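(* Let $X,Y,Z$ be sets of size $n$, let $E\subset X\times Y$, and let $\lambda:E\to Z$ be such that $(X,Y,Z,E,\lambda)$ is a partial Latin square with at least $\epsilon n^5$ octahedra. Then for every positive integer $b$ there exist a subset $A\subset E$ with $|A|\geq \epsilon^{b^{25b}}n^2$, a metric group $G$, and maps $\phi:X\to G$, $\psi:Y\to G$ and $\omega:Z\to G$, such that each of the images $\phi(X),\psi(Y),\omega(Z)$ is $1$-separated, and $d(\phi(x)\psi(y),\omega(z))\leq b^{-1}$ for every $(x,y,z)\in X\times Y\times Z$ such that $(x,y)\in A$ and $\lambda(x,y)=z$.
   Context: A partial Latin square is a quintuple $(X,Y,Z,E,\lambda)$ with $X,Y,Z$ finite sets, $E\subset X\times Y$ and $\lambda:E\to Z$ such that $\lambda(a,b_1)=\lambda(a,b_2)$ implies $b_1=b_2$ and $\lambda(a_1,b)=\lambda(a_2,b)$ implies $a_1=a_2$. An octahedron is a pair of rectangles $((x_1,y_1),(x_2,y_1),(x_1,y_2),(x_2,y_2))\in E^4$ and $((x_3,y_3),(x_4,y_3),(x_3,y_4),(x_4,y_4))\in E^4$ with $\lambda(x_1,y_1)=\lambda(x_3,y_3)$, $\lambda(x_2,y_1)=\lambda(x_4,y_3)$, $\lambda(x_1,y_2)=\lambda(x_3,y_4)$, $\lambda(x_2,y_2)=\lambda(x_4,y_4)$ (degeneracies allowed; octahedra counted as ordered tuples $(x_1,x_2,y_1,y_2,x_3,x_4,y_3,y_4)$). A metric group is a group with a bi-invariant metric, possibly taking the value $+\infty$; a set is $1$-separated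 if any two distinct elements are at distance at least $1$. *)

(* Defs.v *)
From HB Require Import structures.
From mathcomp Require Import all_boot all_order all_algebra.
From mathcomp Require Import all_classical all_reals all_analysis.

Set Implicit Arguments.
Unset Strict Implicit.
Unset Printing Implicit Defensive.

Import Order.TTheory GRing.Theory Num.Theory.

Local Open Scope ring_scope.

(* The labelling is a total function X * Y -> Z; only its restriction to E is
   ever used, so it stands for a function E -> Z. *)
Definition partial_latin_square (X Y Z : finType) (E : {set X * Y})
    (lam : X * Y -> Z) : Prop :=
  (forall a b1 b2, (a, b1) \in E -> (a, b2) \in E ->
     lam (a, b1) = lam (a, b2) -> b1 = b2) /\
  (forall a1 a2 b, (a1, b) \in E -> (a2, b) \in E ->
     lam (a1, b) = lam (a2, b) -> a1 = a2).

Definition octahedron (X Y Z : finType) (E : {set X * Y})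
    (lam : X * Y -> Z) (x1 x2 : X) (y1 y2 : Y) (x3 x4 : X) (y3 y4 : Y) : bool :=
  [&& (x1, y1) \in E, (x2, y1) \in E, (x1, y2) \in E, (x2, y2) \in E,
      (x3, y3) \in E, (x4, y3) \in E, (x3, y4) \in E, (x4, y4) \in E,
      lam (x1, y1) == lam (x3, y3), lam (x2, y1) == lam (x4, y3),
      lam (x1, y2) == lam (x3, y4) & lam (x2, y2) == lam (x4, y4)].

Definition octahedra (X Y Z : finType) (E : {set X * Y}) (lam : X * Y -> Z) :
    {set X * X * Y * Y * X * X * Y * Y} :=
  [set o | let: (x1, x2, y1, y2, x3, x4, y3, y4) := o in
           octahedron E lam x1 x2 y1 y2 x3 x4 y3 y4].

(* A metric group is a group G (not necessarily finite) with such a d. *)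
Record biinvariant_metric (R : realType) (G : groupType)
    (d : G -> G -> \bar R) : Prop := BiinvariantMetric {
  bimetric_ge0 : forall g h, (0 <= d g h)%E ;
  bimetric_eq0 : forall g h, d g h = 0%E <-> g = h ;
  bimetric_sym : forall g h, d g h = d h g ;
  bimetric_triangle : forall g h k, (d g k <= d g h + d h k)%E ;
  bimetric_left : forall k g h, d (k * g)%g (k * h)%g = d g h ;
  bimetric_right : forall k g h, d (g * k)%g (h * k)%g = d g h }.

Definition one_separated (R : realType) (T : Type) (d : T -> T -> \bar R)
    (S : set T) : Prop :=
  forall g h, S g -> S h -> g <> h -> (1 <= d g h)%E.

(* The 1-separated image of a map is understood as an embedding: distinct
   points of X are sent to points at distance at least 1.  If points could be
   identified, constant maps into a trivial group would always qualify. *)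
Definition one_separated_image (R : realType) (G : Type)
    (d : G -> G -> \bar R) (T : Type) (f : T -> G) : Prop :=
  injective f /\ one_separated d (range f).

(* Main.v *)
Require Import Defs.
From HB Require Import structures.
From mathcomp Require Import all_boot all_order all_algebra all_fingroup.
From mathcomp Require Import all_classical all_reals all_analysis.
From mathcomp Require Import zify ring lra.

Set Implicit Arguments.
Unset Strict Implicit.
Unset Printing Implicit Defensive.

Import Order.TTheory GRing.Theory Num.Theory.

(** Read the cell (x, y) with label z as a triangle with sides x, y, z^-1.  The
    group is the free group on rows, columns and symbols, and b * d(g, h) is the
    area of g h^-1, the least number of triangles in a van Kampen diagram.  Then
    d(x y, z) <= 1/b for free, and only the separation matters: two rows x, x' are
    closer than 1 exactly when some disc of fewer than b triangles has boundary
    x x'^-1, and counting sides rules this out if b <= 2.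

    If eps is not close to 1, dependent random choice (random shifts that move
    a triangle across an octahedron) gives a dense set of triangles in which, for
    almost every bounded star, a positive proportion of all vertices could replace
    its hub.  Discs are built
    from triangles by merging along an edge and by folding an edge, and at good
    edges either step can be imitated by summing over all nearby edges.  So there
    are boundedly many kernels, weights of mass at most 1 on words, that see every
    small disc with a definite popularity; hence only boundedly many x' lie near
    a given x.  A proper colouring of this nearness graph and its most popular
    colour classes separate all letters.

    If eps >= 1 - 1/(2b + 4), fix a cell (x0, y0) lying in eps n^3 octahedra.  Rows,
    columns and symbols then act as partial injections u -> y -> w on symbols
    that are compatible whenever an octahedron through (x0, y0) says so; extend them
    to permutations and use the normalized Hamming metric.  Letters without good
    cells are put at infinite distance by means of a second factor. *)

(** * Free groups *)

(** The shape of the proof is dictated by the exponent [b ^ (25 * b)]. A disc with [j] faces and two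
    boundary letters is built in [s] steps with [2 * s + 2 = 5 * j], so fewer than [b] faces means
    [s <= S] with [S] about [5 * b / 2]. Each step multiplies the exponent of the popularity by 64,
    since a merge multiplies two popularities and pays for its exceptional sets. The random choice
    needs about [64 ^ S] shifts to beat these losses and a popularity threshold whose exponent is of
    the same size; together they square the exponent. The result is of order [64 ^ (5 * b)], and
    [64 < 3 ^ 4 <= b ^ 4]. Along the way factors such as [2 ^ (40 * b)] are lost. They can be paid
    by powers of [eps] only while [eps] stays away from 1: below the threshold,
    [eps ^+ (2 * b + 4) <= 1/2]. Near 1 the required density itself tends to 1, so no constant may
    be lost. This forces the second construction, whose density [1 - (b + 2) * (1 - eps)] is
    compared with [eps ^+ (2 * (b + 2))]. *)

Definition letter (A : Type) : Type := A * bool.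
Definition linv (A : Type) (s : letter A) : letter A := (s.1, ~~ s.2).

Lemma linvK (A : Type) : involutive (@linv A).
Proof. by case=> a s; rewrite /linv /= negbK. Qed.

Section FreeGroup.
Variable A : choiceType.
Local Notation T := (A * bool)%type.
Implicit Types (s t : T) (u v w : seq T).

Definition reduced w := sorted (fun s t => t != linv s) w.

Definition push s w :=
  if w is t :: w' then if t == linv s then w' else s :: w else [:: s].

Lemma push_reduced s w : reduced w -> reduced (push s w).
Proof.
case: w => [//|t w] /= rw; case: eqP => [_|/eqP nt] /=; last by rewrite nt rw.
by case: w rw => //= x w /andP[].
Qed.

Lemma push_invK s w : reduced w -> push (linv s) (push s w) = w.
Proof.
case: w => [|t w] /=; first by rewrite linvK eqxx.
move=> rw; case: eqP rw => [->|_] rw /=; last by rewrite linvK eqxx.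
case: w rw => [//|x w] /= /andP[nx _].
by rewrite (negPf nx).
Qed.

(** Van der Waerden's trick: [push s] and [push (linv s)] are inverse bijections of the reduced
    words, so words act on normal forms and associativity needs no confluence argument. *)
Definition pushs w v := foldr push v w.

Lemma pushs_reduced w v : reduced v -> reduced (pushs w v).
Proof. by move=> rv; elim: w => [//|s w IH] /=; apply: push_reduced. Qed.

Lemma pushs_cat u v w : pushs (u ++ v) w = pushs u (pushs v w).
Proof. exact: foldr_cat. Qed.

Lemma pushs_id w : reduced w -> pushs w [::] = w.
Proof.
elim: w => [//|s w IH] rw /=.
rewrite IH; last by case: w rw {IH} => //= x w /andP[].
by case: w rw {IH} => [//|t w] /= /andP[/negPf -> _].
Qed.

Lemma pushs_push s w v : reduced v -> pushs (push s w) v = push s (pushs w v).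
Proof.
case: w => [//|t w] rv /=; case: eqP => [->|_] //=.
by have := push_invK (linv s) (pushs_reduced w rv); rewrite linvK.
Qed.

Lemma pushsA u v w : reduced w -> pushs (pushs u v) w = pushs u (pushs v w).
Proof.
by move=> rw; elim: u => [//|s u IH] /=; rewrite pushs_push // IH.
Qed.

Definition word_inv w := rev (map (@linv A) w).

Lemma word_invK : involutive word_inv.
Proof.
by move=> w; rewrite /word_inv map_rev revK mapK //; apply: linvK.
Qed.

Lemma word_inv_cat u v : word_inv (u ++ v) = word_inv v ++ word_inv u.
Proof. by rewrite /word_inv map_cat rev_cat. Qed.

Lemma pushs_invl w v : reduced v -> pushs (word_inv w) (pushs w v) = v.
Proof.
elim: w v => [//|s w IH] v rv.
have -> : word_inv (s :: w) = word_inv w ++ [:: linv s].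
  by rewrite -cat1s word_inv_cat.
by rewrite (pushs_cat (word_inv w)) /= push_invK ?IH // pushs_reduced.
Qed.

Record free_group := FreeGroup { fword :> seq T; fword_reduced : reduced fword }.

HB.instance Definition _ := [isSub for fword].
HB.instance Definition _ := [Choice of free_group by <:].

Definition fg_of w := FreeGroup (pushs_reduced w (isT : reduced [::])).
Definition fg_mul (g h : free_group) := fg_of (g ++ h).
Definition fg_one := fg_of [::].
Definition fg_inv (g : free_group) := fg_of (word_inv g).

Lemma fg_of_word (g : free_group) : fg_of g = g.
Proof. by apply: val_inj; rewrite /= pushs_id // fword_reduced. Qed.

Lemma fg_of_cat u v : fg_of (u ++ v) = fg_mul (fg_of u) (fg_of v).
Proof.
by apply: val_inj; rewrite /= !pushs_cat pushsA ?pushs_reduced // (pushsA v).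
Qed.

Lemma fg_mulA : associative fg_mul.
Proof.
by move=> g h k; rewrite -(fg_of_word g) -(fg_of_word h) -(fg_of_word k)
  -!fg_of_cat catA.
Qed.

Lemma fg_mul1 : left_id fg_one fg_mul.
Proof. by move=> g; rewrite -(fg_of_word g) -fg_of_cat. Qed.

Lemma fg_1mul : right_id fg_one fg_mul.
Proof. by move=> g; rewrite -(fg_of_word g) -fg_of_cat cats0. Qed.

Lemma fg_of_invl w : fg_of (word_inv w ++ w) = fg_one.
Proof. by apply: val_inj; rewrite /= pushs_cat pushs_invl. Qed.

Lemma fg_mulV : left_inverse fg_one fg_inv fg_mul.
Proof.
by move=> g; rewrite -{2}(fg_of_word g) -fg_of_cat fg_of_invl.
Qed.

Lemma fg_Vmul : right_inverse fg_one fg_inv fg_mul.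
Proof.
move=> g; rewrite -{1}(fg_of_word g) -fg_of_cat -{1}(word_invK g).
exact: fg_of_invl.
Qed.

HB.instance Definition _ := isGroup.Build free_group
  fg_mulA fg_mul1 fg_1mul fg_mulV fg_Vmul.

Lemma fgM u v : fg_of (u ++ v) = (fg_of u * fg_of v)%g.
Proof. exact: fg_of_cat. Qed.

Lemma fgV w : fg_of (word_inv w) = (fg_of w)^-1%g.
Proof.
by apply: (@mulgI _ (fg_of w)); rewrite mulgV -fgM -{1}(word_invK w) fg_of_invl.
Qed.

End FreeGroup.

(** * Areas of words and van Kampen discs *)

Lemma cat_eq_cons (T : Type) (x y u v : seq T) s : x ++ y = u ++ s :: v ->
  (exists x', x = u ++ s :: x' /\ v = x' ++ y) \/
  (exists y', y = y' ++ s :: v /\ u = x ++ y').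
Proof.
elim: x u => [|a x IH] [|b u] /=.
- by move=> ->; right; exists [::].
- by move=> ->; right; exists (b :: u).
- by case=> -> <-; left; exists x.
case=> -> /IH[[x' [-> ->]]|[y' [-> ->]]]; first by left; exists x'.
by right; exists y'.
Qed.

Section Discs.
Variables (A : choiceType) (face : A * bool -> A * bool -> A * bool -> Prop).
Local Notation T := (A * bool)%type.
Implicit Types (a b c : T) (u v w : seq T).
Hypothesis face_sign : forall a b c, face a b c -> a.2 = b.2 /\ b.2 = c.2.
Hypothesis face_inv : forall a b c,
  face a b c -> face (linv c) (linv b) (linv a).

(* Boundary words of discs obtained by gluing faces: [j] counts the faces and
   [s] the construction steps. *)
Inductive disc : nat -> nat -> seq T -> Prop :=
| disc_face a b c : face a b c -> disc 1 1 [:: a; b; c]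
| disc_rot s j u v : disc s j (u ++ v) -> disc s j (v ++ u)
| disc_merge s j s' j' u v a : u <> [::] -> v <> [::] ->
    disc s j (rcons u a) -> disc s' j' (rcons v (linv a)) ->
    disc (s + s').+1 (j + j') (u ++ v)
| disc_fold s j u a : u <> [::] -> disc s j (u ++ [:: a; linv a]) ->
    disc s.+1 j u.

(** A merge or a fold adds one step and removes two boundary letters, and a face starts with
    [2 * 1 + 3 = 5]. Bounds on area thus become bounds on the number of steps. *)
Lemma disc_steps s j w : disc s j w -> 2 * s + size w = 5 * j.
Proof.
elim=> {s j w} //= [s j u v _|s j s' j' u v a _ _ _|s j u a _ _];
  rewrite ?size_rcons !size_cat /=; lia.
Qed.

Lemma disc_letters (P : T -> Prop) s j w :
  (forall a b c, face a b c -> [/\ P a, P b & P c]) -> disc s j w ->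
  forall a, a \in w -> P a.
Proof.
move=> Pf; elim=> {s j w} [a b c /Pf[Pa Pb Pc]|s j u v _ IH
  |s j s' j' u v a _ _ _ IHu _ IHv|s j u a _ _ IH] x.
- by rewrite !inE => /or3P[] /eqP->.
- by move=> xw; apply: IH; rewrite mem_cat orbC -mem_cat.
- rewrite mem_cat => /orP[xu|xv]; [apply: IHu | apply: IHv];
  by rewrite mem_rcons inE ?xu ?xv orbT.
- by move=> xu; apply: IH; rewrite mem_cat xu.
Qed.

(** Modulo 3 this is the exponent sum. It kills every face, because a face consists of three letters
    of equal sign, but no single letter; so no disc bounds a single letter. *)
Definition turn w := \sum_(a <- w) (if a.2 then 1 else 2).

Lemma turn_disc s j w : disc s j w -> turn w %% 3 = 0.
Proof.
rewrite /turn.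
elim=> {s j w} [a b c /face_sign[]|s j u v _|s j s' j' u v a _ _ _ + _
  |s j u a _ _]; rewrite -?cats1 ?big_cat ?big_cons ?big_nil /=;
  try case: a => ? []; rewrite /=; try lia.
- by case: b c => [? []] [? []].
- by case: b c => [? []] [? []].
Qed.

Lemma disc_size s j w : disc s j w -> 1 < size w.
Proof.
elim=> {s j w} //= [s j u v _|s j s' j' u v a u0 v0 _ _ _ _|s j u a u0 d _].
- by rewrite !size_cat addnC.
- by rewrite size_cat; case: u v u0 v0 => [|? u] [|? v] //= _ _; lia.
have := turn_disc d; case: u u0 {d} => [//|x [|y u]] //= _.
by rewrite /turn !big_cons big_nil; case: (x) => ? []; case: (a) => ? [].
Qed.

Definition block j w :=
  (exists2 a, w = [:: a; linv a] & j = 0) \/ exists s, disc s j w.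

Lemma block_size j w : block j w -> 1 < size w.
Proof. by case=> [[a ->]//|[s /disc_size]]. Qed.

Lemma block_rot j u v : block j (u ++ v) -> block j (v ++ u).
Proof.
case=> [[a e j0]|[s d]]; last by right; exists s; apply: disc_rot.
left; case: u e => [|x [|y [|z u]]] //=.
- by move=> ->; exists a; rewrite ?cats0.
- by case=> ex ev; subst; exists (linv a); rewrite /= ?linvK.
- by case=> ex ey ev; subst; exists a.
Qed.

Lemma block_glue i j u v w a :
  block i (u ++ a :: v) -> block j (linv a :: w) ->
  block (i + j) (u ++ w ++ v).
Proof.
case=> [[b e ->]|[s d]] bl; first rewrite add0n.
  case: u e => [|x [|y u]] /= e; last by case: u e.
    by case: e => ea ev; subst; apply: (@block_rot _ [:: _]).
  by case: e => ex ea ev; subst; rewrite linvK in bl; rewrite cats0.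
case: bl => [[b [<- ->] ->]|[s' d']].
  by rewrite addn0 linvK; right; exists s.
have d1 : disc s i (rcons (v ++ u) a).
  by rewrite -cats1 -catA; apply: disc_rot; rewrite -catA.
have d2 : disc s' j (rcons w (linv a)).
  by rewrite -cats1; apply: disc_rot.
right; exists (s + s').+1; rewrite catA; apply: disc_rot; rewrite catA.
apply: (disc_merge _ _ d1 d2).
  by move=> vu0; have := disc_size d1; rewrite vu0.
by move=> w0; have := disc_size d2; rewrite w0.
Qed.

Lemma block_cancel j u v a : block j (u ++ a :: linv a :: v) ->
  u ++ v = [::] \/ block j (u ++ v).
Proof.
case=> [[b e _]|[s d]].
  by left; move/(congr1 size): e; rewrite size_cat /=; case: u => [|? u]; case: v => //=; lia.
case: (u ++ v =P [::]) => [|n]; [by left | right; right].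
exists s.+1; apply: disc_rot; apply: (@disc_fold s j _ a).
  by move/(congr1 size); rewrite size_cat addnC -size_cat => /size0nil.
by rewrite -catA; apply: disc_rot; rewrite -catA.
Qed.

(* Words cut into blocks along a noncrossing partition; the index is the total
   number of faces. *)
Inductive blocks : nat -> seq T -> Prop :=
| blocks_nil : blocks 0 [::]
| blocks_insert k j u v w : blocks k (u ++ v) -> block j w ->
    blocks (k + j) (u ++ w ++ v).

(** Induction on the insertions: either [a] lies in the last inserted block, which is then glued to
    the new one, or it lies beside that block and the insertion commutes with the gluing. *)
Lemma blocks_glue k u a v : blocks k (u ++ a :: v) ->
  forall j w, block j (linv a :: w) -> blocks (k + j) (u ++ w ++ v).
Proof.
move e: (u ++ a :: v) => x bx.
elim: bx u v e => {k x} [|k i u0 v0 w0 b0 IH bl0] u v e j w bl.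
  by case: u e.
case: (cat_eq_cons (esym e)) => {e} [[x [e ->]]|[y [e ->]]].
  have := IH u (x ++ v0); rewrite e -catA => /(_ erefl _ _ bl) b1.
  have -> : u ++ w ++ x ++ w0 ++ v0 = (u ++ w ++ x) ++ w0 ++ v0.
    by rewrite -!catA.
  by rewrite addnAC; apply: blocks_insert; rewrite // -!catA.
case: (cat_eq_cons e) => {e} [[x [e ->]]|[z [e ->]]].
  rewrite e in bl0; have -> : (u0 ++ y) ++ w ++ x ++ v0 = u0 ++ (y ++ w ++ x) ++ v0.
    by rewrite -!catA.
  by rewrite -addnA; apply: blocks_insert => //; apply: block_glue bl0 bl.
have := IH (u0 ++ z) v; rewrite e -catA => /(_ erefl _ _ bl) b1.
by rewrite addnAC -!catA; apply: blocks_insert; rewrite // -catA in b1.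
Qed.

(** Adjacent inverse letters in one block are folded; in two blocks they are the edge along which
    the blocks are glued. A block that closes up completely is dropped, which is why [k'] may be
    smaller. *)
Lemma blocks_cancel k u a v : blocks k (u ++ a :: linv a :: v) ->
  exists2 k', k' <= k & blocks k' (u ++ v).
Proof.
move e: (u ++ a :: linv a :: v) => x bx.
elim: bx u v e => {k x} [|k i u0 v0 w0 b0 IH bl0] u v e.
  by case: u e.
case: (cat_eq_cons (esym e)) => {e} [[[|x0 x] [e ev]]|[y [e ->]]].
- case: w0 bl0 ev => [/block_size//|b w0] bl0 [eb ->].
  exists (k + i); rewrite // e -catA in b0 *.
  by apply: (blocks_glue b0); rewrite eb.
- case: ev => ex ->; rewrite -ex in e.
  have := IH u (x ++ v0); rewrite e -catA => /(_ erefl)[k' lek b1].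
  exists (k' + i); first by rewrite leq_add2r.
  by rewrite catA; apply: blocks_insert; rewrite // -catA.
- case: (cat_eq_cons e) => {e} [[[|x0 x] [e ev]]|[z [e ->]]].
  + rewrite e in bl0; exists (k + i) => //; rewrite -catA; rewrite /= in ev.
    rewrite -ev in b0; apply: (blocks_glue b0); rewrite linvK.
    exact: (@block_rot _ y [:: a]).
  + case: ev => ex ->; rewrite e -ex in bl0.
    case: (block_cancel bl0) => [y0|bl1].
      exists k; first exact: leq_addr.
      by rewrite -catA (catA y) y0.
    by exists (k + i); rewrite // -catA (catA y); apply: blocks_insert.
have := IH (u0 ++ z) v; rewrite e -catA => /(_ erefl)[k' lek b1].
exists (k' + i); first by rewrite leq_add2r.
by rewrite -!catA; apply: blocks_insert; rewrite // -catA in b1.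
Qed.

Lemma blocks_pairs k u v w : blocks k (u ++ v) ->
  blocks k (u ++ w ++ word_inv w ++ v).
Proof.
elim: w u v => [//|a w IH] u v b.
have -> : word_inv (a :: w) = word_inv w ++ [:: linv a].
  by rewrite -cat1s word_inv_cat.
rewrite -cat1s -!catA (catA u); apply: IH; rewrite -catA -[k]addn0.
by apply: (@blocks_insert _ _ _ _ [:: a; linv a]) => //; left; exists a.
Qed.

Lemma blocks_pushs k u w : blocks k (u ++ w) ->
  exists2 k', k' <= k & blocks k' (u ++ pushs w [::]).
Proof.
elim: w k u => [|a w IH] k u /=; first by exists k.
rewrite -cat1s catA => /IH[k1 le1]; rewrite -catA /=.
case: (pushs w [::]) => [|b x] /= b1; first by exists k1.
case: eqP b1 => [->|_] b1; last by exists k1.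
by have [k2 le2 b2] := blocks_cancel b1; exists k2 => //; apply: leq_trans le1.
Qed.

Inductive area : nat -> free_group A -> Prop :=
| area0 : area 0 1%g
| areaS k g h a b c : area k g -> face a b c ->
    area k.+1 (g * (h * fg_of [:: a; b; c] * h^-1))%g.

(** Van Kampen's lemma: a product of conjugates of faces, written without cancellation, consists of
    one-face blocks and cancelling pairs, and free reduction only glues, folds or drops blocks. *)
Lemma area_blocks k g : area k g -> exists2 k', k' <= k & blocks k' g.
Proof.
elim=> {k g} [|k g h a b c _ [k1 le1 b1] fabc].
  by exists 0 => //; apply: blocks_nil.
have b2 : blocks (k1 + 1) (g ++ h ++ [:: a; b; c] ++ word_inv h).
  rewrite catA; apply: blocks_insert; last by right; exists 1; apply: disc_face.
  rewrite -catA -[word_inv h]cats0; apply: blocks_pairs; rewrite cats0 //.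
have := @blocks_pushs _ [::] _ b2 => -[k2 le2 b3].
exists k2; first by rewrite (leq_trans le2) // addn1.
suff -> : (g * (h * fg_of [:: a; b; c] * h^-1))%g =
  fg_of (g ++ h ++ [:: a; b; c] ++ word_inv h) by [].
by rewrite !fgM fgV !fg_of_word !mulgA.
Qed.

Lemma areaM k l g h : area k g -> area l h -> area (k + l) (g * h)%g.
Proof.
move=> ag; elim=> {l h} [|l h x a b c _ IH fabc]; first by rewrite addn0 mulg1.
by rewrite addnS mulgA; apply: areaS.
Qed.

Lemma areaJ k g x : area k g -> area k (x * g * x^-1)%g.
Proof.
elim=> {k g} [|k g h a b c _ IH fabc]; first by rewrite mulg1 mulgV; apply: area0.
have -> : (x * (g * (h * fg_of [:: a; b; c] * h^-1)) * x^-1 =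
  (x * g * x^-1) * ((x * h) * fg_of [:: a; b; c] * (x * h)^-1))%g.
  by rewrite invgM !mulgA mulgVK.
exact: areaS.
Qed.

Lemma area1 a b c : face a b c -> area 1 (fg_of [:: a; b; c]).
Proof.
move=> fabc; have := areaS 1%g area0 fabc.
by rewrite mul1g invg1 mulg1 mul1g.
Qed.

Lemma areaV k g : area k g -> area k (g^-1)%g.
Proof.
elim=> {k g} [|k g h a b c ag IH fabc]; first by rewrite invg1; apply: area0.
rewrite !invgM invgK -fgV -add1n; apply: areaM => //.
have -> : word_inv [:: a; b; c] = [:: linv c; linv b; linv a] by [].
by rewrite mulgA; apply: areaJ; apply: area1; apply: face_inv.
Qed.

Lemma area0_eq1 g : area 0 g -> g = 1%g.
Proof. by move e: 0 => k a; case: a e. Qed.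

(** As [x <> y], the word is already reduced. A block has at least two letters, so the two letters
    form one block, and it is not a cancelling pair. *)
Lemma area_disc k x y : x <> y -> area k (fg_of [:: x; linv y]) ->
  exists s j, j <= k /\ disc s j [:: x; linv y].
Proof.
move=> nxy /area_blocks[k1 le1].
have -> : fword (fg_of [:: x; linv y]) = [:: x; linv y].
  rewrite /= ; case: eqP => // e; case: nxy.
  by rewrite -(linvK x) -(linvK y) e !linvK.
move e: [:: x; _] => w b; case: b le1 e => [//|k2 j u v z _ bl le1 e].
have := block_size bl; move/(congr1 size): (e); rewrite !size_cat /= /letter => sz sz1.
have /size0nil u0 : size u = 0 by lia.
have /size0nil v0 : size v = 0 by lia.
move: e; rewrite u0 v0 cats0 /= => e.
case: bl => [[a ez _]|[s d]]; last first.
  by exists s, j; split; [apply: leq_trans le1; apply: leq_addl |].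
case: nxy; move: (congr1 (nth x ^~ 0) e) (congr1 (nth x ^~ 1) e).
by rewrite ez /= => -> /(congr1 (@linv A)); rewrite !linvK.
Qed.

End Discs.
Local Open Scope ring_scope.

(** * Fans of faces along padded words *)

(** Cutting at position [n] leaves the marked letter in only one of the pieces. The kernels below
    are built by cutting words, and their sums over one letter are bounded by locating this
    letter. *)
Lemma take_drop_letter (T : Type) n (U V : seq T) :
  (exists A, forall y, take n (U ++ y :: V) = U ++ y :: A) /\
    (exists B, forall y, drop n (U ++ y :: V) = B) \/
  (exists A, forall y, take n (U ++ y :: V) = A) /\
    (exists B C, forall y, drop n (U ++ y :: V) = B ++ y :: C).
Proof.
case: (leqP n (size U)) => [le|lt]; [right | left].
  split; first by exists (take n U) => y; rewrite takel_cat.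
  exists (drop n U), V => y; rewrite drop_cat; case: ltnP => // ge.
  by rewrite (_ : n = size U) ?subnn ?drop_size //; apply/eqP; rewrite eqn_leq le.
have [k ->] : exists k, n = (size U + k.+1)%N by exists (n - (size U).+1)%N; lia.
split; [exists (take k V) | exists (drop k V)] => y.
  by rewrite take_cat ltnNge leq_addr addKn.
by rewrite drop_cat ltnNge leq_addr addKn.
Qed.

(** * Sums over all words of a given length *)

Section Sums.
Variables (R : realFieldType) (T : finType).
Implicit Types (f g : seq T -> R) (k : nat).

Fixpoint sums k f : R :=
  if k is k'.+1 then \sum_x sums k' (fun s => f (x :: s)) else f [::].

Lemma eq_sums k f g : (forall s, size s = k -> f s = g s) ->
  sums k f = sums k g.
Proof.
elim: k f g => [|k IH] f g e /=; first exact: e.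
by apply: eq_bigr => x _; apply: IH => s sk; apply: e; rewrite /= sk.
Qed.

Lemma le_sums k f g : (forall s, size s = k -> f s <= g s) ->
  sums k f <= sums k g.
Proof.
elim: k f g => [|k IH] f g e /=; first exact: e.
by apply: ler_sum => x _; apply: IH => s sk; apply: e; rewrite /= sk.
Qed.

Lemma sumsS k f : sums k.+1 f = \sum_x sums k (fun s => f (x :: s)).
Proof. by []. Qed.

Lemma sums1 f : sums 1 f = \sum_x f [:: x].
Proof. by []. Qed.

Lemma sums_const k c : sums k (fun=> c) = #|T|%:R ^+ k * c.
Proof.
elim: k => [|k IH]; first by rewrite expr0 mul1r.
by rewrite sumsS IH sumr_const exprS -mulrA mulr_natl.
Qed.

Lemma sums0 k : sums k (fun=> 0) = 0.
Proof. by rewrite sums_const mulr0. Qed.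

Lemma sums_ge0 k f : (forall s, size s = k -> 0 <= f s) -> 0 <= sums k f.
Proof. by move=> f0; rewrite -(sums0 k); apply: le_sums. Qed.

Lemma sumsD k f g : sums k (fun s => f s + g s) = sums k f + sums k g.
Proof.
elim: k f g => [//|k IH] f g; rewrite !sumsS -big_split.
by apply: eq_bigr => x _; rewrite IH.
Qed.

Lemma sumsZ k c f : sums k (fun s => c * f s) = c * sums k f.
Proof.
elim: k f => [//|k IH] f; rewrite !sumsS mulr_sumr.
by apply: eq_bigr => x _; rewrite IH.
Qed.

Lemma sumsZr k c f : sums k (fun s => f s * c) = sums k f * c.
Proof. by rewrite mulrC -sumsZ; apply: eq_sums => s _; rewrite mulrC. Qed.

Lemma sums_cat m n f :
  sums (m + n) f = sums m (fun u => sums n (fun v => f (u ++ v))).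
Proof.
elim: m f => [//|m IH] f; rewrite addSn !sumsS.
by apply: eq_bigr => x _; rewrite IH.
Qed.

Lemma sums_rcons k f : sums k.+1 f = sums k (fun u => \sum_x f (rcons u x)).
Proof.
rewrite -addn1 sums_cat; apply: eq_sums => u _.
by rewrite sums1; apply: eq_bigr => x _; rewrite cats1.
Qed.

Lemma exchange_sums (I : finType) k (f : I -> seq T -> R) :
  sums k (fun s => \sum_i f i s) = \sum_i sums k (f i).
Proof.
elim: k f => [//|k IH] f; rewrite sumsS.
under eq_bigr do rewrite IH.
by rewrite exchange_big.
Qed.

Lemma sums_sums k l (f : seq T -> seq T -> R) :
  sums k (fun s => sums l (f s)) = sums l (fun t => sums k (f ^~ t)).
Proof.
elim: k f => [//|k IH] f; rewrite sumsS; under eq_bigr do rewrite IH.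
by rewrite -exchange_sums.
Qed.

End Sums.
Arguments sums : simpl never.

(** * Sequences of spokes, annuli and kernels *)

Section Paths.
Variables (R : realFieldType) (T : finType) (inv : T -> T).
Variable F : T -> T -> T -> bool.
Hypothesis Fdet1 : forall a a' u h, F a u h -> F a' u h -> a = a'.
Hypothesis Fdet2 : forall a u u' h, F a u h -> F a u' h -> u = u'.
Hypothesis Fdet3 : forall a u h h', F a u h -> F a u h' -> h = h'.
Local Notation N := (#|T|%:R : R).
Implicit Types (a b c u : T) (t : option T) (W : seq (option T)) (U V : seq T).

(* [a u = t b], where [t] is a letter or the empty word. *)
Definition step a t u b :=
  if t is Some s then [exists h, F a u h && F s b h] else F a u b.

Lemma step_det1 a a' t u b : step a t u b -> step a' t u b -> a = a'.
Proof.
case: t => [s|] /=; last exact: Fdet1.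
move=> /existsP[h /andP[ah sh]] /existsP[h' /andP[ah' sh']].
by move: (Fdet3 sh sh') ah' => <-; apply: Fdet1.
Qed.

Lemma step_det2 a t u u' b : step a t u b -> step a t u' b -> u = u'.
Proof.
case: t => [s|] /=; last exact: Fdet2.
move=> /existsP[h /andP[ah sh]] /existsP[h' /andP[ah' sh']].
by move: (Fdet3 sh sh') ah' => <-; apply: Fdet2.
Qed.

Lemma step_det3 a t u b b' : step a t u b -> step a t u b' -> b = b'.
Proof.
case: t => [s|] /=; last exact: Fdet3.
move=> /existsP[h /andP[ah sh]] /existsP[h' /andP[ah' sh']].
by move: (Fdet3 ah ah') sh' => <-; apply: Fdet2.
Qed.

Lemma sum_uniq_le1 (I : finType) (P : pred I) :
  (forall i j, P i -> P j -> i = j) -> \sum_i (P i)%:R <= 1 :> R.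
Proof.
move=> uP; case: (pickP P) => [i Pi|P0].
  rewrite (bigD1 i) //= Pi big1 ?addr0 // => j nji.
  by case: (boolP (P j)) => // Pj; rewrite (uP _ _ Pi Pj) eqxx in nji.
by rewrite big1 ?ler01 // => i _; rewrite P0.
Qed.

Lemma sum_step1 t u b : \sum_a (step a t u b)%:R <= 1 :> R.
Proof. by apply: sum_uniq_le1 => a a'; apply: step_det1. Qed.

Lemma sum_step2 a t b : \sum_u (step a t u b)%:R <= 1 :> R.
Proof. by apply: sum_uniq_le1 => u u'; apply: step_det2. Qed.

Lemma sum_step3 a t u : \sum_b (step a t u b)%:R <= 1 :> R.
Proof. by apply: sum_uniq_le1 => b b'; apply: step_det3. Qed.

(* The number of sequences of spokes leading from [a] to [b] along the padded
   word [W] of boundary letters, with [V] the word of opposite edges. *)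
Fixpoint paths a W V b : R :=
  match W, V with
  | [::], [::] => (a == b)%:R
  | t :: W', u :: V' => \sum_c (step a t u c)%:R * paths c W' V' b
  | _, _ => 0
  end.

Lemma paths_ge0 a W V b : 0 <= paths a W V b.
Proof.
elim: W V a => [|t W IH] [|u V] a //=.
by apply: sumr_ge0 => c _; apply: mulr_ge0.
Qed.

Lemma sum_delta (I : finType) (i : I) (f : I -> R) :
  \sum_j (i == j)%:R * f j = f i.
Proof.
rewrite (bigD1 i) //= eqxx mul1r big1 ?addr0 // => j.
by rewrite eq_sym => /negPf->; rewrite mul0r.
Qed.

Lemma paths_size a W V b : size W != size V -> paths a W V b = 0.
Proof.
elim: W V a => [|t W IH] [|u V] a //= sWV.
by rewrite big1 // => c _; rewrite IH ?mulr0.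
Qed.

Lemma paths_cat a W1 W2 V1 V2 b : size W1 = size V1 ->
  paths a (W1 ++ W2) (V1 ++ V2) b =
  \sum_c paths a W1 V1 c * paths c W2 V2 b.
Proof.
elim: W1 V1 a => [|t W1 IH] [|u V1] a //=; first by rewrite sum_delta.
move=> [sW]; under [RHS]eq_bigr do rewrite mulr_suml.
rewrite exchange_big; apply: eq_bigr => c _.
by rewrite IH // mulr_sumr; apply: eq_bigr => d _; rewrite mulrA.
Qed.

Lemma paths1 a t u b : paths a [:: t] [:: u] b = (step a t u b)%:R.
Proof.
rewrite /= (bigD1 b) //= eqxx mulr1 big1 ?addr0 // => c /negPf->.
by rewrite mulr0.
Qed.

Lemma sum_paths_end a W V : \sum_b paths a W V b <= 1.
Proof.
elim: W V a => [|t W IH] [|u V] a /=; try by rewrite big1.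
  by rewrite (bigD1 a) //= eqxx big1 ?addr0 // => b; rewrite eq_sym => /negPf->.
rewrite exchange_big /=; apply: le_trans (sum_step3 a t u).
by apply: ler_sum => c _; rewrite -mulr_sumr ler_piMr.
Qed.

Lemma sum_paths_start b W V : \sum_a paths a W V b <= 1.
Proof.
elim: W V => [|t W IH] [|u V] /=; try by rewrite big1.
  by rewrite (bigD1 b) //= eqxx big1 ?addr0 // => a /negPf->.
rewrite exchange_big /=; apply: le_trans (IH V).
by apply: ler_sum => c _; rewrite -mulr_suml ler_piMl ?paths_ge0 ?sum_step1.
Qed.

Lemma ler_sum1 (I : finType) (i : I) (f : I -> R) :
  (forall j, 0 <= f j) -> f i <= \sum_j f j.
Proof.
by move=> f0; rewrite (bigD1 i) //= ler_wpDr // sumr_ge0.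
Qed.

Lemma paths_le1 a W V b : paths a W V b <= 1.
Proof.
apply: le_trans (sum_paths_end a W V); apply: (ler_sum1 b (f := paths a W V)).
exact: paths_ge0.
Qed.

(** Both end spokes being given, the [k] spokes in between determine all [k.+1] opposite edges. *)
Lemma sums_paths k a W b : size W = k.+1 ->
  sums k.+1 (fun V => paths a W V b) <= N ^+ k.
Proof.
elim: k a W => [|k IH] a [//|t W] [sW].
  rewrite sums1 expr0; case: W sW => // _.
  by under eq_bigr do rewrite paths1; apply: sum_step2.
rewrite sumsS /=; under eq_bigr do rewrite exchange_sums.
have -> : N ^+ k.+1 = \sum_(c : T) N ^+ k by rewrite sumr_const exprS mulr_natl.
rewrite exchange_big /=; apply: ler_sum => c _.
under eq_bigr do rewrite sumsZ; rewrite -mulr_suml.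
apply: le_trans (IH c W sW); apply: ler_piMl (sum_step2 a t c).
by apply: sums_ge0 => V _; apply: paths_ge0.
Qed.

(** The other edges force the spokes forward from [a] and backward from [b]; the two spokes that
    meet at the gap force the missing edge. *)
Lemma sum_paths_letter a W V1 V2 b : \sum_x paths a W (V1 ++ x :: V2) b <= 1.
Proof.
have [eW|nW] := eqVneq (size W) (size V1 + (size V2).+1)%N; last first.
  by rewrite big1 ?ler01 // => x _; rewrite paths_size // size_cat.
have sW1 : size (take (size V1) W) = size V1.
  by rewrite size_take eW; case: ltnP => //; lia.
rewrite -(cat_take_drop (size V1) W).
under eq_bigr do rewrite paths_cat //.
case: (drop _ W) => [|t W2] /=.
  by rewrite big1 ?ler01 // => x _; rewrite big1 // => c _; rewrite mulr0.
rewrite exchange_big; apply: le_trans (sum_paths_end a (take (size V1) W) V1).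
apply: ler_sum => c _; rewrite -mulr_sumr ler_piMr ?paths_ge0 //.
rewrite exchange_big; apply: le_trans (sum_paths_start b W2 V2).
apply: ler_sum => d _; rewrite -mulr_suml ler_piMl ?paths_ge0 //.
exact: sum_step2.
Qed.

(** Annuli of faces with inner word [W] and outer word [V]. An empty letter of [W] contributes no
    inner edge; if all letters are empty, the inner circle is a hub and [V] is its link. *)
Definition ptrace W V := \sum_a paths a W V a.

Lemma ptrace_ge0 W V : 0 <= ptrace W V.
Proof. by apply: sumr_ge0 => a _; apply: paths_ge0. Qed.

Lemma ptrace_catC W1 W2 V1 V2 : size W1 = size V1 -> size W2 = size V2 ->
  ptrace (W1 ++ W2) (V1 ++ V2) = ptrace (W2 ++ W1) (V2 ++ V1).
Proof.
move=> s1 s2; rewrite /ptrace.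
under eq_bigr do rewrite paths_cat //.
rewrite exchange_big; apply: eq_bigr => c _; rewrite paths_cat //.
by apply: eq_bigr => a _; rewrite mulrC.
Qed.

(* A weight on words that behaves like the indicator of the words representing
   the identity: all letters but one determine the last one. *)
Definition kernel (Psi : seq T -> R) :=
  (forall V, 0 <= Psi V) /\ forall V1 V2, \sum_x Psi (V1 ++ x :: V2) <= 1.

Lemma kernel_le1 Psi V : kernel Psi -> V <> [::] -> Psi V <= 1.
Proof.
case: V => [//|x V] [p0 p1] _; apply: le_trans (p1 [::] V).
exact: (ler_sum1 x (f := fun x => Psi (x :: V))).
Qed.

(** A robust form of the statement that [W] bounds a disc: annuli around [W] often end in words that
    [Psi] takes for trivial. There are at most [N ^ size W] sequences of spokes, each determining
    [V], which explains the normalisation. *)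
Definition popularity Psi W :=
  N ^- size W * sums (size W) (fun V => ptrace W V * Psi V).

Lemma popularityE Psi W : popularity Psi W =
  N ^- size W * sums (size W) (fun V => ptrace W V * Psi V).
Proof. by []. Qed.

Lemma popularity_catC Psi W1 W2 : popularity Psi (W1 ++ W2) =
  popularity (fun V => Psi (rot (size W2) V)) (W2 ++ W1).
Proof.
rewrite /popularity !size_cat addnC; congr (_ * _).
rewrite [in LHS]addnC !sums_cat [LHS]sums_sums; apply: eq_sums => V2 s2 /=.
apply: eq_sums => V1 s1.
by rewrite ptrace_catC ?s1 ?s2 // -s2 rot_size_cat.
Qed.

End Paths.
Arguments paths : simpl never.

(** * Folding and merging discs *)

Section Surgery.
Variables (R : realFieldType) (T : finType) (inv : T -> T).
Variable F : T -> T -> T -> bool.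
Hypothesis Fdet1 : forall a a' u h, F a u h -> F a' u h -> a = a'.
Hypothesis Fdet2 : forall a u u' h, F a u h -> F a u' h -> u = u'.
Hypothesis Fdet3 : forall a u h h', F a u h -> F a u h' -> h = h'.
Local Notation N := (#|T|%:R : R).
Hypothesis N_gt0 : 0 < N.
Hypothesis invK : involutive inv.
Implicit Types (a b c u : T) (W : seq (option T)) (U V : seq T).
Local Notation paths := (@paths R T F).
Local Notation popularity := (@popularity R T F).
Local Notation ptrace := (@ptrace R T F).
Local Notation kernel := (@kernel R T).

Let N_neq0 : N != 0. Proof. by rewrite gt_eqF. Qed.

Lemma sums_paths_le k W a b : size W = k -> (0 < k)%N ->
  sums k (fun V => paths a W V b) <= N ^+ k.-1.
Proof. by case: k => [//|k] sW _; apply: sums_paths. Qed.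

Lemma kernel_cat_le1 Psi U V : kernel Psi -> (0 < size V)%N -> Psi (U ++ V) <= 1.
Proof.
move=> kP; case: V => [//|x V] _; apply: kernel_le1 => //.
by case: U.
Qed.

(* The weight of the part of the filling beyond the segment from [a] to [b]. *)
Definition rest Psi W a b V : R :=
  N ^- size W * sums (size W) (fun U => paths b W U a * Psi (U ++ V)).

Lemma rest_ge0 Psi W a b V : kernel Psi -> 0 <= rest Psi W a b V.
Proof.
move=> [p0 _]; rewrite mulr_ge0 ?invr_ge0 ?exprn_ge0 ?ler0n //.
by apply: sums_ge0 => U _; rewrite mulr_ge0 ?paths_ge0.
Qed.

Lemma rest_le Psi W a b V : kernel Psi -> (0 < size W)%N -> (0 < size V)%N ->
  rest Psi W a b V <= N^-1.
Proof.
move=> kP W0 V0; rewrite /rest.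
have -> : N^-1 = N ^- size W * N ^+ (size W).-1.
  rewrite -[in N ^- _](prednK W0) exprS invfM -mulrA mulVf ?mulr1 //.
  by rewrite expf_eq0 (negPf N_neq0) andbF.
apply: ler_wpM2l; first by rewrite invr_ge0 exprn_ge0 // ltW.
apply: le_trans (sums_paths_le b a (erefl (size W)) W0).
apply: le_sums => U _; rewrite ler_piMr ?paths_ge0 //.
exact: kernel_cat_le1.
Qed.

Lemma popularity_cat Psi W Z : popularity Psi (W ++ Z) =
  N ^- size Z * \sum_a \sum_b sums (size Z) (fun V => paths a Z V b * rest Psi W a b V).
Proof.
rewrite /popularity size_cat exprD invfM -mulrA mulrCA; congr (_ * _).
rewrite sums_cat; transitivity (N ^- size W * \sum_a \sum_b sums (size Z)
  (fun V => sums (size W) (fun U => paths a Z V b * (paths b W U a * Psi (U ++ V))))).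
  congr (_ * _); under [RHS]eq_bigr do under eq_bigr do rewrite sums_sums.
  under [RHS]eq_bigr do rewrite -exchange_sums.
  rewrite -exchange_sums; apply: eq_sums => U sU.
  under [RHS]eq_bigr do rewrite -exchange_sums.
  rewrite -exchange_sums; apply: eq_sums => V sV.
  rewrite /ptrace mulr_suml exchange_big; apply: eq_bigr => b _.
  rewrite paths_cat ?sU // mulr_suml; apply: eq_bigr => a _; ring.
rewrite mulr_sumr; apply: eq_bigr => a _; rewrite mulr_sumr; apply: eq_bigr => b _.
rewrite -sumsZ; apply: eq_sums => V _.
by rewrite sumsZ /rest; ring.
Qed.

Variable K : seq T -> seq T -> R.
Hypothesis K_ge0 : forall V L, 0 <= K V L.
Hypothesis K_unitl : forall V1 V2 L, \sum_x K (V1 ++ x :: V2) L <= 1.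
Hypothesis K_unitr : forall V L1 L2, \sum_x K V (L1 ++ x :: L2) <= 1.

(** A fold or a merge puts three empty letters in place of the edge that disappears. Three is the
    number of faces that lie between the two outer spokes around an endpoint of this edge; see
    [fansE] and [sum_two_edges]. *)
Definition fan3 : seq (option T) := nseq 3 None.
Definition zipper s m : seq (option T) :=
  Some s :: nseq m None ++ [:: Some (inv s)].

Lemma size_zipper s m : size (zipper s m) = m.+2.
Proof. by rewrite /= size_cat size_nseq addn1. Qed.

(** Three opposite edges between given spokes leave at most [N ^ 2] choices, by [sums_paths]. *)
Definition detour a b V : R :=
  N ^- 2 * sums 3 (fun L => paths a fan3 L b * K V L).

Lemma detourE a b V :
  detour a b V = N ^- 2 * sums 3 (fun L => paths a fan3 L b * K V L).
Proof. by []. Qed.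

(* Replacing the edge [s], which occurs twice in succession, by nearby edges
   is possible for all but a proportion [eta] of the configurations around it. *)
Definition fold_good (eta gam : R) m s :=
  \sum_a \sum_b sums m.+2 (fun V =>
    paths a (zipper s m) V b * (detour a b V < gam)%R%:R) <= eta * N ^+ m.+3.

(** [Psi] composed with [K]: the word [V] opposite to the doubled edge is averaged out. One of its
    [m.+2] letters is determined by the others, hence the exponent [m.+1]. *)
Definition fold_kernel n m Psi U : R :=
  N ^- m.+1 * sums m.+2 (fun V => Psi (take n U ++ V) * K V (drop n U)).

Lemma kernel_fold n m Psi : kernel Psi -> kernel (fold_kernel n m Psi).
Proof.
move=> [p0 p1]; split=> [U|U V].
  rewrite mulr_ge0 ?invr_ge0 ?exprn_ge0 ?ler0n //.
  by apply: sums_ge0 => V _; rewrite mulr_ge0.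
rewrite /fold_kernel -mulr_sumr ler_pdivrMl ?exprn_gt0 // mulr1.
have [[[A eA] [B eB]]|[[A eA] [B [C eC]]]] := take_drop_letter n U V.
  under eq_bigr => x _ do under eq_sums => Z _ do rewrite eA eB -catA cat_cons.
  rewrite -exchange_sums sumsS -exchange_sums.
  rewrite -[N ^+ m.+1]mulr1 -(@sums_const R T); apply: le_sums => Z _.
  apply: le_trans (K_unitl [::] Z B); apply: ler_sum => y _.
  by rewrite -mulr_suml ler_piMl.
under eq_bigr => x _ do under eq_sums => Z _ do rewrite eA eC.
rewrite -exchange_sums sumsS -exchange_sums.
rewrite -[N ^+ m.+1]mulr1 -(@sums_const R T); apply: le_sums => Z _.
apply: le_trans (p1 A Z); apply: ler_sum => y _.
by rewrite -mulr_sumr ler_piMr.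
Qed.

(** Expanding the new kernel replaces the weight [paths a Z V b] by [detour a b V], which is at
    least [gam] off the bad configurations. These cost at most [eta], because [rest] is at most
    [N^-1]. *)
Lemma popularity_fold eta gam m s Psi W : kernel Psi -> (0 < size W)%N ->
  0 <= gam -> fold_good eta gam m s ->
  gam * (popularity Psi (W ++ zipper s m) - eta) <=
  popularity (fold_kernel (size W) m Psi) (W ++ fan3).
Proof.
move=> kP W0 gam0 good; rewrite !popularity_cat size_zipper.
set Z := zipper s m; set r := rest Psi W.
have r0 a b V : 0 <= r a b V by apply: rest_ge0.
have rN a b V : size V = m.+2 -> r a b V <= N^-1.
  by move=> sV; apply: rest_le; rewrite ?sV.
have q0 a b V : 0 <= detour a b V.
  rewrite mulr_ge0 ?invr_ge0 ?exprn_ge0 ?ler0n //.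
  by apply: sums_ge0 => L _; rewrite mulr_ge0 ?paths_ge0.
have -> : N ^- size fan3 * (\sum_a \sum_b sums (size fan3) (fun L =>
    paths a fan3 L b * rest (fold_kernel (size W) m Psi) W a b L)) =
  N ^- m.+2 * \sum_a \sum_b sums m.+2 (fun V => r a b V * detour a b V).
  rewrite !mulr_sumr; apply: eq_bigr => a _.
  rewrite !mulr_sumr; apply: eq_bigr => b _.
  rewrite -!sumsZ /detour.
  under [RHS]eq_sums => V _ do rewrite -!sumsZ.
  rewrite [RHS]sums_sums; apply: eq_sums => L sL.
  rewrite /rest /fold_kernel.
  under eq_sums => U sU do rewrite take_size_cat // drop_size_cat // -sumsZ -sumsZ.
  rewrite sums_sums -!sumsZ; apply: eq_sums => V _.
  rewrite /r /rest -!sumsZ -sumsZr -!sumsZ.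
  apply: eq_sums => U _; rewrite [size fan3]/=.
  have -> : N ^- 3 = N ^- 2 * N^-1 by rewrite exprSr invfM.
  have -> : N ^- m.+2 = N ^- m.+1 * N^-1 by rewrite exprSr invfM.
  ring.
have -> : eta = N ^- m.+2 * (N^-1 * (eta * N ^+ m.+3)).
  by rewrite mulrA -invfM -exprSr mulrCA mulVf ?mulr1 // expf_eq0 (negPf N_neq0) andbF.
rewrite -mulrBr mulrCA; apply: ler_wpM2l.
  by rewrite invr_ge0 exprn_ge0 // ltW.
apply: le_trans (_ : gam * (\sum_a \sum_b sums m.+2 (fun V => paths a Z V b *
   (r a b V - N^-1 * (detour a b V < gam)%R%:R))) <= _).
  apply: ler_wpM2l => //; apply: le_trans (_ : _ <=
    \sum_a \sum_b sums m.+2 (fun V => paths a Z V b * r a b V) -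
    N^-1 * (\sum_a \sum_b sums m.+2 (fun V => paths a Z V b * (detour a b V < gam)%R%:R))) _.
    by rewrite lerB // ler_wpM2l // invr_ge0 ltW.
  rewrite mulr_sumr -sumrB; apply: ler_sum => a _.
  rewrite mulr_sumr -sumrB; apply: ler_sum => b _.
  rewrite -mulNr -sumsZ -sumsD; apply: le_sums => V _.
  by rewrite mulrBr mulNr (mulrCA N^-1).
rewrite mulr_sumr; apply: ler_sum => a _.
rewrite mulr_sumr; apply: ler_sum => b _.
rewrite -sumsZ; apply: le_sums => V sV.
have p0 := paths_ge0 R F a Z V b; have p1 := paths_le1 R Fdet2 Fdet3 a Z V b.
case: (ltP (detour a b V) gam) => [lt|ge].
  apply: le_trans (_ : 0 <= _); last by rewrite mulr_ge0.
  rewrite mulrC -mulrA; apply: mulr_ge0_le0 => //.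
  by rewrite mulr_le0_ge0 // mulr1 subr_le0 rN.
rewrite mulr0 subr0; apply: le_trans (_ : gam * r a b V <= _).
  by rewrite ler_wpM2l // ler_piMl.
by rewrite mulrC ler_wpM2l.
Qed.

Definition word_rinv V := rev (map inv V).

(** The annulus of one disc crosses the edge from [a] to [b], that of the other from [a'] to [b'].
    After the merge the boundary continues crosswise, from [a] to [b'] and from [a'] to [b]; two
    free fans give [N ^ 4]. *)
Definition detour2 a b a' b' u u' : R :=
  N ^- 4 * sums 3 (fun L => sums 3 (fun L' =>
    paths a fan3 L b' * paths a' fan3 L' b * K (u :: word_rinv L' ++ [:: u']) L)).

Lemma detour2_def a b a' b' u u' : detour2 a b a' b' u u' =
  N ^- 4 * sums 3 (fun L => sums 3 (fun L' =>
    paths a fan3 L b' * paths a' fan3 L' b * K (u :: word_rinv L' ++ [:: u']) L)).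
Proof. by []. Qed.

Definition merge_good (eta gam : R) s :=
  \sum_a \sum_b \sum_a' \sum_b' \sum_u \sum_u'
    (step F a (Some s) u b)%:R * (step F a' (Some (inv s)) u' b')%:R *
    (detour2 a b a' b' u u' < gam)%R%:R <= eta * N ^+ 4.

Definition merge_kernel n1 n2 Psi1 Psi2 U : R :=
  let U1 := take n1 U in let R1 := drop n1 U in
  let L := take 3 R1 in let R2 := drop 3 R1 in
  let U2 := take n2 R2 in let L' := drop n2 R2 in
  \sum_u \sum_u' Psi1 (U1 ++ [:: u]) * Psi2 (U2 ++ [:: u']) *
    K (u :: word_rinv L' ++ [:: u']) L.

Lemma sum_inv (f : T -> R) : \sum_x f (inv x) = \sum_x f x.
Proof. by rewrite [RHS](reindex_inj (can_inj invK)). Qed.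

(** For each of the four segments that may hold the summed letter, the three factors can be summed
    in an order in which each has a single free letter. *)
Lemma kernel_merge n1 n2 Psi1 Psi2 : kernel Psi1 -> kernel Psi2 ->
  kernel (merge_kernel n1 n2 Psi1 Psi2).
Proof.
move=> [p0 p1] [q0 q1]; split=> [U|U V].
  by apply: sumr_ge0 => u _; apply: sumr_ge0 => u' _; rewrite !mulr_ge0.
rewrite /merge_kernel; rewrite exchange_big /=.
under eq_bigr do rewrite exchange_big /=.
have end1 U1 : \sum_u Psi1 (U1 ++ [:: u]) <= 1 by apply: p1.
have end2 U2 : \sum_u Psi2 (U2 ++ [:: u]) <= 1 by apply: q1.
have [[[A eA] [B eB]]|[[A eA] [B [C eC]]]] := take_drop_letter n1 U V.
  under eq_bigr => u _ do under eq_bigr => u' _ do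
    under eq_bigr => x _ do rewrite eA eB -catA cat_cons -mulrA.
  apply: le_trans (end2 (take n2 (drop 3 B))).
  rewrite exchange_big; apply: ler_sum => u' _ /=.
  apply: le_trans (_ : \sum_u Psi2 (take n2 (drop 3 B) ++ [:: u']) *
    K (u :: word_rinv (drop n2 (drop 3 B)) ++ [:: u']) (take 3 B) <= _).
    apply: ler_sum => u _; rewrite -mulr_suml ler_piMl ?mulr_ge0 //.
  rewrite -mulr_sumr ler_piMr //; exact: (K_unitl [::]).
under eq_bigr => u _ do under eq_bigr => u' _ do
    under eq_bigr => x _ do rewrite eA eC.
have [[[D eD] [E eE]]|[[D eD] [E [G eG]]]] := take_drop_letter 3 B C.
  under eq_bigr => u _ do under eq_bigr => u' _ do
    under eq_bigr => x _ do rewrite eD eE.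
  apply: le_trans (end1 A); apply: ler_sum => u _.
  apply: le_trans (_ : \sum_u' Psi1 (A ++ [:: u]) *
    Psi2 (take n2 E ++ [:: u']) <= _).
    apply: ler_sum => u' _; rewrite -mulr_sumr ler_piMr ?mulr_ge0 //.
  by rewrite -mulr_sumr ler_piMr.
under eq_bigr => u _ do under eq_bigr => u' _ do
    under eq_bigr => x _ do rewrite eD eG.
have [[[H eH] [I eI]]|[[H eH] [I [J eJ]]]] := take_drop_letter n2 E G.
  under eq_bigr => u _ do under eq_bigr => u' _ do
    under eq_bigr => x _ do rewrite eH eI -catA cat_cons mulrAC.
  apply: le_trans (end1 A); apply: ler_sum => u _.
  apply: le_trans (_ : \sum_u' Psi1 (A ++ [:: u]) *
    K (u :: word_rinv I ++ [:: u']) D <= _).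
    by apply: ler_sum => u' _; rewrite -mulr_sumr ler_piMr ?mulr_ge0.
  rewrite -mulr_sumr ler_piMr //; exact: (K_unitl (u :: word_rinv I)).
under eq_bigr => u _ do under eq_bigr => u' _ do
    under eq_bigr => x _ do rewrite eH eJ /word_rinv map_cat rev_cat map_cons
      rev_cons cat_rcons -catA cat_cons.
apply: le_trans (end1 A); apply: ler_sum => u _.
apply: le_trans (_ : \sum_u' Psi1 (A ++ [:: u]) * Psi2 (H ++ [:: u']) <= _).
  apply: ler_sum => u' _; rewrite -mulr_sumr ler_piMr ?mulr_ge0 //.
  rewrite (sum_inv (fun x => K (u :: rev (map inv J) ++
    x :: rev (map inv I) ++ [:: u']) D)).
  exact: (K_unitl (u :: _)).
by rewrite -mulr_sumr ler_piMr.
Qed.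

Lemma popularity_rcons Psi W s : popularity Psi (W ++ [:: Some s]) =
  N^-1 * \sum_a \sum_b \sum_u (step F a (Some s) u b)%:R * rest Psi W a b [:: u].
Proof.
rewrite popularity_cat expr1; congr (_ * _); apply: eq_bigr => a _.
apply: eq_bigr => b _; rewrite sums1; apply: eq_bigr => u _.
by rewrite paths1.
Qed.

Lemma exchange_sums4 (I J I' J' : finType) k (f : I -> J -> I' -> J' -> seq T -> R) :
  \sum_i \sum_j \sum_i' \sum_j' sums k (f i j i' j') =
  sums k (fun V => \sum_i \sum_j \sum_i' \sum_j' f i j i' j' V).
Proof.
rewrite exchange_sums; apply: eq_bigr => i _.
rewrite exchange_sums; apply: eq_bigr => j _.
rewrite exchange_sums; apply: eq_bigr => i' _.
by rewrite exchange_sums.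
Qed.

Lemma popularity_merge_kernel Psi1 Psi2 W1 W2 :
  popularity (merge_kernel (size W1) (size W2) Psi1 Psi2)
    (W1 ++ fan3 ++ W2 ++ fan3) =
  N ^- 2 * \sum_a \sum_b \sum_a' \sum_b' \sum_u \sum_u'
    rest Psi1 W1 a b [:: u] * rest Psi2 W2 a' b' [:: u'] *
    detour2 a b a' b' u u'.
Proof.
rewrite popularity_cat !mulr_sumr; apply: eq_bigr => a _.
rewrite !mulr_sumr; apply: eq_bigr => b _.
pose term L U L' a' b' u u' := N ^- 6 * N ^- size W2 *
  (paths a fan3 L b' * paths b' W2 U a' * paths a' fan3 L' b *
   (rest Psi1 W1 a b [:: u] * Psi2 (U ++ [:: u']) *
    K (u :: word_rinv L' ++ [:: u']) L)).
transitivity (sums 3 (fun L => sums (size W2) (fun U => sums 3 (fun L' =>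
   \sum_a' \sum_b' \sum_u \sum_u' term L U L' a' b' u u')))).
  rewrite !size_cat !sums_cat -sumsZ; apply: eq_sums => L sL.
  rewrite sums_cat -sumsZ; apply: eq_sums => U sU.
  rewrite -sumsZ; apply: eq_sums => L' sL'.
  rewrite paths_cat ?sL //.
  have -> : rest (merge_kernel (size W1) (size W2) Psi1 Psi2) W1 a b (L ++ U ++ L')
    = \sum_u \sum_u' rest Psi1 W1 a b [:: u] * Psi2 (U ++ [:: u']) *
       K (u :: word_rinv L' ++ [:: u']) L.
    rewrite /rest /merge_kernel.
    under eq_sums => V sV do rewrite take_size_cat // drop_size_cat //
      (take_size_cat _ sL) (drop_size_cat _ sL) take_size_cat //
      drop_size_cat // mulr_sumr.
    rewrite exchange_sums mulr_sumr; apply: eq_bigr => u _.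
    under eq_sums => V sV do rewrite mulr_sumr.
    rewrite exchange_sums mulr_sumr; apply: eq_bigr => u' _.
    rewrite -mulrA -[RHS]mulrA -sumsZr; congr (_ * _).
    by apply: eq_sums => V _; rewrite !mulrA.
  under eq_bigr => b' _ do rewrite paths_cat ?sU // mulr_sumr.
  rewrite [X in _ * (X * _)]exchange_big /= mulr_suml mulr_sumr.
  apply: eq_bigr => a' _; rewrite mulr_suml mulr_sumr; apply: eq_bigr => b' _.
  rewrite 2!mulr_sumr; apply: eq_bigr => u _.
  rewrite 2!mulr_sumr; apply: eq_bigr => u' _.
  rewrite /term; have -> : (3 + (size W2 + 3) = 6 + size W2)%N by lia.
  by rewrite exprD invfM; ring.
under eq_sums => L _ do under eq_sums => U _ do rewrite -exchange_sums4.
under eq_sums => L _ do rewrite -exchange_sums4.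
rewrite -exchange_sums4 mulr_sumr; apply: eq_bigr => a' _.
rewrite mulr_sumr; apply: eq_bigr => b' _.
rewrite mulr_sumr; apply: eq_bigr => u _.
rewrite mulr_sumr; apply: eq_bigr => u' _.
rewrite /detour2 -!sumsZ; apply: eq_sums => L _.
rewrite sums_sums -!sumsZ; apply: eq_sums => L' _.
rewrite /rest mulrA mulrAC -sumsZ.
rewrite [RHS](_ : _ = N ^- 2 * rest Psi1 W1 a b [:: u] * N ^- size W2 *
  (N ^- 4 * (paths a fan3 L b' * paths a' fan3 L' b *
     K (u :: word_rinv L' ++ [:: u']) L)) *
  sums (size W2) (fun U => paths b' W2 U a' * Psi2 (U ++ [:: u']))); last first.
  rewrite sumsZ /rest; ring.
rewrite -sumsZ; apply: eq_sums => U _; rewrite /term.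
have -> : N ^- 6 = N ^- 2 * N ^- 4 by rewrite -invfM -exprD.
ring.
Qed.

(** The two discs are summed independently and interact only through [detour2], so their
    popularities multiply; bad configurations cost [eta] because each [rest] is at most [N^-1]. *)
Lemma popularity_merge eta gam s Psi1 Psi2 W1 W2 : kernel Psi1 -> kernel Psi2 ->
  (0 < size W1)%N -> (0 < size W2)%N -> 0 <= gam -> merge_good eta gam s ->
  gam * (popularity Psi1 (W1 ++ [:: Some s]) *
         popularity Psi2 (W2 ++ [:: Some (inv s)]) - eta) <=
  popularity (merge_kernel (size W1) (size W2) Psi1 Psi2)
    (W1 ++ fan3 ++ W2 ++ fan3).
Proof.
move=> kP1 kP2 W10 W20 gam0 good.
rewrite popularity_merge_kernel !popularity_rcons.
set r1 := rest Psi1 W1; set r2 := rest Psi2 W2.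
have r10 a b V : 0 <= r1 a b V by apply: rest_ge0.
have r20 a b V : 0 <= r2 a b V by apply: rest_ge0.
have r1N a b u : r1 a b [:: u] <= N^-1 by apply: rest_le.
have r2N a b u : r2 a b [:: u] <= N^-1 by apply: rest_le.
have q0 a b a' b' u u' : 0 <= detour2 a b a' b' u u'.
  rewrite mulr_ge0 ?invr_ge0 ?exprn_ge0 ?ler0n //.
  apply: sums_ge0 => L _; apply: sums_ge0 => L' _.
  by rewrite !mulr_ge0 ?paths_ge0.
have -> : N^-1 * (\sum_a \sum_b \sum_u (step F a (Some s) u b)%:R * r1 a b [:: u]) *
   (N^-1 * (\sum_a' \sum_b' \sum_u' (step F a' (Some (inv s)) u' b')%:R *
      r2 a' b' [:: u'])) =
   N ^- 2 * (\sum_a \sum_b \sum_a' \sum_b' \sum_u \sum_u'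
    (step F a (Some s) u b)%:R * (step F a' (Some (inv s)) u' b')%:R *
    (r1 a b [:: u] * r2 a' b' [:: u'])).
  rewrite mulrACA -expr2 exprVn; congr (_ * _).
  rewrite mulr_suml; apply: eq_bigr => a _.
  rewrite mulr_suml; apply: eq_bigr => b _.
  rewrite mulr_sumr; apply: eq_bigr => a' _.
  rewrite mulr_sumr; apply: eq_bigr => b' _.
  rewrite mulr_suml; apply: eq_bigr => u _.
  rewrite mulr_sumr; apply: eq_bigr => u' _; exact: mulrACA.
have -> : eta = N ^- 2 * (N ^- 2 * (eta * N ^+ 4)).
  by rewrite mulrA -invfM -exprD mulrCA mulVf ?mulr1 // expf_eq0 (negPf N_neq0) andbF.
rewrite -mulrBr mulrCA; apply: ler_wpM2l.
  by rewrite invr_ge0 exprn_ge0 // ltW.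
apply: le_trans (_ : gam * (\sum_a \sum_b \sum_a' \sum_b' \sum_u \sum_u'
    (step F a (Some s) u b)%:R * (step F a' (Some (inv s)) u' b')%:R *
    (r1 a b [:: u] * r2 a' b' [:: u'] -
     N ^- 2 * (detour2 a b a' b' u u' < gam)%R%:R)) <= _).
  apply: ler_wpM2l => //; apply: le_trans (_ : _ <=
    (\sum_a \sum_b \sum_a' \sum_b' \sum_u \sum_u'
    (step F a (Some s) u b)%:R * (step F a' (Some (inv s)) u' b')%:R *
    (r1 a b [:: u] * r2 a' b' [:: u'])) - N ^- 2 *
    (\sum_a \sum_b \sum_a' \sum_b' \sum_u \sum_u'
    (step F a (Some s) u b)%:R * (step F a' (Some (inv s)) u' b')%:R *
    (detour2 a b a' b' u u' < gam)%R%:R)) _.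
    by rewrite lerB // ler_wpM2l // invr_ge0 exprn_ge0 // ltW.
  rewrite mulr_sumr -sumrB; apply: ler_sum => a _.
  rewrite mulr_sumr -sumrB; apply: ler_sum => b _.
  rewrite mulr_sumr -sumrB; apply: ler_sum => a' _.
  rewrite mulr_sumr -sumrB; apply: ler_sum => b' _.
  rewrite mulr_sumr -sumrB; apply: ler_sum => u _.
  rewrite mulr_sumr -sumrB; apply: ler_sum => u' _.
  by rewrite [leRHS]mulrBr (mulrCA (N ^- 2)).
rewrite mulr_sumr; apply: ler_sum => a _.
rewrite mulr_sumr; apply: ler_sum => b _.
rewrite mulr_sumr; apply: ler_sum => a' _.
rewrite mulr_sumr; apply: ler_sum => b' _.
rewrite mulr_sumr; apply: ler_sum => u _.
rewrite mulr_sumr; apply: ler_sum => u' _.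
set p := _%:R * _%:R.
have p0 : 0 <= p by rewrite mulr_ge0 ?ler0n.
have p1 : p <= 1 by rewrite mulr_ile1 ?ler0n ?lern1 ?leq_b1.
have rr0 : 0 <= r1 a b [:: u] * r2 a' b' [:: u'] by rewrite mulr_ge0.
case: (ltP (detour2 a b a' b' u u') gam) => [lt|ge].
  apply: le_trans (_ : 0 <= _); last by rewrite mulr_ge0.
  rewrite mulr1 mulr_ge0_le0 // mulr_ge0_le0 // subr_le0.
  by rewrite -[N ^- 2]exprVn expr2 ler_pM.
rewrite mulr0 subr0; apply: le_trans (_ : gam * (r1 a b [:: u] * r2 a' b' [:: u']) <= _).
  by rewrite ler_wpM2l // ler_piMl.
by rewrite mulrC ler_wpM2l.
Qed.

End Surgery.

(** * Small discs are bounded in number *)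

Section Padding.
Variable T : eqType.
Implicit Types (W : seq (option T)) (u v w : seq T).

Lemma pmap_id_cat W u v : pmap id W = u ++ v ->
  exists W1 W2, [/\ W = W1 ++ W2, pmap id W1 = u & pmap id W2 = v].
Proof.
elim: W u => [|[a|] W IH] u /=.
- by case: u v => [|//] [|//] _; exists [::], [::].
- case: u => [|b u] /=.
    by case: v {IH} => [//|b v] [-> e]; exists [::], (Some b :: W); rewrite /= e.
  by case=> -> /IH[W1 [W2 [-> <- <-]]]; exists (Some b :: W1), W2.
by case/IH=> W1 [W2 [-> <- <-]]; exists (None :: W1), W2.
Qed.

Lemma pmap_id_nil W : pmap id W = [::] -> W = nseq (size W) None.
Proof. by elim: W => [//|[a|] W IH] //= /IH{1}->. Qed.

Lemma pmap_id_seq1 W a : pmap id W = [:: a] ->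
  exists m k, W = nseq m None ++ Some a :: nseq k None.
Proof.
elim: W => [//|[b|] W IH] /=.
  by case=> -> /pmap_id_nil ->; exists 0, (size W).
by case/IH=> m [k ->]; exists m.+1, k.
Qed.

Lemma pmap_id_nseq k : pmap id (nseq k (@None T)) = [::].
Proof. by elim: k. Qed.

Lemma pmap_id_rcons W u a : pmap id W = rcons u a ->
  exists X k, W = (X ++ [:: Some a]) ++ nseq k None /\ pmap id X = u.
Proof.
rewrite -cats1 => /pmap_id_cat[W1 [W2 [-> <- /pmap_id_seq1[m [k ->]]]]].
exists (W1 ++ nseq m None), k; split; first by rewrite -!catA.
by rewrite pmap_cat pmap_id_nseq cats0.
Qed.

(** Rotating a disc and then its padded word is again one rotation of the original padded word. *)
Lemma rotation_trans (B : Type) (x y z t : seq B) : y ++ x = z ++ t ->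
  exists w1 w2 : seq B, x ++ y = w1 ++ w2 /\ t ++ z = w2 ++ w1.
Proof.
move=> e; case: (leqP (size z) (size y)) => szy.
  exists (x ++ z), (drop (size z) y).
  have ey : y = z ++ drop (size z) y.
    rewrite -[LHS](cat_take_drop (size z)); congr (_ ++ _).
    by move: (congr1 (take (size z)) e); rewrite takel_cat // take_size_cat.
  have et : t = drop (size z) y ++ x.
    move: (congr1 (drop (size z)) e); rewrite [in RHS]drop_size_cat // drop_cat.
    case: ltnP => // ge; rewrite (_ : size z = size y) ?subnn; last lia.
    by move=> <-; rewrite drop0 drop_size.
  by split; [rewrite -catA -ey | rewrite et catA].
have ez : z = y ++ drop (size y) z.
  rewrite -[LHS](cat_take_drop (size y)); congr (_ ++ _).
  by move: (congr1 (take (size y)) e); rewrite take_size_cat // takel_cat ?(ltnW szy).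
have ex : x = drop (size y) z ++ t.
  by move: (congr1 (drop (size y)) e); rewrite drop_size_cat // drop_cat szy.
exists (drop (size y) z), (t ++ y).
by split; [rewrite {1}ex catA | rewrite {1}ez catA].
Qed.

End Padding.

Lemma size_fan3 (T : finType) : size (fan3 T) = 3%N. Proof. by []. Qed.

Lemma pmap_fan3 (T : finType) : pmap id (fan3 T) = [::]. Proof. by []. Qed.

Section Universal.
Variables (R : realFieldType) (A : finType).
Local Notation T := (A * bool)%type.
Variable F : T -> T -> T -> bool.
Hypothesis Fdet1 : forall a a' u h, F a u h -> F a' u h -> a = a'.
Hypothesis Fdet2 : forall a u u' h, F a u h -> F a u' h -> u = u'.
Hypothesis Fdet3 : forall a u h h', F a u h -> F a u h' -> h = h'.
Local Notation N := (#|{: T}|%:R : R).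
Hypothesis N_gt0 : 0 < N.
Implicit Types (a b c u : T) (W : seq (option T)) (U V : seq T).
Local Notation popularity := (@popularity R _ F).
Local Notation kernel := (@kernel R {: T}).

Variable K : seq T -> seq T -> R.
Hypothesis K_ge0 : forall V L, 0 <= K V L.
Hypothesis K_unitl : forall V1 V2 L, \sum_x K (V1 ++ x :: V2) L <= 1.
Hypothesis K_unitr : forall V L1 L2, \sum_x K V (L1 ++ x :: L2) <= 1.

Local Notation fold_good := (@fold_good R _ (@linv A) F K).
Local Notation merge_good := (@merge_good R _ (@linv A) F K).
Local Notation fold_kernel := (@fold_kernel R {: T} K).
Local Notation merge_kernel := (@merge_kernel R {: T} (@linv A) K).

Lemma kernel_rot i Psi : kernel Psi -> kernel (fun V => Psi (rot i V)).
Proof.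
move=> [p0 p1]; split=> [//|U V]; rewrite /rot.
have [[[B eB] [C eC]]|[[B eB] [C [D eCD]]]] := take_drop_letter i U V.
  under eq_bigr do rewrite eB eC catA; exact: p1.
under eq_bigr do rewrite eB eCD -catA cat_cons; exact: p1.
Qed.

Lemma kernel_average (I : finType) (Phi : I -> seq T -> R) : (0 < #|I|)%N ->
  (forall i, kernel (Phi i)) ->
  kernel (fun V => #|I|%:R^-1 * \sum_i Phi i V).
Proof.
move=> I0 kP; split=> [V|U V].
  rewrite mulr_ge0 ?invr_ge0 ?ler0n // sumr_ge0 // => i _.
  by case: (kP i).
rewrite -mulr_sumr exchange_big ler_pdivrMl ?ltr0n // mulr1.
rewrite -sum1_card natr_sum; apply: ler_sum => i _; by case: (kP i).
Qed.

Lemma popularity_average (I : finType) (Phi : I -> seq T -> R) i W :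
  (forall i, kernel (Phi i)) ->
  #|I|%:R^-1 * popularity (Phi i) W <=
  popularity (fun V => #|I|%:R^-1 * \sum_i Phi i V) W.
Proof.
move=> kP; rewrite /popularity mulrCA; apply: ler_wpM2l.
  by rewrite invr_ge0 exprn_ge0 // ltW.
rewrite -sumsZ; apply: le_sums => V _; rewrite mulrCA.
apply: ler_wpM2l; first exact: ptrace_ge0.
apply: ler_wpM2l; first by rewrite invr_ge0 ler0n.
by apply: (ler_sum1 i (f := fun i => Phi i V)) => j; case: (kP j).
Qed.

(** Rotated to the end, the letter is determined by its two spokes and its opposite edge; what
    remains is summed by the kernel property and the uniqueness of the end of a path. This turns
    popularity into a bound on the number of partners of a letter. *)
Lemma sum_popularity_letter Psi W1 W2 : kernel Psi ->
  \sum_y popularity Psi (W1 ++ Some y :: W2) <= 1.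
Proof.
move=> kP; have kP' := kernel_rot (size W2) kP.
under eq_bigr => y _ do
  rewrite -cat1s catA popularity_catC catA popularity_rcons.
set Psi' := fun V => Psi _ in kP' *; set W := W2 ++ W1.
rewrite -mulr_sumr ler_pdivrMl // mulr1 exchange_big /=.
have step_s a u b : \sum_y (step F a (Some y) u b)%:R <= 1 :> R.
  apply: sum_uniq_le1 => y y' /existsP[h /andP[ah sh]] /existsP[h' /andP[ah' sh']].
  by move: (Fdet3 ah ah') sh' => <-; apply: Fdet1.
apply: le_trans (_ : \sum_a \sum_b \sum_u rest F Psi' W a b [:: u] <= _).
  apply: ler_sum => a _; rewrite exchange_big; apply: ler_sum => b _ /=.
  rewrite exchange_big; apply: ler_sum => u _ /=.
  by rewrite -mulr_suml; apply: ler_piMl (step_s a u b); apply: rest_ge0.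
apply: le_trans (_ : \sum_(a : T) 1 <= _); last by rewrite sumr_const.
rewrite exchange_big; apply: ler_sum => b _ /=.
under eq_bigr => a _ do rewrite /rest -mulr_sumr -exchange_sums.
rewrite -mulr_sumr ler_pdivrMl ?exprn_gt0 // -exchange_sums -sums_const.
apply: le_sums => U _; apply: le_trans (sum_paths_end R Fdet2 Fdet3 b W U).
apply: ler_sum => a _; rewrite -mulr_sumr ler_piMr ?paths_ge0 //.
by case: kP' => _; apply.
Qed.

Variable face : T -> T -> T -> Prop.
Hypothesis face_F : forall a b c, face a b c -> F a b (linv c).
Hypothesis face_sign : forall a b c, face a b c -> a.2 = b.2 /\ b.2 = c.2.

Variables (S : nat) (c_ eta_ gam_ : nat -> R).
(** A step adds at most six empty letters, so discs built in [s] steps have padded words of length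
    at most [7 * s]. [I] lists all last steps: a rotation followed by a fold with its two lengths,
    or by a merge with its number of steps and two lengths. *)
Let L := (7 * S).+1.
Let I : finType := ('I_L * ('I_L * 'I_L + 'I_S * 'I_L * 'I_L))%type.
Let M : R := #|I|%:R.

Definition face_kernel V : R :=
  if V is [:: u1; u2; u3] then (F u1 u2 (linv u3))%:R else 0.

Hypothesis F_rot : forall u1 u2 u3, F u1 u2 (linv u3) = F u2 u3 (linv u1).
Hypothesis face_popular : forall a b c, face a b c ->
  c_ 1 <= popularity face_kernel [:: Some a; Some b; Some c].
Hypothesis face_good : forall a b c, face a b c -> forall x, x \in [:: a; b; c] ->
  forall s, (s < S)%N -> (forall m, (m < L)%N -> fold_good (eta_ s) (gam_ s) m x) /\
    merge_good (eta_ s) (gam_ s) x.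
Hypothesis c_ge0 : forall s, 0 <= c_ s <= 1.
Hypothesis c_dec : forall s t, (s <= t)%N -> c_ t <= c_ s.
Hypothesis gam_ge0 : forall s, 0 <= gam_ s.
Hypothesis c_step : forall s, (0 < s < S)%N ->
  M * c_ s.+1 <= gam_ s * (c_ s ^+ 2 - eta_ s).

(** The steps place empty letters wherever they need them, so the padding is existential. All
    rotations of one padded word are required because [disc_rot] may cut between any two letters. *)
Definition rot_popular s Psi w := exists W,
  [/\ pmap id W = w, (size W <= 7 * s)%N &
     forall W1 W2, W = W1 ++ W2 -> c_ s <= popularity Psi (W2 ++ W1)].

Lemma kernel_face : kernel face_kernel.
Proof.
split=> [[|x [|y [|z [|? ?]]]]|] //=.
move=> U V; case: (eqVneq (size U + size V)%N 2) => [s2|n2]; last first.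
  rewrite big1 ?ler01 // => a _; case: U n2 => [|x [|y [|z U]]];
  case: V => [|x' [|y' [|z' V]]] //=; by case: U => [|? []].
case: U s2 => [|x [|y [|z U]]]; case: V => [|x' [|y' [|z' V]]] //= _.
- by apply: sum_uniq_le1 => a a'; apply: Fdet1.
- by apply: sum_uniq_le1 => a a'; apply: Fdet2.
- apply: sum_uniq_le1 => a a' h h'.
  by apply: (can_inj (@linvK A)); apply: Fdet3 h h'.
Qed.

Lemma kernel0 : kernel (fun=> 0).
Proof. by split=> [//|U V]; rewrite big1. Qed.

Lemma disc_steps_gt0 s j w : disc face s j w -> (0 < s)%N.
Proof. by elim. Qed.

Lemma rot_popular_rcons s Psi (u : seq T) a : u <> [::] -> rot_popular s Psi (rcons u a) ->
  exists X, [/\ pmap id X = u, (0 < size X < 7 * s)%N &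
     c_ s <= popularity Psi (X ++ [:: Some a])].
Proof.
move=> u0 [W [/pmap_id_rcons[X [k [eW eX]]] sW pW]].
exists (nseq k None ++ X); split.
- by rewrite pmap_cat pmap_id_nseq.
- move: sW; rewrite eW !size_cat size_nseq /= addn1 => sW.
  rewrite addnC; apply/andP; split; last lia.
  by rewrite addn_gt0; case: (X) eX => // eu; case: u0.
by have := pW _ _ eW; rewrite catA.
Qed.

Lemma rot_popular_fold s Psi (u : seq T) a : u <> [::] ->
  rot_popular s Psi (u ++ [:: a; linv a]) ->
  exists X m, [/\ pmap id X = u, (0 < size X)%N, (size X + m.+2 <= 7 * s)%N &
     c_ s <= popularity Psi (X ++ zipper (@linv A) a m)].
Proof.
move=> u0 [W [/pmap_id_cat[X [Y [-> eX eY]]] sW pW]].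
have [Y1 [Y2 [e /pmap_id_seq1[m1 [k1 e1]] /pmap_id_seq1[m2 [k2 e2]]]]] :=
  @pmap_id_cat _ _ [:: a] [:: linv a] eY.
exists (nseq k2 None ++ X ++ nseq m1 None), (k1 + m2)%N.
move: sW pW; rewrite e e1 e2 => sW pW.
rewrite !(size_cat, size_nseq) /= !size_nseq in sW.
rewrite !(size_cat, size_nseq).
split; last 1 first.
- have := pW (X ++ nseq m1 None ++ Some a :: nseq k1 None ++ nseq m2 None ++
    [:: Some (linv a)]) (nseq k2 None).
  rewrite -!catA /= -!catA /= => /(_ erefl).
  by rewrite /zipper nseqD -!catA /=.
- by rewrite !pmap_cat !pmap_id_nseq cats0.
- by rewrite !addn_gt0; case: (X) eX => [eu|? ?]; [case: u0 | rewrite /= orbT].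
- lia.
Qed.

(** The kernel must not depend on the disc. It is therefore the average over [I] of the kernels of
    all conceivable last steps; a given disc is served by one term, and averaging costs only the
    factor [M]. *)
Lemma universal_kernels s : (s <= S)%N -> exists Psi : nat -> seq T -> R,
  (forall i, kernel (Psi i)) /\
  forall i j w, (i <= s)%N -> disc face i j w -> rot_popular i (Psi i) w.
Proof.
elim: s => [_|s IH ltsS].
  exists (fun _ _ => 0); split=> [i|i j w]; first exact: kernel0.
  by rewrite leqn0 => /eqP-> /disc_steps_gt0.
have [Psi [kP pP]] := IH (ltnW ltsS).
pose Phi (x : I) : seq T -> R := fun V =>
  (match x.2 with
   | inl (n, m) => fold_kernel n m (Psi s)
   | inr (i, n, m) => merge_kernel n m (Psi i) (Psi (s - i)%N)
   end) (rot x.1 V).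
have kPhi x : kernel (Phi x).
  rewrite /Phi; case: x => r [[n m]|[[i n] m]] /=; apply: (kernel_rot r).
    exact: kernel_fold.
  by apply: kernel_merge => //; apply: linvK.
pose avg : seq T -> R := if s == 0%N then face_kernel else
  fun V => #|I|%:R^-1 * \sum_x Phi x V.
have I0 : (0 < #|I|)%N.
  by apply/card_gt0P; exists (ord0, inl (ord0, ord0)).
have kavg : kernel avg.
  by rewrite /avg; case: eqP => _; [apply: kernel_face | apply: kernel_average].
exists (fun i => if i == s.+1 then avg else Psi i).
split=> [i|]; first by case: eqP.
have avgP W (x : 'I_L * 'I_L + 'I_S * 'I_L * 'I_L) : (0 < s)%N -> (size W <= 7 * s.+1)%N ->
  M * c_ s.+1 <= popularity (fun V => match x with
   | inl (n, m) => fold_kernel n m (Psi s) V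
   | inr (i, n, m) => merge_kernel n m (Psi i) (Psi (s - i)%N) V
   end) W ->
  forall W1 W2, W = W1 ++ W2 -> c_ s.+1 <= popularity avg (W2 ++ W1).
  move=> s0 sW pW W1 W2 eW.
  have ltL : (size W2 < L)%N by rewrite eW size_cat in sW; rewrite /L; lia.
  have := @popularity_average I Phi (inord (size W2), x) (W2 ++ W1) kPhi.
  rewrite /avg gtn_eqF //; apply: le_trans.
  rewrite ler_pdivlMl ?ltr0n // {1}/Phi /= inordK //.
  rewrite -popularity_catC -eW.
  by case: x pW => [[n m]|[[i n] m]].
have goodP i j w x : disc face i j w -> x \in w ->
    (forall m, (m < L)%N -> fold_good (eta_ s) (gam_ s) m x) /\
    merge_good (eta_ s) (gam_ s) x.
  move=> d; apply: (disc_letters (P := fun x =>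
    (forall m, (m < L)%N -> fold_good (eta_ s) (gam_ s) m x) /\
    merge_good (eta_ s) (gam_ s) x) _ d).
  by move=> a b c fabc; split; apply: (face_good fabc) => //; rewrite !inE eqxx ?orbT.
move=> i j w les d; case: eqP les => [ei _|ni les]; last by apply: pP d; lia.
rewrite {}ei in d *.
(* Rotations cost no step, so the derivation is followed down to its last face, merge or fold, whose
   parts have fewer steps and are covered by [Psi]. *)
have : rot_popular s.+1 avg w.
  move ei: (s.+1) d => s1 d; elim: d ei => {s1 j w}.
  - move=> a b c fabc [s0]; exists [:: Some a; Some b; Some c].
    rewrite /avg s0 /=; split=> // W1 W2 eW.
    have szW : size (W2 ++ W1) = 3%N by rewrite size_cat addnC -size_cat -eW.
    apply: le_trans (face_popular fabc) _; rewrite eW popularity_catC.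
    rewrite !popularityE szW; apply: ler_wpM2l.
      by rewrite invr_ge0 exprn_ge0 // ltW.
    apply: le_sums => V sV; apply: ler_wpM2l; first exact: ptrace_ge0.
    have : (size W2 <= 3)%N by move: szW; rewrite size_cat => <-; apply: leq_addr.
    case: V sV => [|x [|y [|z []]]] // _.
    case: (size W2) => [|[|[|[|//]]]] _ //=; rewrite /rot /=.
      by rewrite -F_rot.
    by rewrite F_rot.
  - move=> s1 j u v _ IHd es.
    have [W [eW sW pW]] := IHd es.
    have [Wu [Wv [e eu ev]]] := pmap_id_cat eW.
    exists (Wv ++ Wu); split.
    + by rewrite pmap_cat eu ev.
    + by rewrite size_cat addnC -size_cat -e.
    move=> W1 W2 /rotation_trans[X [Y [eX ->]]].
    by apply: pW; rewrite e.
  - move=> s1 j1 s2 j2 u v a u0 v0 d1 _ d2 _ [es].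
    rewrite -es; have s10 := disc_steps_gt0 d1; have s20 := disc_steps_gt0 d2.
    have les1 : (s1 <= s)%N by lia. have les2 : (s2 <= s)%N by lia.
    have [X1 [eX1 /andP[X10 X1s] pX1]] := rot_popular_rcons u0 (pP _ _ _ les1 d1).
    have [X2 [eX2 /andP[X20 X2s] pX2]] := rot_popular_rcons v0 (pP _ _ _ les2 d2).
    exists (X1 ++ fan3 T ++ X2 ++ fan3 T); rewrite !pmap_cat pmap_fan3 cats0 eX1 eX2.
    rewrite !size_cat !size_fan3; split=> //; first lia.
    have n1 : (size X1 < L)%N by rewrite /L; lia.
    have n2 : (size X2 < L)%N by rewrite /L; lia.
    have ns : (s1 < S)%N by lia.
    move=> V1 V2; apply: (avgP _ (inr (Ordinal ns, Ordinal n1, Ordinal n2))).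
    - lia.
    - by rewrite !size_cat !size_fan3; lia.
    rewrite /=; have -> : (s - s1 = s2)%N by lia.
    have ga : merge_good (eta_ s) (gam_ s) a.
      by case: (goodP _ _ _ a d1) => //; rewrite mem_rcons mem_head.
    have := popularity_merge Fdet2 Fdet3 N_gt0 K_ge0 (kP s1) (kP s2) X10 X20
      (gam_ge0 s) ga.
    apply: le_trans; apply: le_trans (c_step _) _; first by lia.
    apply: ler_wpM2l => //; rewrite lerB // expr2.
    have [c0 _] := andP (c_ge0 s).
    by apply: ler_pM => //; [apply: le_trans pX1 | apply: le_trans pX2]; apply: c_dec; lia.
  move=> s1 j u a u0 d _ [es].
  rewrite -es in d *; have s0 := disc_steps_gt0 d.
  have [X [m [eX X0 Xs pX]]] := rot_popular_fold u0 (pP _ _ _ (leqnn s) d).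
  exists (X ++ fan3 T); rewrite pmap_cat pmap_fan3 cats0 eX size_cat size_fan3.
  split=> //; first lia.
  have n1 : (size X < L)%N by rewrite /L; lia.
  have n2 : (m < L)%N by rewrite /L; lia.
  move=> V1 V2; apply: (avgP _ (inl (Ordinal n1, Ordinal n2))) => //=.
    by rewrite size_cat size_fan3; lia.
  have aw : a \in u ++ [:: a; linv a] by rewrite mem_cat inE eqxx orbT.
  have [ga _] := goodP _ _ _ _ d aw.
  have := popularity_fold Fdet2 Fdet3 N_gt0 K_ge0 (kP s) X0 (gam_ge0 s) (ga m n2).
  apply: le_trans; apply: le_trans (c_step _) _; first by lia.
  apply: ler_wpM2l => //; rewrite lerB // (le_trans _ pX) //.
  by have /andP[c0 c1] := c_ge0 s; rewrite expr2 ler_piMl.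
by [].
Qed.

Lemma popularity_ge0 Psi W : kernel Psi -> 0 <= popularity Psi W.
Proof.
move=> [p0 _]; rewrite mulr_ge0 ?invr_ge0 ?exprn_ge0 ?ler0n //.
by apply: sums_ge0 => V _; rewrite mulr_ge0 ?ptrace_ge0.
Qed.

(** A word [x y^-1] is padded in three places, which with the number of steps gives [S.+1 * L ^ 3]
    patterns. For each pattern the popularities sum to at most 1 over [y], while every [y] in [P]
    has popularity at least [c_ S] in some pattern. *)
Lemma disc_degree (x : T) (P : pred T) :
  (forall y, P y -> exists s j, (s <= S)%N /\ disc face s j [:: x; linv y]) ->
  #|P|%:R * c_ S <= (S.+1 * L ^ 3)%:R.
Proof.
move=> Pd; have [Psi [kP pP]] := universal_kernels (leqnn S).
pose pad (i : 'I_S.+1 * ('I_L * 'I_L * 'I_L)) y := popularity (Psi i.1)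
  ((nseq i.2.1.1 None ++ Some x :: nseq i.2.1.2 None) ++
   Some (linv y) :: nseq i.2.2 None).
have padP y : P y -> c_ S <= \sum_i pad i y.
  move=> /Pd[s [j [les /(pP _ _ _ les)[W [eW sW pW]]]]].
  have [W1 [W2 [e /pmap_id_seq1[m1 [k1 e1]] /pmap_id_seq1[m2 [k2 e2]]]]] :=
    @pmap_id_cat _ _ [:: x] [:: linv y] eW.
  move: sW (pW W [::]); rewrite e e1 e2 cats0 => sW /(_ erefl) pW1.
  rewrite !(size_cat, size_nseq) /= !size_nseq in sW.
  have l1 : (m1 < L)%N by rewrite /L; nia.
  have l2 : (k1 + m2 < L)%N by rewrite /L; nia.
  have l3 : (k2 < L)%N by rewrite /L; nia.
  apply: le_trans (c_dec les) _; apply: le_trans pW1 _.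
  pose i := (inord s : 'I_S.+1, (Ordinal l1, Ordinal l2, Ordinal l3)).
  apply: le_trans (_ : pad i y <= _).
    by rewrite /pad /= inordK // nseqD -!catA /= -!catA.
  by apply: (ler_sum1 i (f := pad^~ y)) => i'; apply: popularity_ge0.
apply: le_trans (_ : \sum_y \sum_i pad i y <= _); last first.
  rewrite exchange_big; apply: le_trans (_ : \sum_(i : 'I_S.+1 * ('I_L * 'I_L * 'I_L)) 1 <= _).
    apply: ler_sum => i _; rewrite /pad.
    rewrite (sum_inv (@linvK A) (fun y => popularity (Psi i.1)
      ((nseq i.2.1.1 None ++ Some x :: nseq i.2.1.2 None) ++
       Some y :: nseq i.2.2 None))).
    exact: sum_popularity_letter.
  by rewrite sumr_const !card_prod !card_ord !expnS expn0 muln1 !mulnA lexx.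
rewrite -sumr_const mulr_suml big_mkcond /=; apply: ler_sum => y _.
case: ifP => Py; first by rewrite mul1r; apply: padP.
by apply: sumr_ge0 => i _; apply: popularity_ge0.
Qed.

End Universal.

(** * Most edges can be folded and merged *)

Section Dumbbell.
Variables (R : realFieldType) (T : finType) (inv : T -> T).
Variable F : T -> T -> T -> bool.
Hypothesis invK : involutive inv.
Hypothesis F_swap : forall g u h, F g u h -> F h (inv u) g.
Hypothesis F_flip : forall g u h, F g u h -> F (inv g) h u.
Hypothesis Fdet1 : forall a a' u h, F a u h -> F a' u h -> a = a'.
Hypothesis Fdet2 : forall a u u' h, F a u h -> F a u' h -> u = u'.
Hypothesis Fdet3 : forall a u h h', F a u h -> F a u h' -> h = h'.
Local Notation N := (#|T|%:R : R).
Hypothesis N_gt0 : 0 < N.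
Implicit Types (a b c u : T) (W : seq (option T)) (U V L : seq T).
Local Notation paths := (@paths R T F).
Local Notation ptrace := (@ptrace R T F).
Local Notation zipper := (@zipper T inv).
Local Notation rinv := (@word_rinv T inv).
Local Notation fan3 := (fan3 T).

Let N_neq0 : N != 0. Proof. by rewrite gt_eqF. Qed.

Lemma F_swapE g u h : F h (inv u) g = F g u h.
Proof. by apply/idP/idP => /F_swap; rewrite ?invK. Qed.

Lemma F_flipE g u h : F (inv g) h u = F g u h.
Proof. by apply/idP/idP => /F_flip; rewrite ?invK. Qed.

Lemma stepE a s u b :
  (step F a (Some s) u b)%:R = \sum_h (F a u h)%:R * (F s b h)%:R :> R.
Proof.
rewrite /=; case: existsP => [[h /andP[ah sh]]|no].
  rewrite (bigD1 h) //= ah sh mulr1 big1 ?addr0 // => h' nh.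
  case: (boolP (F a u h')) => [ah'|]; last by rewrite mul0r.
  by rewrite (Fdet3 ah ah') eqxx in nh.
rewrite big1 // => h _; case: (boolP (F a u h)) => [ah|]; last by rewrite mul0r.
by case: (boolP (F s b h)) => [sh|]; [case: no; exists h; rewrite ah | rewrite mulr0].
Qed.

Lemma sum_F12 h : \sum_a \sum_u (F a u h)%:R <= N.
Proof.
apply: le_trans (_ : \sum_(a : T) 1 <= _); last by rewrite sumr_const.
apply: ler_sum => a _; apply: sum_uniq_le1 => u u'; exact: Fdet2.
Qed.

Lemma paths_cons a t u W V b :
  paths a (t :: W) (u :: V) b = \sum_c (step F a t u c)%:R * paths c W V b.
Proof. by []. Qed.

Lemma nseq_rcons k : nseq k.+1 (@None T) = nseq k None ++ [:: None].
Proof. by rewrite -addn1 nseqD. Qed.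

Lemma rinv_cons u V : rinv (u :: V) = rinv V ++ [:: inv u].
Proof. by rewrite /word_rinv /= rev_cons cats1. Qed.

Lemma size_rinv V : size (rinv V) = size V.
Proof. by rewrite /word_rinv size_rev size_map. Qed.

Lemma paths_rev k V a b : size V = k ->
  paths a (nseq k None) V b = paths b (nseq k None) (rinv V) a.
Proof.
elim: k V a b => [|k IH] [|u V] a b //.
  by move=> _; rewrite /word_rinv /paths /= eq_sym.
case=> sV.
rewrite rinv_cons [in RHS]nseq_rcons paths_cat ?size_nseq ?size_rinv //.
rewrite paths_cons; apply: eq_bigr => c _.
by rewrite paths1 /= F_swapE (IH V c b sV) mulrC.
Qed.

Lemma sums_rinv k (f : seq T -> R) : sums k (fun V => f (rinv V)) = sums k f.
Proof.
elim: k f => [//|k IH] f; rewrite sumsS sums_rcons -exchange_sums.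
rewrite -[RHS]IH; apply: eq_sums => V _.
under eq_bigr => x _ do rewrite rinv_cons cats1.
exact: (sum_inv invK (fun x => f (rcons (rinv V) x))).
Qed.

Definition spokes g V k := paths g (nseq (size V) None) V k.
Definition cones V := ptrace (nseq (size V) None) V.

Lemma spokes_ge0 g V k : 0 <= spokes g V k. Proof. exact: paths_ge0. Qed.

Lemma cones_ge0 V : 0 <= cones V. Proof. exact: ptrace_ge0. Qed.

Lemma cones_le V : cones V <= N.
Proof.
apply: le_trans (_ : \sum_(a : T) 1 <= _); last by rewrite sumr_const.
by apply: ler_sum => a _; apply: paths_le1.
Qed.

(* The number of hubs [Q] with spokes [g], ..., [k] and [s^-1], where [P] is
   adjacent through [s]. *)
Definition hubs V b h := cones (V ++ [:: inv b; h]).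

Lemma hubsE V b h : hubs V b h =
  \sum_g \sum_k spokes g V k * \sum_s (F s k b)%:R * (F s g h)%:R.
Proof.
rewrite /hubs /cones size_cat nseqD /ptrace; apply: eq_bigr => g _.
rewrite paths_cat ?size_nseq //; apply: eq_bigr => k _; congr (_ * _).
rewrite -(sum_inv invK) /= paths_cons; apply: eq_bigr => s _.
rewrite paths1 /=; congr (_%:R * _%:R).
  by rewrite -[s in RHS]invK F_flipE -[s in LHS]invK F_swapE invK.
by rewrite F_flipE.
Qed.

Lemma paths_last m s V g b : size V = m.+1 ->
  paths g (nseq m None ++ [:: Some s]) V b =
  \sum_k spokes g V k * (F s b k)%:R.
Proof.
case/lastP: V => [//|V u]; rewrite size_rcons => -[sV].
rewrite -cats1 paths_cat ?size_nseq //.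
under [RHS]eq_bigr => k _ do
  rewrite /spokes size_cat addn1 nseq_rcons paths_cat ?size_nseq // mulr_suml.
rewrite exchange_big; apply: eq_bigr => c _ /=.
rewrite paths1 stepE mulr_sumr sV; apply: eq_bigr => k _.
by rewrite paths1 mulrA.
Qed.

(** The tip of the zipper is an open star around the far endpoint Q of the edge [s]. Summing over
    [s] lets Q vary over the hubs of the link formed by [V], [b^-1] and [h]. *)
Lemma zipperE m a v V b : size V = m.+1 ->
  \sum_s paths a (zipper s m) (v :: V) b =
  \sum_h (F a v h)%:R * hubs V b h.
Proof.
move=> sV; transitivity (\sum_s \sum_g \sum_h (F a v h)%:R *
  ((F s g h)%:R * \sum_k spokes g V k * (F s k b)%:R)).
  apply: eq_bigr => s _; rewrite /zipper paths_cons; apply: eq_bigr => g _.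
  rewrite stepE paths_last // mulr_suml; apply: eq_bigr => h _.
  by rewrite mulrA; under eq_bigr do rewrite F_flipE.
under eq_bigr do rewrite exchange_big /=; rewrite exchange_big /=.
apply: eq_bigr => h _; rewrite hubsE mulr_sumr exchange_big /=.
apply: eq_bigr => g _; rewrite -mulr_sumr; congr (_ * _).
under eq_bigr do rewrite mulr_sumr; rewrite exchange_big /=.
apply: eq_bigr => k _; rewrite mulr_sumr; apply: eq_bigr => s _; ring.
Qed.

(* The words [V] and [L] bound a strip along the doubled edge [s], closed up by a
   fan of three faces. *)
Definition dumbbell V L : R :=
  N ^- 2 * \sum_s \sum_a \sum_b paths a (zipper s (size V).-2) V b * paths a fan3 L b.

Lemma dumbbell_ge0 V L : 0 <= dumbbell V L.
Proof.
rewrite mulr_ge0 ?invr_ge0 ?exprn_ge0 ?ler0n //.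
apply: sumr_ge0 => s _; apply: sumr_ge0 => a _; apply: sumr_ge0 => b _.
by rewrite mulr_ge0 ?paths_ge0.
Qed.

Lemma sum_paths_all W V : \sum_(s : T) \sum_a \sum_b paths a W V b <= N ^+ 2.
Proof.
apply: le_trans (_ : \sum_(s : T) \sum_(a : T) 1 <= _); last first.
  by rewrite !sumr_const expr2 mulr_natl.
by apply: ler_sum => s _; apply: ler_sum => a _; apply: sum_paths_end.
Qed.

Lemma dumbbell_unitl V1 V2 L : \sum_x dumbbell (V1 ++ x :: V2) L <= 1.
Proof.
rewrite /dumbbell -mulr_sumr ler_pdivrMl ?exprn_gt0 // mulr1.
apply: le_trans (sum_paths_all fan3 L).
rewrite exchange_big; apply: ler_sum => s _ /=.
rewrite exchange_big; apply: ler_sum => a _ /=.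
rewrite exchange_big; apply: ler_sum => b _ /=.
rewrite -mulr_suml ler_piMl ?paths_ge0 //.
under eq_bigr do rewrite size_cat /=.
exact: sum_paths_letter.
Qed.

Lemma dumbbell_unitr V L1 L2 : \sum_x dumbbell V (L1 ++ x :: L2) <= 1.
Proof.
rewrite /dumbbell -mulr_sumr ler_pdivrMl ?exprn_gt0 // mulr1.
rewrite exchange_big /=; apply: le_trans (_ : \sum_(s : T) \sum_(a : T) 1 <= _); last first.
  by rewrite !sumr_const expr2 mulr_natl.
apply: ler_sum => s _; rewrite exchange_big; apply: ler_sum => a _ /=.
rewrite exchange_big; apply: le_trans (sum_paths_end R Fdet2 Fdet3 a (zipper s (size V).-2) V).
apply: ler_sum => b _ /=.
rewrite -mulr_sumr ler_piMr ?paths_ge0 //; exact: sum_paths_letter.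
Qed.

Lemma paths3E a x y z b : paths a fan3 [:: x; y; z] b =
  \sum_h \sum_s (F a x h)%:R * (F h y s)%:R * (F s z b)%:R.
Proof.
rewrite paths_cons; apply: eq_bigr => h _.
rewrite paths_cons mulr_sumr; apply: eq_bigr => s _.
by rewrite paths1 /= mulrA.
Qed.

Lemma dumbbellE v V L : (0 < size V)%N -> dumbbell (v :: V) L =
  N ^- 2 * \sum_a \sum_b (\sum_h (F a v h)%:R * hubs V b h) * paths a fan3 L b.
Proof.
move=> V0; congr (_ * _); rewrite exchange_big; apply: eq_bigr => a _ /=.
rewrite exchange_big; apply: eq_bigr => b _ /=.
by rewrite -mulr_suml -(@zipperE (size V).-1) // prednK.
Qed.

Definition cones6 v g k L := cones ([:: v; inv g; k] ++ rinv L).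

Lemma cones6E v g k L : size L = 3%N -> cones6 v g k L =
  \sum_a \sum_b (\sum_h \sum_s (F a v h)%:R * (F s g h)%:R * (F s k b)%:R) *
    paths a fan3 L b.
Proof.
move=> sL; rewrite /cones6 /cones size_cat nseqD /ptrace; apply: eq_bigr => a _.
rewrite paths_cat //; apply: eq_bigr => b _.
rewrite size_rinv sL -paths_rev // paths3E; congr (_ * _).
by apply: eq_bigr => h _; apply: eq_bigr => s _; rewrite F_swapE.
Qed.

(** The dumbbell is cut along the edge [s] from P to Q: P has the link [v, g^-1, k, L^-1] of length
    six, and Q keeps the spokes from [g] to [k] along [V]. Both hubs are free, so popular links make
    popular dumbbells. *)
Lemma dumbbell_cones6 v V L : (0 < size V)%N -> size L = 3%N ->
  dumbbell (v :: V) L = N ^- 2 * \sum_g \sum_k spokes g V k * cones6 v g k L.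
Proof.
move=> V0 sL; rewrite dumbbellE //; congr (_ * _).
under [RHS]eq_bigr => g _ do under eq_bigr => k _ do rewrite cones6E // mulr_sumr.
under [RHS]eq_bigr => g _ do rewrite exchange_big /=.
rewrite [RHS]exchange_big; apply: eq_bigr => a _ /=.
under [RHS]eq_bigr => g _ do under eq_bigr => k _ do rewrite mulr_sumr.
under [RHS]eq_bigr => g _ do rewrite exchange_big /=.
rewrite [RHS]exchange_big; apply: eq_bigr => b _ /=.
under [RHS]eq_bigr => g _ do under eq_bigr => k _ do rewrite mulrA mulr_sumr.
under [RHS]eq_bigr => g _ do rewrite -mulr_suml exchange_big /=.
rewrite -mulr_suml; congr (_ * _); rewrite [RHS]exchange_big.
apply: eq_bigr => h _ /=; rewrite hubsE mulr_sumr; apply: eq_bigr => g _.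
rewrite mulr_sumr; apply: eq_bigr => k _; rewrite mulrCA; congr (_ * _).
rewrite mulr_sumr; apply: eq_bigr => s _; ring.
Qed.

Definition fans a b : R := sums 3 (fun L => paths a fan3 L b).

(** The zipper itself contains three faces around P from the spoke [a] to the spoke [b], through [h]
    and [s]. Hence spokes joined by few fans of three faces occur in few zippers, as [fans_few]
    makes precise. *)
Lemma fansE a b : fans a b = \sum_v \sum_h \sum_g \sum_k
  (F a v h)%:R * \sum_s (F s k b)%:R * (F s g h)%:R.
Proof.
rewrite /fans !sumsS; apply: eq_bigr => v _.
rewrite sumsS; under eq_bigr => g _ do rewrite sumsS.
transitivity (\sum_g \sum_k \sum_h \sum_s
  (F a v h)%:R * (F h (inv g) s)%:R * (F s k b)%:R : R).
  rewrite -(sum_inv invK); apply: eq_bigr => g _; apply: eq_bigr => k _.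
  exact: paths3E.
rewrite [RHS]exchange_big; apply: eq_bigr => g _ /=.
rewrite [RHS]exchange_big; apply: eq_bigr => k _ /=.
apply: eq_bigr => h _; rewrite mulr_sumr; apply: eq_bigr => s _.
by rewrite F_swapE -mulrA [X in _ * X]mulrC.
Qed.

Lemma fans_few th : 0 <= th ->
  \sum_a \sum_b (fans a b < th * N ^+ 2)%R%:R * fans a b <= th * N ^+ 4.
Proof.
move=> th0; have -> : th * N ^+ 4 = \sum_(a : T) \sum_(b : T) th * N ^+ 2.
  have c (x : R) : \sum_(a : T) x = N * x by rewrite sumr_const mulr_natl.
  by rewrite !c; move: (#|T|%:R : R) => x; ring.
apply: ler_sum => a _; apply: ler_sum => b _.
case: ltP => [/ltW|_]; rewrite ?mul1r ?mul0r //.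
by rewrite mulr_ge0 // exprn_ge0 // ltW.
Qed.

Local Notation detour := (@detour R T F dumbbell).

(** * Exceptional configurations for folding *)

Section Counting.
Variables (m : nat) (th1 th2 th3 be1 be2 : R).
Hypotheses (th1_gt0 : 0 < th1) (th2_gt0 : 0 < th2) (th3_gt0 : 0 < th3).
Hypothesis stars_hub : sums m.+3 (fun V => cones V * (cones V < th1 * N)%R%:R)
  <= be1 * N ^+ m.+3.
Hypothesis stars6 : sums 6 (fun V => cones V * (cones V < th2 * N)%R%:R)
  <= be2 * N ^+ 6.

Definition bad_hubs v V b h L := \sum_g \sum_k spokes g V k *
  (\sum_s (F s k b)%:R * (F s g h)%:R) * (cones6 v g k L < th2 * N)%R%:R.

Lemma sum_FF_ge0 k b g h : 0 <= \sum_s (F s k b)%:R * (F s g h)%:R :> R.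
Proof. by apply: sumr_ge0 => s _; rewrite mulr_ge0 ?ler0n. Qed.

Lemma sum_FF_le1 k b g h : \sum_s (F s k b)%:R * (F s g h)%:R <= 1 :> R.
Proof.
apply: le_trans (_ : \sum_s (F s k b)%:R <= _).
  by apply: ler_sum => s _; rewrite ler_piMr ?ler0n ?lern1 ?leq_b1.
by apply: sum_uniq_le1 => s s'; apply: Fdet1.
Qed.

Lemma bad_hubs_ge0 v V b h L : 0 <= bad_hubs v V b h L.
Proof.
apply: sumr_ge0 => g _; apply: sumr_ge0 => k _.
by rewrite !mulr_ge0 ?spokes_ge0 ?sum_FF_ge0 ?ler0n.
Qed.

Lemma hubs_ge0 V b h : 0 <= hubs V b h. Proof. exact: cones_ge0. Qed.

(** If the link of Q has [th1 * N] hubs and fewer than half that many lead to a six-link with under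
    [th2 * N] hubs, the dumbbell weighs at least [th1 * th2 / 2]. Any other case is charged to the
    unpopular link or to the bad hubs. *)
Lemma dumbbell_popular v V b h L : (0 < size V)%N -> size L = 3%N ->
  hubs V b h * (dumbbell (v :: V) L < th1 * th2 / 2)%R%:R <=
  hubs V b h * (hubs V b h < th1 * N)%R%:R + 2 / th1 * bad_hubs v V b h L.
Proof.
move=> V0 sL; have bh0 := bad_hubs_ge0 v V b h L; have h0 := hubs_ge0 V b h.
have c0 : 0 <= 2 / th1 * bad_hubs v V b h L.
  by rewrite mulr_ge0 // mulr_ge0 ?ler0n // invr_ge0 ltW.
case: ltP => [lt|_]; last by rewrite mulr0 addr_ge0 // mulr_ge0 ?ler0n.
rewrite mulr1; case: ltP => [_|ge]; first by rewrite mulr1 lerDl.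
rewrite mulr0 add0r; apply: le_trans (cones_le _) _.
rewrite leNgt; apply/negP => lt2; move: lt; rewrite ltNge => /negP[].
have lt3 : bad_hubs v V b h L < th1 * N / 2.
  move: lt2; rewrite mulrAC ltr_pdivrMr //; lra.
rewrite dumbbell_cones6 // ler_pdivlMl ?exprn_gt0 //.
apply: le_trans (_ : th2 * N * (hubs V b h - bad_hubs v V b h L) <= _).
  have le4 : th1 * N / 2 <= hubs V b h - bad_hubs v V b h L.
    by move: ge lt3; lra.
  apply: le_trans (_ : th2 * N * (th1 * N / 2) <= _).
    by rewrite le_eqVlt; apply/orP; left; apply/eqP; ring.
  by apply: ler_wpM2l le4; rewrite mulr_ge0 // ltW.
rewrite hubsE /bad_hubs -sumrB mulr_sumr; apply: ler_sum => g _.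
rewrite -sumrB mulr_sumr; apply: ler_sum => k _.
have sp0 := spokes_ge0 g V k; have F0 := sum_FF_ge0 k b g h.
have F1 := sum_FF_le1 k b g h.
case: ltP => [_|ge6]; first by rewrite mulr1 subrr mulr0 mulr_ge0 // cones_ge0.
rewrite mulr0 subr0 mulrC -mulrA; apply: ler_wpM2l => //.
apply: le_trans ge6; apply: ler_piMl => //.
by rewrite mulr_ge0 // ltW.
Qed.

Lemma sum_spokes_at g k : sums m.+1 (fun V => spokes g V k) <= N ^+ m.
Proof.
apply: le_trans (@sums_paths R T F Fdet2 Fdet3 m g _ k (size_nseq m.+1 None)).
by apply: le_sums => V sV; rewrite /spokes sV.
Qed.

Lemma sum_around (w : seq T -> T -> T -> R) : (forall V b h, 0 <= w V b h) ->
  \sum_a \sum_b \sum_v sums m.+1 (fun V => \sum_h sums 3 (fun L =>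
    (F a v h)%:R * paths a fan3 L b * w V b h)) <=
  N ^+ 3 * \sum_b sums m.+1 (fun V => \sum_h w V b h).
Proof.
move=> w0; apply: le_trans (_ : N ^+ 2 * \sum_a \sum_b \sum_v
  sums m.+1 (fun V => \sum_h (F a v h)%:R * w V b h) <= _).
  rewrite mulr_sumr; apply: ler_sum => a _; rewrite mulr_sumr; apply: ler_sum => b _.
  rewrite mulr_sumr; apply: ler_sum => v _; rewrite -sumsZ; apply: le_sums => V _.
  rewrite mulr_sumr; apply: ler_sum => h _.
  under eq_sums => L _ do rewrite mulrAC.
  rewrite sumsZ mulrC; apply: ler_wpM2r; first by rewrite mulr_ge0 ?ler0n.
  exact: (@sums_paths R T F Fdet2 Fdet3 2 a fan3 b erefl).
rewrite (exprSr N 2) -mulrA; apply: ler_wpM2l; first by rewrite exprn_ge0 // ltW.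
rewrite exchange_big mulr_sumr; apply: ler_sum => b _ /=.
under eq_bigr => a _ do rewrite -exchange_sums.
rewrite -exchange_sums -sumsZ; apply: le_sums => V _ /=.
under eq_bigr => a _ do rewrite exchange_big /=.
rewrite exchange_big mulr_sumr; apply: ler_sum => h _ /=.
under eq_bigr => a _ do rewrite -mulr_suml.
by rewrite -mulr_suml; apply: ler_wpM2r (sum_F12 h).
Qed.

(** Sorted by the six-link around P: for given [g] and [k] the spokes along [V] contribute at most
    [N ^ m], and the remaining sum runs over unpopular six-links. *)
Lemma sum_bad_hubs :
  \sum_a \sum_b \sum_v sums m.+1 (fun V => \sum_h sums 3 (fun L =>
    (F a v h)%:R * paths a fan3 L b * bad_hubs v V b h L)) <= be2 * N ^+ (m + 6).
Proof.
pose f v g k L := cones6 v g k L * (cones6 v g k L < th2 * N)%R%:R.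
apply: le_trans (_ : N ^+ m * \sum_v \sum_g \sum_k sums 3 (f v g k) <= _); last first.
  rewrite exprD mulrCA; apply: ler_wpM2l; first by rewrite exprn_ge0 // ltW.
  apply: le_trans stars6; rewrite !sumsS le_eqVlt; apply/orP; left; apply/eqP.
  apply: eq_bigr => v _; rewrite sumsS -(sum_inv invK); apply: eq_bigr => g _.
  rewrite sumsS; apply: eq_bigr => k _.
  rewrite -(sums_rinv 3 (fun L => cones [:: v, inv g, k & L] *
    (cones [:: v, inv g, k & L] < th2 * N)%R%:R)).
  by apply: eq_sums => L _.
pose q v g k L a b : R := (\sum_h \sum_s (F a v h)%:R * (F s g h)%:R * (F s k b)%:R) *
    paths a fan3 L b * (cones6 v g k L < th2 * N)%R%:R.
apply: le_trans (_ : N ^+ m * \sum_v \sum_g \sum_k sums 3 (fun L =>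
  \sum_a \sum_b q v g k L a b) <= _); last first.
  apply: ler_wpM2l; first by rewrite exprn_ge0 // ltW.
  apply: ler_sum => v _; apply: ler_sum => g _; apply: ler_sum => k _.
  apply: le_sums => L sL; rewrite /f {1}cones6E // mulr_suml; apply: ler_sum => a _.
  by rewrite mulr_suml.
have -> : \sum_v \sum_g \sum_k sums 3 (fun L => \sum_a \sum_b q v g k L a b) =
  \sum_a \sum_b \sum_v sums 3 (fun L => \sum_g \sum_k q v g k L a b).
  under eq_bigr => v _ do under eq_bigr => g _ do rewrite -exchange_sums.
  under eq_bigr => v _ do rewrite -exchange_sums.
  under eq_bigr => v _ do under eq_sums => L _ do under eq_bigr => g _ do
    rewrite exchange_big /=.
  under eq_bigr => v _ do under eq_sums => L _ do rewrite exchange_big /=.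
  under eq_bigr => v _ do rewrite exchange_sums.
  rewrite exchange_big /=; apply: eq_bigr => a _.
  under eq_bigr => v _ do under eq_sums => L _ do under eq_bigr => g _ do
    rewrite exchange_big /=.
  under eq_bigr => v _ do under eq_sums => L _ do rewrite exchange_big /=.
  under eq_bigr => v _ do rewrite exchange_sums.
  by rewrite exchange_big /=.
rewrite mulr_sumr; apply: ler_sum => a _; rewrite mulr_sumr; apply: ler_sum => b _.
rewrite mulr_sumr; apply: ler_sum => v _; rewrite -sumsZ.
under eq_sums => V _ do rewrite -exchange_sums.
rewrite sums_sums; apply: le_sums => L sL.
rewrite mulr_sumr exchange_sums.
apply: le_trans (_ : \sum_h \sum_g \sum_k (F a v h)%:R * paths a fan3 L b *
   (\sum_s (F s k b)%:R * (F s g h)%:R) * (cones6 v g k L < th2 * N)%R%:R *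
   N ^+ m <= _).
  apply: ler_sum => h _; rewrite /bad_hubs.
  under eq_sums => V _ do rewrite mulr_sumr.
  rewrite exchange_sums; apply: ler_sum => g _.
  under eq_sums => V _ do rewrite mulr_sumr.
  rewrite exchange_sums; apply: ler_sum => k _.
  set x := _ * paths _ _ _ _; set y := \sum_s _; set z := _%:R.
  have -> : sums m.+1 (fun V => x * (spokes g V k * y * z)) =
    x * y * z * sums m.+1 (fun V => spokes g V k).
    by rewrite -sumsZ; apply: eq_sums => V _; ring.
  apply: ler_wpM2l (sum_spokes_at g k).
  by rewrite !mulr_ge0 ?ler0n ?paths_ge0 ?sum_FF_ge0.
rewrite exchange_big; apply: ler_sum => g _ /=.
rewrite exchange_big mulr_sumr; apply: ler_sum => k _ /=.
have -> : q v g k L a b = (\sum_h (F a v h)%:R *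
    (\sum_s (F s k b)%:R * (F s g h)%:R)) * paths a fan3 L b *
    (cones6 v g k L < th2 * N)%R%:R.
  congr (_ * _ * _); apply: eq_bigr => h _.
  by rewrite mulr_sumr; apply: eq_bigr => s _; ring.
rewrite [leRHS]mulrC 3!mulr_suml; apply: ler_sum => h _.
by rewrite le_eqVlt; apply/orP; left; apply/eqP; ring.
Qed.

Lemma sum_dumbbell_unpopular :
  \sum_a \sum_b \sum_v sums m.+1 (fun V => \sum_h sums 3 (fun L =>
    (F a v h)%:R * paths a fan3 L b *
    (hubs V b h * (dumbbell (v :: V) L < th1 * th2 / 2)%R%:R)))
  <= (be1 + 2 / th1 * be2) * N ^+ (m + 6).
Proof.
pose w V b h := hubs V b h * (hubs V b h < th1 * N)%R%:R.
have w0 V b h : 0 <= w V b h by rewrite mulr_ge0 ?hubs_ge0 ?ler0n.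
have bw : \sum_b sums m.+1 (fun V => \sum_h w V b h) <= be1 * N ^+ m.+3.
  apply: le_trans stars_hub; have -> : m.+3 = (m.+1 + 2)%N by rewrite addn2.
  rewrite sums_cat.
  rewrite -exchange_sums; apply: le_sums => V _.
  rewrite sumsS -[leRHS](sum_inv invK) le_eqVlt; apply/orP; left; apply/eqP.
  by apply: eq_bigr => b _; rewrite sums1.
have B1 := le_trans (sum_around w0) (ler_wpM2l (exprn_ge0 3 (ltW N_gt0)) bw).
have c0 : 0 <= 2 / th1 by rewrite mulr_ge0 ?ler0n // invr_ge0 ltW.
have -> : (be1 + 2 / th1 * be2) * N ^+ (m + 6) =
    N ^+ 3 * (be1 * N ^+ m.+3) + 2 / th1 * (be2 * N ^+ (m + 6)).
  rewrite (_ : (m + 6 = 3 + m.+3)%N); last by rewrite -[m.+3]addn3 addnCA.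
  by rewrite exprD; move: (N ^+ 3) (N ^+ m.+3) => x y; ring.
apply: le_trans (lerD B1 (ler_wpM2l c0 sum_bad_hubs)).
rewrite mulr_sumr -big_split; apply: ler_sum => a _ /=.
rewrite mulr_sumr -big_split; apply: ler_sum => b _ /=.
rewrite mulr_sumr -big_split; apply: ler_sum => v _ /=.
rewrite -sumsZ -sumsD; apply: le_sums => V sV.
rewrite mulr_sumr -big_split; apply: ler_sum => h _ /=.
rewrite -sumsZ -sumsD; apply: le_sums => L sL.
rewrite [X in _ + X]mulrCA -mulrDr.
apply: ler_wpM2l; first by rewrite mulr_ge0 ?paths_ge0 ?ler0n.
by apply: dumbbell_popular; rewrite ?sV.
Qed.

Lemma sum_hubs a b :
  \sum_v sums m.+1 (fun V => \sum_h (F a v h)%:R * hubs V b h) <=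
  N ^+ m * fans a b.
Proof.
rewrite fansE mulr_sumr; apply: ler_sum => v _.
rewrite exchange_sums mulr_sumr; apply: ler_sum => h _.
under eq_sums => V _ do rewrite hubsE mulr_sumr.
rewrite exchange_sums mulr_sumr; apply: ler_sum => g _.
under eq_sums => V _ do rewrite mulr_sumr.
rewrite exchange_sums mulr_sumr; apply: ler_sum => k _.
under eq_sums => V _ do rewrite mulrCA.
rewrite sumsZr; apply: ler_wpM2r (sum_spokes_at g k).
by rewrite mulr_ge0 ?ler0n ?sum_FF_ge0.
Qed.

Local Notation gam := (th1 * th2 * th3 / 4).

(** If there are [th3 * N ^ 2] fans from [a] to [b] and under half that many close up to an
    unpopular dumbbell, the detour weighs at least [th1 * th2 / 2 * (th3 / 2)]. *)
Lemma detour_popular a b v V :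
  (detour a b (v :: V) < gam)%R%:R <= (fans a b < th3 * N ^+ 2)%R%:R +
    2 / (th3 * N ^+ 2) * sums 3 (fun L => paths a fan3 L b *
      (dumbbell (v :: V) L < th1 * th2 / 2)%R%:R).
Proof.
set bad := sums 3 _.
have N2 : 0 < N ^+ 2 by rewrite exprn_gt0.
have bad0 : 0 <= bad by apply: sums_ge0 => L _; rewrite mulr_ge0 ?paths_ge0 ?ler0n.
have tN : 0 < th3 * N ^+ 2 by rewrite mulr_gt0.
have c0 : 0 <= 2 / (th3 * N ^+ 2) * bad.
  by rewrite mulr_ge0 // mulr_ge0 ?ler0n // invr_ge0 ltW.
case: ltP => [lt|_]; last by rewrite addr_ge0 ?ler0n.
case: ltP => [_|ge]; first by rewrite lerDl.
rewrite add0r leNgt; apply/negP => lt2; move: lt; rewrite ltNge => /negP[].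
have lt3 : bad < th3 * N ^+ 2 / 2.
  move: lt2; rewrite mulrAC ltr_pdivrMr // mul1r => lt2.
  by rewrite ltr_pdivlMr ?ltr0n // mulrC.
rewrite detourE ler_pdivlMl //.
apply: le_trans (_ : th1 * th2 / 2 * (fans a b - bad) <= _).
  apply: le_trans (_ : th1 * th2 / 2 * (th3 * N ^+ 2 / 2) <= _).
    by rewrite le_eqVlt; apply/orP; left; apply/eqP; move: (N ^+ 2) => x; field.
  apply: ler_wpM2l; first by rewrite !mulr_ge0 ?invr_ge0 ?ler0n // ltW.
  by move: (fans a b) bad ge lt3 {bad0 c0 lt2} => x y; lra.
rewrite mulrBr /fans /bad -!sumsZ.
rewrite -[X in _ - X]mul1r -mulNr -sumsZ -sumsD; apply: le_sums => L _.
have p0 := paths_ge0 R F a fan3 L b; have d0 := dumbbell_ge0 (v :: V) L.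
case: ltP => [_|ge2]; first by rewrite mulr1 mulN1r subrr mulr_ge0.
by rewrite !mulr0 addr0 mulrC ler_wpM2l.
Qed.

(** The loss [th3] comes from spokes with few fans, [be1] from unpopular links of Q and [be2] from
    unpopular six-links of P; the factors [2 / th3] and [2 / th1] are the prices of [detour_popular]
    and [dumbbell_popular]. *)
Lemma fold_total :
  \sum_s \sum_a \sum_b sums m.+2 (fun V =>
    paths a (zipper s m) V b * (detour a b V < gam)%R%:R)
  <= (th3 + 2 / th3 * (be1 + 2 / th1 * be2)) * N ^+ (m + 4).
Proof.
have tN : 0 < th3 * N ^+ 2 by rewrite mulr_gt0 ?exprn_gt0.
have -> : \sum_s \sum_a \sum_b sums m.+2 (fun V =>
    paths a (zipper s m) V b * (detour a b V < gam)%R%:R) =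
  \sum_a \sum_b \sum_v sums m.+1 (fun V => \sum_h (F a v h)%:R * hubs V b h *
     (detour a b (v :: V) < gam)%R%:R).
  rewrite exchange_big; apply: eq_bigr => a _ /=.
  rewrite exchange_big; apply: eq_bigr => b _ /=.
  under eq_bigr => s _ do rewrite sumsS.
  rewrite exchange_big; apply: eq_bigr => v _ /=.
  rewrite -exchange_sums; apply: eq_sums => V sV.
  by rewrite -mulr_suml -mulr_suml zipperE.
pose B1 := \sum_a \sum_b (fans a b < th3 * N ^+ 2)%R%:R * fans a b.
pose B2 := \sum_a \sum_b \sum_v sums m.+1 (fun V => \sum_h sums 3 (fun L =>
    (F a v h)%:R * paths a fan3 L b *
    (hubs V b h * (dumbbell (v :: V) L < th1 * th2 / 2)%R%:R))).
apply: le_trans (_ : N ^+ m * B1 + 2 / (th3 * N ^+ 2) * B2 <= _).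
  rewrite /B1 /B2 mulr_sumr mulr_sumr -big_split; apply: ler_sum => a _ /=.
  rewrite mulr_sumr mulr_sumr -big_split; apply: ler_sum => b _ /=.
  apply: le_trans (_ : (fans a b < th3 * N ^+ 2)%R%:R *
    (\sum_v sums m.+1 (fun V => \sum_h (F a v h)%:R * hubs V b h)) +
    2 / (th3 * N ^+ 2) * (\sum_v sums m.+1 (fun V => \sum_h sums 3 (fun L =>
      (F a v h)%:R * paths a fan3 L b *
      (hubs V b h * (dumbbell (v :: V) L < th1 * th2 / 2)%R%:R)))) <= _); last first.
    by rewrite lerD2r [leRHS]mulrCA; apply: ler_wpM2l (sum_hubs a b); rewrite ler0n.
  rewrite mulr_sumr mulr_sumr -big_split; apply: ler_sum => v _ /=.
  rewrite -!sumsZ -sumsD; apply: le_sums => V sV.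
  rewrite mulr_sumr mulr_sumr -big_split; apply: ler_sum => h _ /=.
  have Fh0 : 0 <= (F a v h)%:R * hubs V b h by rewrite mulr_ge0 ?ler0n ?hubs_ge0.
  apply: le_trans (ler_wpM2l Fh0 (detour_popular a b v V)) _.
  rewrite mulrDr; apply: lerD; first by rewrite mulrC.
  rewrite mulrCA -[X in _ * X <= _]sumsZ le_eqVlt; apply/orP; left; apply/eqP.
  by congr (_ * _); apply: eq_sums => L _; ring.
have th3N : th3 != 0 by rewrite gt_eqF.
have -> : (th3 + 2 / th3 * (be1 + 2 / th1 * be2)) * N ^+ (m + 4) =
  N ^+ m * (th3 * N ^+ 4) + 2 / (th3 * N ^+ 2) *
     ((be1 + 2 / th1 * be2) * N ^+ (m + 6)).
  rewrite !exprD -[N ^+ 4]/(N ^+ (2 + 2)) -[N ^+ 6]/(N ^+ (2 + (2 + 2))) !exprD.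
  have N2 : N ^+ 2 != 0 by rewrite expf_neq0.
  move: N2 (N ^+ m) (be1 + 2 / th1 * be2) => /=.
  move: (N ^+ 2) => x x0 y z; field.
  by rewrite th3N x0.
apply: lerD; first by apply: ler_wpM2l (fans_few (ltW th3_gt0)); rewrite exprn_ge0 // ltW.
by apply: ler_wpM2l sum_dumbbell_unpopular; rewrite mulr_ge0 ?ler0n // invr_ge0 ltW.
Qed.

End Counting.

(** * Exceptional configurations for merging *)

Section CountingMerge.
Variables (th g eF : R).
Hypotheses (th_gt0 : 0 < th) (g_ge0 : 0 <= g).
Hypothesis fold_bound : \sum_s \sum_a \sum_b sums 5 (fun V =>
    paths a (zipper s 3) V b * (detour a b V < g)%R%:R) <= eF * N ^+ 7.
Local Notation detour2 := (@detour2 R T inv F dumbbell).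

Lemma detour_ge0 a b V : 0 <= detour a b V.
Proof.
rewrite mulr_ge0 ?invr_ge0 ?exprn_ge0 ?ler0n //.
by apply: sums_ge0 => L _; rewrite mulr_ge0 ?paths_ge0 ?dumbbell_ge0.
Qed.

(** A merge is a fold in disguise: once a fan from [a'] to [b] is chosen, the two copies of [s]
    become a zipper whose tip is this fan. Hence the bound for folding is applied with three empty
    letters at the tip. *)
Lemma detour2E a b a' b' u u' : detour2 a b a' b' u u' =
  N ^- 2 * sums 3 (fun L => paths a' fan3 L b *
    detour a b' (u :: rinv L ++ [:: u'])).
Proof.
rewrite detour2_def sums_sums -!sumsZ; apply: eq_sums => L' _.
rewrite detourE mulrCA mulrA -!sumsZ; apply: eq_sums => L _.
have -> : N ^- 4 = N ^- 2 * N ^- 2 by rewrite -invfM -exprD.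
by move: (N ^- 2) => x; ring.
Qed.

Lemma detour2_popular a b a' b' u u' :
  (detour2 a b a' b' u u' < th * g / 2)%R%:R <= (fans a' b < th * N ^+ 2)%R%:R +
    2 / (th * N ^+ 2) * sums 3 (fun L => paths a' fan3 L b *
      (detour a b' (u :: rinv L ++ [:: u']) < g)%R%:R).
Proof.
set bad := sums 3 _.
have N2 : 0 < N ^+ 2 by rewrite exprn_gt0.
have bad0 : 0 <= bad by apply: sums_ge0 => L _; rewrite mulr_ge0 ?paths_ge0 ?ler0n.
have tN : 0 < th * N ^+ 2 by rewrite mulr_gt0.
have c0 : 0 <= 2 / (th * N ^+ 2) * bad.
  by rewrite mulr_ge0 // mulr_ge0 ?ler0n // invr_ge0 ltW.
case: ltP => [lt|_]; last by rewrite addr_ge0 ?ler0n.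
case: ltP => [_|ge]; first by rewrite lerDl.
rewrite add0r leNgt; apply/negP => lt2; move: lt; rewrite ltNge => /negP[].
have lt3 : bad < th * N ^+ 2 / 2.
  move: lt2; rewrite mulrAC ltr_pdivrMr // mul1r => lt2.
  by rewrite ltr_pdivlMr ?ltr0n // mulrC.
rewrite detour2E ler_pdivlMl //.
apply: le_trans (_ : g * (fans a' b - bad) <= _).
  apply: le_trans (_ : g * (th * N ^+ 2 / 2) <= _).
    by rewrite le_eqVlt; apply/orP; left; apply/eqP; move: (N ^+ 2) => x; field.
  apply: ler_wpM2l => //.
  by move: (fans a' b) bad ge lt3 {bad0 c0 lt2} => x y; lra.
rewrite mulrBr /fans /bad -!sumsZ.
rewrite -[X in _ - X]mul1r -mulNr -sumsZ -sumsD; apply: le_sums => L _.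
have p0 := paths_ge0 R F a' fan3 L b.
have d0 := detour_ge0 a b' (u :: rinv L ++ [:: u']).
case: ltP => [_|ge2]; first by rewrite mulr1 mulN1r subrr mulr_ge0.
by rewrite !mulr0 addr0 mulrC ler_wpM2l.
Qed.

(** The two half-annuli at the edge [s] already contain three faces from [a'] to [b], one of the
    inner spokes being [s] itself up to inversion. So spokes with few fans are rare here too. *)
Lemma sum_two_edges a' b :
  \sum_s (\sum_h (F s b h)%:R) * (\sum_b' \sum_u (step F a' (Some (inv s)) u b')%:R)
  = fans a' b.
Proof.
rewrite -(sum_inv invK) /fans sumsS.
transitivity (\sum_u \sum_b' \sum_h \sum_k \sum_s
  (F a' u k)%:R * (F k (inv b') s)%:R * (F s h b)%:R : R); last first.
  apply: eq_bigr => u _; rewrite sumsS -[RHS](sum_inv invK).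
  apply: eq_bigr => b' _; rewrite sums1; apply: eq_bigr => h _.
  by rewrite paths3E.
under [RHS]eq_bigr => u _ do under eq_bigr => b' _ do under eq_bigr => h _ do
  rewrite exchange_big /=.
under [RHS]eq_bigr => u _ do under eq_bigr => b' _ do rewrite exchange_big /=.
under [RHS]eq_bigr => u _ do rewrite exchange_big /=.
rewrite [RHS]exchange_big /=; apply: eq_bigr => s _.
rewrite mulr_sumr [RHS]exchange_big /=; apply: eq_bigr => b' _.
rewrite mulr_sumr; apply: eq_bigr => u _.
rewrite stepE invK mulr_suml; apply: eq_bigr => h _.
rewrite mulr_sumr; apply: eq_bigr => k _.
by rewrite F_flipE F_swapE mulrC.
Qed.

Lemma sum_step_merge :
  \sum_s \sum_a \sum_b \sum_a' \sum_b' \sum_u \sum_u'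
    (step F a (Some s) u b)%:R * (step F a' (Some (inv s)) u' b')%:R *
    (fans a' b < th * N ^+ 2)%R%:R <= N * (th * N ^+ 4).
Proof.
apply: le_trans (_ : N * \sum_b \sum_a' (fans a' b < th * N ^+ 2)%R%:R *
   fans a' b <= _); last first.
  by rewrite exchange_big; apply: ler_wpM2l (fans_few (ltW th_gt0)); rewrite ler0n.
rewrite mulr_sumr.
under eq_bigr => s _ do rewrite exchange_big /=.
rewrite exchange_big; apply: ler_sum => b _ /=.
rewrite mulr_sumr.
under eq_bigr => s _ do rewrite exchange_big /=.
rewrite exchange_big; apply: ler_sum => a' _ /=.
rewrite [leRHS]mulrCA -[X in _ <= _ * (_ * X)]sum_two_edges !mulr_sumr; apply: ler_sum => s _.
set i := (fans a' b < th * N ^+ 2)%R%:R.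
set X := \sum_b' \sum_u (step F a' (Some (inv s)) u b')%:R.
apply: le_trans (_ : i * ((\sum_a \sum_u (step F a (Some s) u b)%:R) * X) <= _).
  rewrite mulr_suml mulr_sumr; apply: ler_sum => a _.
  rewrite exchange_big mulr_suml mulr_sumr; apply: ler_sum => u _ /=.
  rewrite /X !mulr_sumr; apply: ler_sum => b' _.
  rewrite !mulr_sumr; apply: ler_sum => u' _.
  by rewrite [leLHS]mulrC.
apply: ler_wpM2l; first by rewrite ler0n.
rewrite mulrA; apply: ler_wpM2r.
  by apply: sumr_ge0 => b' _; apply: sumr_ge0 => u' _.
under eq_bigr => a _ do under eq_bigr => u _ do rewrite stepE.
under eq_bigr => a _ do rewrite exchange_big /=.
rewrite exchange_big mulr_sumr; apply: ler_sum => h _ /=.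
under eq_bigr => a _ do rewrite -mulr_suml.
by rewrite -mulr_suml; apply: ler_wpM2r (sum_F12 h).
Qed.

Lemma sum_detour_merge :
  \sum_s \sum_a \sum_b \sum_a' \sum_b' \sum_u \sum_u'
    (step F a (Some s) u b)%:R * (step F a' (Some (inv s)) u' b')%:R *
    sums 3 (fun L => paths a' fan3 L b *
      (detour a b' (u :: rinv L ++ [:: u']) < g)%R%:R) <= eF * N ^+ 7.
Proof.
apply: le_trans fold_bound; rewrite le_eqVlt; apply/orP; left; apply/eqP.
apply: eq_bigr => s _; apply: eq_bigr => a _.
transitivity (\sum_b' \sum_u sums 3 (fun L => \sum_u' \sum_b \sum_a'
  (step F a (Some s) u b)%:R * (paths a' fan3 L b *
   (step F a' (Some (inv s)) u' b')%:R) *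
   (detour a b' (u :: rinv L ++ [:: u']) < g)%R%:R)).
  under eq_bigr => b _ do rewrite exchange_big /=.
  rewrite exchange_big; apply: eq_bigr => b' _ /=.
  under eq_bigr => b _ do rewrite exchange_big /=.
  rewrite exchange_big; apply: eq_bigr => u _ /=.
  under [RHS]eq_sums => L _ do rewrite exchange_big /=.
  rewrite exchange_sums; apply: eq_bigr => b _ /=.
  under [RHS]eq_sums => L _ do rewrite exchange_big /=.
  rewrite exchange_sums; apply: eq_bigr => a' _ /=.
  rewrite exchange_sums; apply: eq_bigr => u' _ /=.
  by rewrite -sumsZ; apply: eq_sums => L _; ring.
apply: eq_bigr => b' _; rewrite (sumsS 4); apply: eq_bigr => u _.
rewrite (sums_cat 3 1) -[RHS](sums_rinv 3); apply: eq_sums => L sL.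
rewrite sums1; apply: eq_bigr => u' _; rewrite /zipper paths_cons.
rewrite mulr_suml; apply: eq_bigr => b _.
rewrite (@paths_cat R T F b (nseq 3 None)) ?size_rinv ?sL //.
rewrite -mulrA mulr_suml mulr_sumr; apply: eq_bigr => a' _.
by rewrite paths1 -(paths_rev _ _ sL) !mulrA.
Qed.

Lemma merge_total :
  \sum_s \sum_a \sum_b \sum_a' \sum_b' \sum_u \sum_u'
    (step F a (Some s) u b)%:R * (step F a' (Some (inv s)) u' b')%:R *
    (detour2 a b a' b' u u' < th * g / 2)%R%:R <= (th + 2 / th * eF) * N ^+ 5.
Proof.
have tN : 0 < th * N ^+ 2 by rewrite mulr_gt0 ?exprn_gt0.
have -> : (th + 2 / th * eF) * N ^+ 5 =
    N * (th * N ^+ 4) + 2 / (th * N ^+ 2) * (eF * N ^+ 7).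
  rewrite -[N ^+ 7]/(N ^+ (2 + 5)) exprD -[N ^+ 5]/(N ^+ (1 + 4)) exprD expr1.
  move: (gt_eqF th_gt0) (gt_eqF (exprn_gt0 2 N_gt0)).
  move: (#|T|%:R : R) (N ^+ 4) (N ^+ 2) => z y x th0 x0; field.
  by rewrite th0 x0.
have c0 : 0 <= 2 / (th * N ^+ 2) by rewrite mulr_ge0 ?ler0n // invr_ge0 ltW.
apply: le_trans (lerD sum_step_merge (ler_wpM2l c0 sum_detour_merge)).
rewrite mulr_sumr -big_split; apply: ler_sum => s _ /=.
rewrite mulr_sumr -big_split; apply: ler_sum => a _ /=.
rewrite mulr_sumr -big_split; apply: ler_sum => b _ /=.
rewrite mulr_sumr -big_split; apply: ler_sum => a' _ /=.
rewrite mulr_sumr -big_split; apply: ler_sum => b' _ /=.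
rewrite mulr_sumr -big_split; apply: ler_sum => u _ /=.
rewrite mulr_sumr -big_split; apply: ler_sum => u' _ /=.
rewrite [X in _ + X]mulrCA -mulrDr; apply: ler_wpM2l.
  by rewrite mulr_ge0 ?ler0n.
exact: detour2_popular.
Qed.

End CountingMerge.

End Dumbbell.

(** * Dependent random choice *)

Section Walks.
Variables (R : realFieldType) (T : finType).
Implicit Types (F : T -> T -> T -> bool) (a b g h u : T) (V gs : seq T).

Fixpoint walk F a V gs : bool :=
  match V, gs with
  | [::], [::] => true
  | u :: V', g :: gs' => F a u g && walk F g V' gs'
  | _, _ => false
  end.

Lemma natrA (b1 b2 : bool) : (b1 && b2)%:R = b1%:R * b2%:R :> R.
Proof. by case: b1; rewrite ?mul1r ?mul0r. Qed.

Lemma paths_walk F a V b : paths R F a (nseq (size V) None) V b =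
  sums (size V) (fun gs => (walk F a V gs && (last a gs == b))%:R).
Proof.
elim: V a => [|u V IH] a; first by [].
rewrite sumsS paths_cons; apply: eq_bigr => g _.
rewrite IH -sumsZ; apply: eq_sums => gs _.
by rewrite -natrA /= andbA.
Qed.

Lemma ptrace_walk F V : ptrace R F (nseq (size V) None) V =
  \sum_a sums (size V) (fun gs => (walk F a V gs && (last a gs == a))%:R).
Proof. by apply: eq_bigr => a _; apply: paths_walk. Qed.

Lemma sums_single k (f : seq T -> R) s : size s = k ->
  (forall s, 0 <= f s) -> f s <= sums k f.
Proof.
elim: k f s => [|k IH] f [|x s] // [sk] f0.
rewrite sumsS; apply: le_trans (IH (fun s => f (x :: s)) s sk (fun s => f0 _)) _.
apply: (ler_sum1 x (f := fun x => sums k (fun s => f (x :: s)))) => y.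
by apply: sums_ge0.
Qed.

End Walks.

(** * Random shifts and the faces that survive them *)

Section Moves.
Variables (R : realFieldType) (T : finType) (inv : T -> T).
Variable F : T -> T -> T -> bool.
Variables (cl : T -> 'I_3) (sg : T -> bool).
Hypothesis invK : involutive inv.
Hypothesis F_swap : forall g u h, F g u h -> F h (inv u) g.
Hypothesis F_flip : forall g u h, F g u h -> F (inv g) h u.
Hypothesis Fdet1 : forall a a' u h, F a u h -> F a' u h -> a = a'.
Hypothesis Fdet2 : forall a u u' h, F a u h -> F a u' h -> u = u'.
Hypothesis Fdet3 : forall a u h h', F a u h -> F a u h' -> h = h'.
Hypothesis F_sg : forall g u h, F g u h -> sg g != sg h.
Hypothesis F_cl : forall g u h, F g u h -> cl g = cl h.
Hypothesis F_corners : forall g u h, F g u h ->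
  [/\ cl g != cl (inv g), cl g != cl (inv h) & cl (inv g) != cl (inv h)].
Local Notation N := (#|T|%:R : R).
Implicit Types (a b g h u : T) (V gs : seq T) (t : T * T * T).

(* For a shift [t = (g0, h0, k0)] of the hub [P], with spokes [g0], [h0], to the
   hub [P'] with spokes [k0], [l0]: the spoke [g] of [P] is moved to [g']. *)
Definition moved t g g' := [exists u0, exists l0,
  [&& F t.1.1 u0 t.1.2, F t.2 u0 l0 &
   [exists v, F t.1.2 v g && F l0 v g'] || [exists v, F t.1.1 v g && F t.2 v g']]].

Definition movable t g h := [exists u, exists g', exists h',
  [&& F g u h, F g' u h', moved t g g' & moved t h h']].

Lemma movedP t g g' : reflect (exists u0 l0, [/\ F t.1.1 u0 t.1.2, F t.2 u0 l0 &
   (sg g == sg t.1.1 /\ exists2 v, F t.1.2 v g & F l0 v g') \/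
   (sg g != sg t.1.1 /\ exists2 v, F t.1.1 v g & F t.2 v g')]) (moved t g g').
Proof.
apply: (iffP existsP) => [[u0 /existsP[l0 /and3P[F0 F1 /orP[]]]]|].
- move=> /existsP[v /andP[F2 F3]]; exists u0, l0; split=> //; left.
  split; last by exists v.
  by move: (F_sg F0) (F_sg F2); case: (sg g); case: (sg t.1.1); case: (sg t.1.2).
- move=> /existsP[v /andP[F2 F3]]; exists u0, l0; split=> //; right.
  by split; [rewrite eq_sym (F_sg F2) | exists v].
move=> [u0 [l0 [F0 F1 e]]]; exists u0; apply/existsP; exists l0.
rewrite F0 F1 /=; apply/orP.
case: e => -[_ [v F2 F3]]; [left | right]; apply/existsP; exists v;
  by rewrite F2 F3.
Qed.

Lemma moved_fun t g g' g'' : moved t g g' -> moved t g g'' -> g' = g''.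
Proof.
move=> /movedP[u0 [l0 [F0 F1 e]]] /movedP[u1 [l1 [F2 F3 e']]].
have eu := Fdet2 F0 F2; rewrite -{}eu {F2} in F3; have el := Fdet3 F1 F3.
rewrite -{}el {F3} in e'.
case: e e' => -[s1 [v F2 F3]] [[s2 [w F4 F5]]|[s2 [w F4 F5]]].
- by move: (Fdet2 F2 F4) F5 => <-; apply: Fdet3.
- by rewrite s1 in s2.
- by rewrite s2 in s1.
- by move: (Fdet2 F2 F4) F5 => <-; apply: Fdet3.
Qed.

(** A spoke of the sign opposite to [g0] is moved across a face at [g0] itself, and its image then
    pins down [k]. Signs alternate around a hub, so one of any two consecutive spokes qualifies. *)
Lemma moved_back g0 h0 k k' g g' : sg g != sg g0 ->
  moved (g0, h0, k) g g' -> moved (g0, h0, k') g g' -> k = k'.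
Proof.
move=> ns /movedP[u0 [l0 [F0 F1 [[/eqP /= s _]|[_ [v F2 F3]]]]]].
  by rewrite s eqxx in ns.
move=> /movedP[u1 [l1 [F4 F5 [[/eqP /= s _]|[_ [w F6 F7]]]]]].
  by rewrite s eqxx in ns.
by move: (Fdet2 F2 F6) F7 => <-; apply: Fdet1.
Qed.

Lemma movable_sym t g h : movable t g h = movable t h g.
Proof.
suff imp a b : movable t a b -> movable t b a by apply/idP/idP; apply: imp.
move=> /existsP[u /existsP[g' /existsP[h' /and4P[F1 F2 m1 m2]]]].
apply/existsP; exists (inv u); apply/existsP; exists h'; apply/existsP; exists g'.
by rewrite m1 m2 !F_swap.
Qed.

Definition move t g := if [pick g' | moved t g g'] is Some g' then g' else g.

Lemma moveP t g g' : moved t g g' -> move t g = g'.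
Proof.
rewrite /move => m; case: pickP => [x mx|/(_ g')]; last by rewrite m.
exact: moved_fun mx m.
Qed.

Lemma movable_face t g u h : F g u h -> movable t g h ->
  [/\ moved t g (move t g), moved t h (move t h) & F (move t g) u (move t h)].
Proof.
move=> F0 /existsP[u' /existsP[g' /existsP[h' /and4P[F1 F2 m1 m2]]]].
by rewrite (moveP m1) (moveP m2) (Fdet2 F0 F1).
Qed.

Lemma walk_move t a V gs : walk F a V gs -> path (movable t) a gs ->
  walk F (move t a) V (map (move t) gs).
Proof.
elim: V a gs => [|u V IH] a [|g gs] //= /andP[F0 w] /andP[m p].
by have [_ _ ->] := movable_face F0 m; apply: IH.
Qed.

(** A shift that moves every face of a star carries it to another star with the same link. Given
    [g0] and [h0], the new star determines [k0], so links with few hubs admit few shifts. *)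
Lemma sum_movable_star a V gs : walk F a V gs -> last a gs = a -> (1 < size V)%N ->
  \sum_t (path (movable t) a gs)%:R <= N ^+ 2 * ptrace R F (nseq (size V) None) V.
Proof.
move=> w la; case: V gs w la => [|u1 [|u2 V]] [|g1 [|g2 gs]] //; first by rewrite /= andbF.
set V1 := [:: u1, u2 & V]; set gs1 := [:: g1, g2 & gs] => w la _.
have F1 : F a u1 g1 by case/andP: w.
pose rel (t : T * T * T) a' gs' := moved t a a' && moved t g1 (head a gs').
pose st a' gs' := (walk F a' V1 gs' && (last a' gs' == a')).
apply: le_trans (_ : \sum_t \sum_a' sums (size V1) (fun gs' =>
    (st a' gs')%:R * (rel t a' gs')%:R) <= _).
  apply: ler_sum => t _; case: (boolP (path _ _ _)) => [p|_]; last first.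
    by apply: sumr_ge0 => a' _; apply: sums_ge0 => gs' _; rewrite mulr_ge0 ?ler0n.
  apply: le_trans (_ : sums (size V1) (fun gs' => (st (move t a) gs')%:R *
      (rel t (move t a) gs')%:R) <= _); last first.
    apply: (ler_sum1 (move t a) (f := fun a' => sums (size V1) (fun gs' =>
       (st a' gs')%:R * (rel t a' gs')%:R))) => a'.
    by apply: sums_ge0 => gs' _; rewrite mulr_ge0 ?ler0n.
  have szw : size (map (move t) gs1) = size V1.
    have sz X Y b : walk F b X Y -> size Y = size X.
      by elim: X Y b => [|x X IH] [|y Y] b //= /andP[_ /IH ->].
    by rewrite size_map (sz _ _ _ w).
  apply: le_trans (sums_single (f := fun gs' => (st (move t a) gs')%:R *
      (rel t (move t a) gs')%:R) szw _); last first.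
    by move=> gs'; rewrite mulr_ge0 ?ler0n.
  have [m1 m2 _] := movable_face F1 (proj1 (andP p)).
  by rewrite /st /rel walk_move // last_map la eqxx [head _ _]/= m1 m2 mulr1.
rewrite (ptrace_walk R F V1) exchange_big mulr_sumr; apply: ler_sum => a' _.
rewrite -exchange_sums -sumsZ; apply: le_sums => gs' _.
rewrite -mulr_sumr mulrC; apply: ler_wpM2r; first by rewrite ler0n.
have -> : \sum_t (rel t a' gs')%:R =
    \sum_g0 \sum_h0 \sum_k0 (rel (g0, h0, k0) a' gs')%:R :> R.
  by rewrite pair_bigA pair_bigA; apply: eq_bigr => -[[? ?] ?].
apply: le_trans (_ : \sum_(g0 : T) \sum_(h0 : T) 1 <= _); last first.
  by rewrite !sumr_const expr2 mulr_natl.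
apply: ler_sum => g0 _; apply: ler_sum => h0 _.
apply: sum_uniq_le1 => k k' /andP[m1 m2] /andP[m1' m2'].
case: (boolP (sg a == sg g0)) => [/eqP e|ne]; last exact: moved_back ne m1 m1'.
by apply: (moved_back _ m2 m2'); rewrite -e eq_sym (F_sg F1).
Qed.

Variable K : nat.
Local Notation shifts := {ffun 'I_3 * 'I_K -> T * T * T}.

(** Each of the three classes of vertices has its own [K] shifts. The corners of a face have
    different classes, so their survival is independent. *)
Definition stable (tau : shifts) g h :=
  [forall i, movable (tau (cl g, i)) g h].

Definition subface (tau : shifts) g u h :=
  [&& F g u h, stable tau g h, stable tau (inv g) u & stable tau (inv h) (inv u)].

Lemma stable_sym tau g h : cl g = cl h -> stable tau g h = stable tau h g.
Proof. by move=> e; apply: eq_forallb => i; rewrite movable_sym e. Qed.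

Lemma subface_F tau g u h : subface tau g u h -> F g u h.
Proof. by case/and4P. Qed.

Lemma subface_swap tau g u h : subface tau g u h -> subface tau h (inv u) g.
Proof.
case/and4P=> F0 s1 s2 s3; rewrite /subface F_swap // invK s2 s3 /= andbT.
by rewrite stable_sym // (F_cl F0).
Qed.

Lemma subface_flip tau g u h : subface tau g u h -> subface tau (inv g) h u.
Proof.
case/and4P=> F0 s1 s2 s3; rewrite /subface F_flip // invK s1 s2 /=.
by rewrite stable_sym // -(F_cl (F_flip (F_swap F0))).
Qed.

Lemma sum_shifts (f : 'I_3 -> T * T * T -> R) :
  \sum_(tau : shifts) \prod_x f x.1 (tau x) = \prod_j (\sum_t f j t) ^+ K.
Proof.
rewrite -(bigA_distr_bigA (fun (x : 'I_3 * 'I_K) t => f x.1 t)).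
rewrite -(pair_bigA _ (fun j (i : 'I_K) => \sum_t f j t)) /=.
by apply: eq_bigr => j _; rewrite prodr_const card_ord.
Qed.

Lemma prod_natr (I : finType) (P : pred I) :
  \prod_i (P i)%:R = [forall i, P i]%:R :> R.
Proof.
case: (boolP [forall i, P i]) => [/forallP all|/forallPn[i /negPf ni]].
  by rewrite big1 // => i _; rewrite all.
by rewrite (bigD1 i) //= ni mul0r.
Qed.

Lemma sum_subface q g u h : 0 <= q -> F g u h ->
  q * N ^+ 3 <= \sum_t (movable t g h)%:R ->
  q * N ^+ 3 <= \sum_t (movable t (inv g) u)%:R ->
  q * N ^+ 3 <= \sum_t (movable t (inv h) (inv u))%:R ->
  q ^+ (3 * K) * N ^+ (9 * K) <= \sum_tau (subface tau g u h)%:R.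
Proof.
move=> q0 F0 q1 q2 q3; have [n1 n2 n3] := F_corners F0.
pose f (j : 'I_3) t : bool := if j == cl g then movable t g h else
  if j == cl (inv g) then movable t (inv g) u else movable t (inv h) (inv u).
have -> : \sum_tau (subface tau g u h)%:R =
    \sum_(tau : shifts) \prod_x (f x.1 (tau x))%:R :> R.
  apply: eq_bigr => tau _; rewrite prod_natr /subface F0 /=; congr (nat_of_bool _)%:R.
  apply/idP/forallP => [/and3P[/forallP s1 /forallP s2 /forallP s3] [j i]|al].
    rewrite /f /=; case: eqP => [->//|/eqP j1]; case: eqP => [->//|/eqP j2].
    suff -> : j = cl (inv h) by [].
    apply/eqP; move: n1 n2 n3 j1 j2; rewrite -!val_eqE /=.
    by move: (cl g) (cl (inv g)) (cl (inv h)) j => [? ?] [? ?] [? ?] [? ?] /=; lia.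
  apply/and3P; split; apply/forallP => i.
  - by have := al (cl g, i); rewrite /f eqxx.
  - by have := al (cl (inv g), i); rewrite /f /= eq_sym (negPf n1) eqxx.
  - have := al (cl (inv h), i).
    by rewrite /f /= eq_sym (negPf n2) eq_sym (negPf n3).
rewrite (sum_shifts (fun j t => (f j t)%:R)).
have -> : q ^+ (3 * K) * N ^+ (9 * K) = \prod_(j : 'I_3) (q * N ^+ 3) ^+ K.
  by rewrite prodr_const card_ord exprMn exprMn -!exprM (mulnC K 3%N) mulnA.
apply: ler_prod => j _; rewrite exprn_ge0 ?mulr_ge0 ?exprn_ge0 ?ler0n //=.
rewrite lerXn2r ?nnegrE ?mulr_ge0 ?exprn_ge0 ?ler0n ?sumr_ge0 //.
rewrite /f; case: eqP => _; first exact: q1.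
by case: eqP => _; [exact: q2 | exact: q3].
Qed.

Lemma walk_subface_path tau a V gs : walk (subface tau) a V gs ->
  walk F a V gs /\ forall i, path (movable (tau (cl a, i))) a gs.
Proof.
elim: V a gs => [|u V IH] a [|g gs] //= /andP[sf /IH[w p]].
rewrite (subface_F sf) w; split=> // i.
case/and4P: sf => F0 /forallP/(_ i) -> _ _ /=.
by rewrite (F_cl F0) p.
Qed.

(** Only the shifts of the class of the hub matter. All [K] of them must move the whole star, which
    at most [gam * N ^ 3] triples do; the shifts of the other classes are free. *)
Lemma sum_subface_star gam a V gs : 0 <= gam -> walk F a V gs -> last a gs = a ->
  (1 < size V)%N -> ptrace R F (nseq (size V) None) V <= gam * N ->
  \sum_(tau : shifts) (walk (subface tau) a V gs)%:R <= gam ^+ K * N ^+ (9 * K).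
Proof.
move=> gam0 w la sV cV.
pose f (j : 'I_3) t : bool := (j == cl a) ==> path (movable t) a gs.
apply: le_trans (_ : \sum_(tau : shifts) \prod_x (f x.1 (tau x))%:R <= _).
  apply: ler_sum => tau _; rewrite prod_natr ler_nat.
  case: (boolP (walk _ _ _ _)) => [/walk_subface_path[_ p]|//].
  suff -> : [forall x, f x.1 (tau x)] by [].
  apply/forallP => -[j i]; apply/implyP => /eqP /= ->; exact: p.
rewrite (sum_shifts (fun j t => (f j t)%:R)) (bigD1 (cl a)) //=.
have -> : gam ^+ K * N ^+ (9 * K) = (gam * N ^+ 3) ^+ K *
    \prod_(j : 'I_3 | j != cl a) (N ^+ 3) ^+ K.
  rewrite prodr_const exprMn -mulrA; congr (_ * _).
  have -> : #|[pred j : 'I_3 | j != cl a]| = 2%N.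
    by have := cardC1 (cl a); rewrite card_ord.
  by rewrite -!exprM -exprD; congr (_ ^+ _); lia.
have T3 : \sum_(t : T * T * T) 1 = N ^+ 3 :> R.
  by rewrite sumr_const !card_prod !natrM !exprS expr0 mulr1 mulrA.
apply: ler_pM.
- by rewrite exprn_ge0 // sumr_ge0.
- by rewrite prodr_ge0 // => j _; rewrite exprn_ge0 // sumr_ge0.
- rewrite lerXn2r ?nnegrE ?sumr_ge0 ?mulr_ge0 ?exprn_ge0 ?ler0n //.
  rewrite /f eqxx /=; apply: le_trans (sum_movable_star w la sV) _.
  rewrite (exprSr N 2) mulrCA; apply: ler_wpM2l; first by rewrite exprn_ge0 ?ler0n.
  by [].
apply: ler_prod => j nj; rewrite exprn_ge0 ?sumr_ge0 //= -T3.
by rewrite lerXn2r ?nnegrE ?sumr_ge0 // ler_sum // => t _; rewrite lern1 leq_b1.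
Qed.

Hypothesis N_gt0 : 0 < N.

Lemma sum_natr_subface (P : T -> T -> T -> bool) :
  (forall g u h, P g u h -> F g u h) -> \sum_g \sum_u \sum_h (P g u h)%:R <= N ^+ 2.
Proof.
move=> PF; apply: le_trans (_ : \sum_(g : T) \sum_(u : T) 1 <= _); last first.
  by rewrite !sumr_const expr2 mulr_natl.
apply: ler_sum => g _; apply: ler_sum => u _.
by apply: sum_uniq_le1 => h h' /PF F1 /PF; apply: Fdet3 F1.
Qed.

Lemma sums_ptrace d : (0 < d)%N ->
  sums d (fun V => ptrace R F (nseq d None) V) <= N ^+ d.
Proof.
case: d => [//|d] _; rewrite exchange_sums.
apply: le_trans (_ : \sum_(a : T) N ^+ d <= _); last first.
  by rewrite sumr_const exprS mulr_natl.
apply: ler_sum => a _.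
exact: (@sums_paths R T F Fdet2 Fdet3 d a (nseq d.+1 None) a (size_nseq _ _)).
Qed.

Definition unpopular gam tau d := sums d (fun V =>
  ptrace R (subface tau) (nseq d None) V *
  (ptrace R F (nseq d None) V < gam * N)%R%:R).

Lemma unpopular_ge0 gam tau d : 0 <= unpopular gam tau d.
Proof. by apply: sums_ge0 => V _; rewrite mulr_ge0 ?ptrace_ge0 ?ler0n. Qed.

Lemma sum_unpopular gam d : 0 <= gam -> (1 < d)%N ->
  \sum_tau unpopular gam tau d <= gam ^+ K * N ^+ (9 * K) * N ^+ d.
Proof.
move=> gam0 d1; have g0 : 0 <= gam ^+ K * N ^+ (9 * K).
  by rewrite mulr_ge0 ?exprn_ge0 ?ler0n.
apply: le_trans (ler_wpM2l g0 (sums_ptrace (ltnW d1))).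
rewrite -exchange_sums -sumsZ; apply: le_sums => V sV.
rewrite -{d}sV in d1 *; case: ltP => [lt|_]; last first.
  under eq_bigr => tau _ do rewrite mulr0.
  by rewrite big1 // mulr_ge0 // ptrace_ge0.
under eq_bigr => tau _ do rewrite mulr1 ptrace_walk.
rewrite ptrace_walk exchange_big mulr_sumr; apply: ler_sum => a _ /=.
rewrite -exchange_sums -sumsZ; apply: le_sums => gs _.
case: (boolP (walk F a V gs && (last a gs == a))) => [/andP[w /eqP la]|no].
  rewrite mulr1; apply: le_trans (sum_subface_star gam0 w la d1 (ltW lt)).
  by apply: ler_sum => tau _; rewrite ler_nat la eqxx andbT.
rewrite mulr0 big1 // => tau _; case: (boolP (walk _ _ _ _)) => // /walk_subface_path[w _].
by rewrite w /= in no; rewrite (negPf no).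
Qed.

Lemma exists_ge_mean (I : finType) (c : R) (G : I -> R) (i0 : I) :
  \sum_(i : I) c <= \sum_i G i -> exists i, c <= G i.
Proof.
move=> le; case: (boolP [exists i, c <= G i]) => [/existsP //|/existsPn no].
move: le; rewrite leNgt => /negP[].
rewrite [ltLHS](bigD1 i0) //= [ltRHS](bigD1 i0) //=.
by apply: ltr_leD => [|]; [rewrite ltNge no | apply: ler_sum => i _; apply: ltW; rewrite ltNge no].
Qed.

(* Dependent random choice: random shifts preserve the faces with many moves
   and destroy the stars whose link has few other hubs. *)
Lemma exists_subface D q rho gam : 0 < q -> 0 < rho -> 0 < gam -> (0 < D)%N ->
  rho * N ^+ 2 <= \sum_g \sum_u \sum_h [&& F g u h,
    q * N ^+ 3 <= \sum_t (movable t g h)%:R,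
    q * N ^+ 3 <= \sum_t (movable t (inv g) u)%:R &
    q * N ^+ 3 <= \sum_t (movable t (inv h) (inv u))%:R]%R%:R ->
  exists tau, rho * q ^+ (3 * K) / 2 * N ^+ 2 <=
      \sum_g \sum_u \sum_h (subface tau g u h)%:R /\
    forall d, (1 < d < D)%N ->
      unpopular gam tau d <= 2 * D%:R * gam ^+ K / (rho * q ^+ (3 * K)) * N ^+ d.
Proof.
move=> q0 rho0 gam0 D0 many.
pose c := rho * q ^+ (3 * K).
have c0 : 0 < c by rewrite mulr_gt0 ?exprn_gt0.
(* With this weight the expected penalty for unpopular stars is at most half the expected number of
   surviving faces. Some [tau] therefore keeps half the faces after the penalty, which bounds every
   single [unpopular] term. *)
pose kap := c / (2 * D%:R * gam ^+ K).
have kap0 : 0 < kap by rewrite divr_gt0 // !mulr_gt0 ?ltr0n ?exprn_gt0.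
pose S tau : R := \sum_g \sum_u \sum_h (subface tau g u h)%:R.
pose G tau := S tau - kap * \sum_(d < D | (1 < d)%N)
  N ^+ 2 * N ^- d * unpopular gam tau d.
have cardS : \sum_(tau : shifts) 1 = N ^+ (9 * K) :> R.
  rewrite sumr_const card_ffun !card_prod !card_ord !natrX !natrM.
  rewrite -mulrA -expr2 -exprS -exprM; congr (_ ^+ _).
  by rewrite mulnA.
have [g0 _] : exists g : T, True.
  move: N_gt0; rewrite ltr0n => /card_gt0P[g _]; by exists g.
have NK : 0 < N ^+ (9 * K) by rewrite exprn_gt0.
have SS : c * N ^+ 2 * N ^+ (9 * K) <= \sum_tau S tau.
  have -> : c * N ^+ 2 * N ^+ (9 * K) = q ^+ (3 * K) * N ^+ (9 * K) * (rho * N ^+ 2).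
    by rewrite /c; move: (q ^+ _) (N ^+ 2) (N ^+ (9 * K)) => x y z; ring.
  apply: le_trans (ler_wpM2l _ many) _.
    by rewrite mulr_ge0 ?exprn_ge0 ?ler0n // ltW.
  rewrite /S [leRHS]exchange_big /= mulr_sumr; apply: ler_sum => g _.
  rewrite [leRHS]exchange_big /= mulr_sumr; apply: ler_sum => u _.
  rewrite [leRHS]exchange_big /= mulr_sumr; apply: ler_sum => h _.
  case: (boolP [&& _, _, _ & _]) => [/and4P[F0 q1 q2 q3]|_]; last first.
    by rewrite mulr0 sumr_ge0 // => tau _; rewrite ler0n.
  by rewrite mulr1; apply: sum_subface q1 q2 q3; rewrite ?ltW.
have SU : \sum_tau (kap * \sum_(d < D | (1 < d)%N) N ^+ 2 * N ^- d * unpopular gam tau d)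
    <= c / 2 * N ^+ 2 * N ^+ (9 * K).
  rewrite -mulr_sumr exchange_big /=.
  apply: le_trans (_ : kap * \sum_(d < D) N ^+ 2 * (gam ^+ K * N ^+ (9 * K)) <= _).
    apply: ler_wpM2l; first exact: ltW.
    rewrite big_mkcond; apply: ler_sum => d _; case: ifP => d1; last first.
      by rewrite !mulr_ge0 ?exprn_ge0 ?ler0n // ltW.
    rewrite -mulr_sumr -mulrA; apply: ler_wpM2l; first by rewrite exprn_ge0 ?ler0n.
    rewrite ler_pdivrMl ?exprn_gt0 // mulrC; apply: sum_unpopular => //; exact: ltW.
  rewrite sumr_const card_ord -[X in kap * X]mulr_natl le_eqVlt; apply/orP; left; apply/eqP.
  have gK : gam ^+ K != 0 by rewrite gt_eqF ?exprn_gt0.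
  have Dn : D%:R != 0 :> R by rewrite pnatr_eq0 -lt0n.
  rewrite /kap; move: (gam ^+ K) (N ^+ 2) (N ^+ (9 * K)) (D%:R : R) gK Dn => x y z w x0 w0.
  by field; rewrite x0 w0.
have [tau le] : exists tau, c / 2 * N ^+ 2 <= G tau.
  apply: (exists_ge_mean [ffun=> (g0, g0, g0)]).
  have -> : \sum_(tau : shifts) (c / 2 * N ^+ 2) = c / 2 * N ^+ 2 * N ^+ (9 * K).
    by rewrite -cardS mulr_sumr; apply: eq_bigr => tau _; rewrite mulr1.
  rewrite sumrB; apply: le_trans (lerB SS SU); rewrite le_eqVlt; apply/orP; left; apply/eqP.
  by move: (N ^+ 2) (N ^+ (9 * K)) => x y; field.
have un0 : 0 <= kap * \sum_(d < D | (1 < d)%N) N ^+ 2 * N ^- d * unpopular gam tau d.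
  apply: mulr_ge0; [exact: ltW | apply: sumr_ge0 => d _].
  by rewrite !mulr_ge0 ?unpopular_ge0 ?invr_ge0 ?exprn_ge0 ?ler0n.
exists tau; split.
  by apply: le_trans le _; rewrite /G lerBlDr lerDl.
move=> d /andP[d1 dD].
have : kap * (N ^+ 2 * N ^- d * unpopular gam tau d) <= N ^+ 2.
  apply: le_trans (_ : kap * \sum_(d < D | (1 < d)%N)
      N ^+ 2 * N ^- d * unpopular gam tau d <= _).
    apply: ler_wpM2l; first exact: ltW.
    rewrite (bigD1 (Ordinal dD)) //= lerDl sumr_ge0 // => i _.
    by rewrite !mulr_ge0 ?unpopular_ge0 ?invr_ge0 ?exprn_ge0 ?ler0n.
  have S2 : S tau <= N ^+ 2 by apply: sum_natr_subface => g u h /subface_F.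
  have : 0 <= c / 2 * N ^+ 2 by rewrite mulr_ge0 ?exprn_ge0 ?ler0n // divr_ge0 ?ltW.
  by move: le S2; rewrite /G; lra.
rewrite -mulrA mulrCA ger_pMr ?exprn_gt0 // /kap -/c => le1.
have -> : 2 * D%:R * gam ^+ K / c = kap^-1 by rewrite /kap invf_div.
by rewrite ler_pdivlMl // -[N ^+ d]mulr1 -ler_pdivrMl ?exprn_gt0 // mulrCA.
Qed.

End Moves.

(** * Octahedra and good faces *)

Section ManySums.
Variables (R : realFieldType) (T : finType).

Lemma sum_triple (G : T * T * T -> R) :
  \sum_x \sum_y \sum_z G (x, y, z) = \sum_t G t.
Proof. by rewrite !pair_bigA; apply: eq_bigr => -[[? ?] ?]. Qed.

End ManySums.

Section StarBound.
Variables (R : realFieldType) (T : finType).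
Variables F F' : T -> T -> T -> bool.
Hypothesis Fdet2 : forall a u u' h, F a u h -> F a u' h -> u = u'.
Hypothesis Fdet3 : forall a u h h', F a u h -> F a u h' -> h = h'.
Local Notation N := (#|T|%:R : R).
Hypothesis N_gt0 : 0 < N.

(* Few distinct links have many hubs, so few hubs have an unpopular link. *)
Lemma star_bound d th gam eta : (0 < d)%N -> 0 <= th -> 0 < gam ->
  sums d (fun V => ptrace R F' (nseq d None) V *
    (ptrace R F (nseq d None) V < gam * N)%R%:R) <= eta * N ^+ d ->
  sums d (fun V => ptrace R F' (nseq d None) V *
    (ptrace R F' (nseq d None) V < th * N)%R%:R) <= (eta + th / gam) * N ^+ d.
Proof.
move=> d0 th0 gam0 un; have tg : 0 <= th / gam by rewrite divr_ge0 // ltW.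
rewrite mulrDl; apply: le_trans (lerD un (ler_wpM2l tg (sums_ptrace R Fdet2 Fdet3 d0))).
rewrite -sumsZ -sumsD; apply: le_sums => V _.
set c' := ptrace R F' _ V; set c := ptrace R F _ V.
have c0 : 0 <= c by apply: ptrace_ge0. have c'0 : 0 <= c' by apply: ptrace_ge0.
have k0 : 0 <= th / gam * c by rewrite mulr_ge0.
case: (ltP c) => [_|ge]; rewrite ?mulr0 ?mulr1 ?add0r.
  by apply: le_trans (_ : c' <= _); rewrite ?lerDl // ler_piMr // lern1 leq_b1.
case: (ltP c') => [/ltW lt|_]; last by rewrite mulr0.
rewrite mulr1; apply: le_trans lt _; rewrite mulrAC ler_pdivlMr // -mulrA.
by apply: ler_wpM2l => //; rewrite mulrC.
Qed.

End StarBound.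

(** * Octahedra as pairs of cones over a four-cycle *)

Section Octahedra.
Variables (R : realFieldType) (T : finType) (inv : T -> T).
Variable F : T -> T -> T -> bool.
Hypothesis invK : involutive inv.
Hypothesis F_swap : forall g u h, F g u h -> F h (inv u) g.
Hypothesis F_flip : forall g u h, F g u h -> F (inv g) h u.
Hypothesis Fdet1 : forall a a' u h, F a u h -> F a' u h -> a = a'.
Hypothesis Fdet2 : forall a u u' h, F a u h -> F a u' h -> u = u'.
Hypothesis Fdet3 : forall a u h h', F a u h -> F a u h' -> h = h'.
Local Notation N := (#|T|%:R : R).
Hypothesis N_gt0 : 0 < N.

Local Notation swapE := (F_swapE invK F_swap).
Local Notation flipE := (F_flipE invK F_flip).

Lemma cauchy_schwarz (I : finType) (f : I -> R) :
  (\sum_i f i) ^+ 2 <= #|I|%:R * \sum_i f i ^+ 2.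
Proof.
have [i0|i0] := posnP #|I|.
  by rewrite big_pred0 ?expr0n ?i0 ?mul0r // => i; have := card0_eq i0 i.
have n0 : 0 < #|I|%:R :> R by rewrite ltr0n.
set S := \sum_i f i; set Q := \sum_i _.
rewrite -subr_ge0 -(pmulr_rge0 _ n0).
have <- : \sum_i (#|I|%:R * f i - S) ^+ 2 = #|I|%:R * (#|I|%:R * Q - S ^+ 2).
  have e i : (#|I|%:R * f i - S) ^+ 2 =
      #|I|%:R ^+ 2 * f i ^+ 2 - 2 * #|I|%:R * S * f i + S ^+ 2.
    by move: (#|I|%:R : R) => x; ring.
  under eq_bigr => i _ do rewrite e.
  have e2 : \sum_(i : I) S ^+ 2 = #|I|%:R * S ^+ 2 by rewrite sumr_const mulr_natl.
  rewrite big_split sumrB /= e2 -!mulr_sumr -/Q -/S.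
  by move: (#|I|%:R : R) => x; ring.
by apply: sumr_ge0 => i _; apply: sqr_ge0.
Qed.

Definition adjacent g h : R := \sum_u (F g u h)%:R.
Definition common g h : R := \sum_k adjacent g k * adjacent k h.

Lemma adjacentC g h : adjacent g h = adjacent h g.
Proof.
rewrite /adjacent -(sum_inv invK); apply: eq_bigr => u _.
by rewrite swapE.
Qed.

Lemma sums_spokesS k a b :
  sums k.+1 (fun V => paths R F a (nseq k.+1 None) V b) =
  \sum_c adjacent a c * sums k (fun V => paths R F c (nseq k None) V b).
Proof.
rewrite sumsS; transitivity (\sum_u \sum_c (F a u c)%:R *
    sums k (fun V => paths R F c (nseq k None) V b)).
  apply: eq_bigr => u _; under [RHS]eq_bigr do rewrite -sumsZ.
  by rewrite -exchange_sums; apply: eq_sums.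
by rewrite exchange_big; apply: eq_bigr => c _; rewrite /adjacent mulr_suml.
Qed.

Lemma sums_cones4 : sums 4 (cones R F) = \sum_g \sum_h common g h ^+ 2.
Proof.
have w2 a b : sums 2 (fun V => paths R F a (nseq 2 None) V b) = common a b.
  rewrite sums_spokesS; apply: eq_bigr => c _; congr (_ * _).
  by apply: eq_bigr => u _; rewrite paths1.
rewrite /cones; under eq_sums => V sV do rewrite sV.
rewrite exchange_sums; apply: eq_bigr => g _.
rewrite sums_spokesS; under eq_bigr => k _ do rewrite sums_spokesS [X in X * _]adjacentC.
under eq_bigr => k _ do rewrite mulr_sumr.
rewrite exchange_big; apply: eq_bigr => h _ /=.
rewrite w2 [in RHS]expr2 [X in _ = X * _]/common mulr_suml; apply: eq_bigr => k _.
rewrite mulrA [adjacent k g]adjacentC; congr (_ * _).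
by apply: eq_bigr => l _; rewrite mulrC [adjacent l g]adjacentC [adjacent h l]adjacentC.
Qed.

(** Sidorenko's inequality for the four-cycle in the graph of spokes: Cauchy-Schwarz for the degrees
    and then for the codegrees. *)
Lemma sums_cones4_ge al : 0 <= al ->
  al * N ^+ 2 <= \sum_g \sum_u \sum_h (F g u h)%:R ->
  al ^+ 4 * N ^+ 4 <= sums 4 (cones R F).
Proof.
move=> al0 le; rewrite sums_cones4.
have n0 := N_gt0.
pose deg g := \sum_h adjacent g h.
have le1 : al * N ^+ 2 <= \sum_g deg g.
  by apply: le_trans le _; apply: ler_sum => g _; rewrite exchange_big.
have le2 : al ^+ 2 * N ^+ 3 <= \sum_g \sum_h common g h.
  have -> : \sum_g \sum_h common g h = \sum_g deg g ^+ 2.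
    rewrite /common; under eq_bigr do rewrite exchange_big /=.
    rewrite exchange_big; apply: eq_bigr => k _ /=.
    under eq_bigr => g _ do under eq_bigr => h _ do rewrite (adjacentC g k).
    by under eq_bigr => g _ do rewrite -mulr_sumr; rewrite -mulr_suml expr2.
  rewrite -(ler_pM2l n0); apply: le_trans (cauchy_schwarz deg).
  apply: le_trans (_ : (al * N ^+ 2) ^+ 2 <= _).
    by rewrite le_eqVlt; apply/orP; left; apply/eqP; move: N => x; ring.
  by rewrite lerXn2r ?nnegrE ?(le_trans _ le1) ?mulr_ge0 ?exprn_ge0 // ltW.
have n2 : 0 < N ^+ 2 by rewrite exprn_gt0.
rewrite -(ler_pM2l n2) pair_bigA /=.
have := cauchy_schwarz (fun x : T * T => common x.1 x.2).
rewrite card_prod natrM -expr2; apply: le_trans.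
rewrite pair_bigA /= in le2; apply: le_trans (_ : (al ^+ 2 * N ^+ 3) ^+ 2 <= _).
  by rewrite le_eqVlt; apply/orP; left; apply/eqP; move: N => x; ring.
have l0 : 0 <= al ^+ 2 * N ^+ 3 by rewrite mulr_ge0 ?exprn_ge0 // ltW.
by rewrite lerXn2r ?nnegrE // (le_trans l0).
Qed.

(** The seven faces of an octahedron other than [s1 s2 s3]: six faces form an annulus around this
    triangle, and [u1 u2 u3] is the opposite face. *)
Definition octa_at s1 s2 s3 (t : T * T * T * (T * T * T) * (T * T * T)) :=
  let: (u1, u2, u3, (g1, g2, g3), (h1, h2, h3)) := t in
  [&& F g1 u1 h1, F s1 g2 h1, F g2 u2 h2, F s2 g3 h2, F g3 u3 h3, F s3 g1 h3
    & F u1 u2 (inv u3)].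

Definition octa s1 s2 s3 : R := \sum_t (octa_at s1 s2 s3 t)%:R.

Lemma octa_ge0 s1 s2 s3 : 0 <= octa s1 s2 s3.
Proof. by apply: sumr_ge0 => t _; rewrite ler0n. Qed.

Hypothesis F_rot : forall u1 u2 u3, F u1 u2 (inv u3) = F u2 u3 (inv u1).

Lemma octa_rot s1 s2 s3 : octa s2 s3 s1 = octa s1 s2 s3.
Proof.
rewrite /octa (reindex (fun t : T * T * T * (T * T * T) * (T * T * T) =>
  let: (u1, u2, u3, (g1, g2, g3), (h1, h2, h3)) := t in
  ((u2, u3, u1), (g2, g3, g1), (h2, h3, h1)))) /=; last first.
  exists (fun t : T * T * T * (T * T * T) * (T * T * T) =>
  let: (u1, u2, u3, (g1, g2, g3), (h1, h2, h3)) := t in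
  ((u3, u1, u2), (g3, g1, g2), (h3, h1, h2))) => -[[[[? ?] ?] [[? ?] ?]] [[? ?] ?]] //.
apply: eq_bigr => -[[[[u1 u2] u3] [[g1 g2] g3]] [[h1 h2] h3]] _ /=.
by rewrite -F_rot; do 7 case: (F _ _ _).
Qed.

Lemma octa_inv s1 s2 s3 : octa (inv s3) (inv s2) (inv s1) = octa s1 s2 s3.
Proof.
pose f (t : T * T * T * (T * T * T) * (T * T * T)) :=
  let: (u1, u2, u3, (g1, g2, g3), (h1, h2, h3)) := t in
  ((inv u1, inv u3, inv u2), (h1, h3, h2), (g1, g3, g2)).
have fK : involutive f.
  by case=> [[[[u1 u2] u3] [[g1 g2] g3]] [[h1 h2] h3]]; rewrite /= !invK.
rewrite /octa (reindex_inj (inv_inj fK)) /=.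
apply: eq_bigr => -[[[[u1 u2] u3] [[g1 g2] g3]] [[h1 h2] h3]] _ /=.
rewrite ?swapE ?flipE -F_rot.
by congr (nat_of_bool _)%:R; do 7 case: (F _ _ _).
Qed.

Lemma sum_quad (G : T -> T -> T -> T -> R) :
  \sum_x \sum_y \sum_z \sum_w G x y z w =
  \sum_(t : T * T * T * T) G t.1.1.1 t.1.1.2 t.1.2 t.2.
Proof.
rewrite -(pair_bigA _ (fun t w => G t.1.1 t.1.2 t.2 w)) /=.
rewrite -(pair_bigA _ (fun t z => \sum_w G t.1 t.2 z w)) /=.
by rewrite -(pair_bigA _ (fun x y => \sum_z \sum_w G x y z w)).
Qed.

Definition cone_at (w p : T * T * T * T) :=
  let: (w1, w2, w3, w4) := w in let: (p1, p2, p3, p4) := p in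
  [&& F p1 w1 p2, F p2 w2 p3, F p3 w3 p4 & F p4 w4 p1].

Lemma conesE w1 w2 w3 w4 : cones R F [:: w1; w2; w3; w4] =
  \sum_p (cone_at (w1, w2, w3, w4) p)%:R.
Proof.
transitivity (\sum_p1 \sum_p2 \sum_p3 \sum_p4
    (cone_at (w1, w2, w3, w4) (p1, p2, p3, p4))%:R : R); last first.
  rewrite (sum_quad (fun p1 p2 p3 p4 => (cone_at _ (p1, p2, p3, p4))%:R)).
  by apply: eq_bigr => -[[[? ?] ?] ?].
apply: eq_bigr => p1 _; rewrite /= paths_cons; apply: eq_bigr => p2 _.
rewrite paths_cons mulr_sumr; apply: eq_bigr => p3 _.
rewrite paths_cons !mulr_sumr; apply: eq_bigr => p4 _.
by rewrite paths1 /= !natrA.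
Qed.

(* Two cones with the same link and a common face span an octahedron. *)
Lemma sum_octa : \sum_s1 \sum_s2 \sum_s3 (F s1 s2 (inv s3))%:R * octa s1 s2 s3 =
  sums 4 (fun V => cones R F V ^+ 2).
Proof.
pose D := (T * T * T * (T * T * T * (T * T * T) * (T * T * T)))%type.
transitivity (\sum_(x : D) (F x.1.1.1 x.1.1.2 (inv x.1.2) &&
    octa_at x.1.1.1 x.1.1.2 x.1.2 x.2)%:R : R).
  rewrite -(pair_bigA _ (fun s t => (F s.1.1 s.1.2 (inv s.2) &&
    octa_at s.1.1 s.1.2 s.2 t)%:R)) /=.
  rewrite -(sum_triple (fun s => \sum_t (F s.1.1 s.1.2 (inv s.2) &&
    octa_at s.1.1 s.1.2 s.2 t)%:R)) /=.
  do 3 (apply: eq_bigr => ? _); rewrite /octa mulr_sumr.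
  by apply: eq_bigr => t _; rewrite natrA.
have -> : sums 4 (fun V => cones R F V ^+ 2) = _ :=
  sum_quad (fun w1 w2 w3 w4 => cones R F [:: w1; w2; w3; w4] ^+ 2).
transitivity (\sum_(y : T * T * T * T * (T * T * T * T * (T * T * T * T)))
    (cone_at y.1 y.2.1 && cone_at y.1 y.2.2)%:R : R); last first.
  rewrite -(pair_bigA _ (fun w y => (cone_at w y.1 && cone_at w y.2)%:R)) /=.
  apply: eq_bigr => -[[[w1 w2] w3] w4] _ /=.
  rewrite conesE expr2 mulr_suml -(pair_bigA _ (fun p q =>
    (cone_at (w1, w2, w3, w4) p && cone_at (w1, w2, w3, w4) q)%:R)).
  by apply: eq_bigr => p _; rewrite mulr_sumr; apply: eq_bigr => q _; rewrite natrA.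
pose f (x : D) :=
  let: ((s1, s2, s3), (u1, u2, u3, (g1, g2, g3), (h1, h2, h3))) := x in
  ((s2, h3, u1, inv g2),
   ((s1, inv s3, g1, h1), (inv h2, inv g3, u3, inv u2))).
pose f' (y : T * T * T * T * (T * T * T * T * (T * T * T * T))) : D :=
  let: ((w1, w2, w3, w4), ((p1, p2, p3, p4), (q1, q2, q3, q4))) := y in
  ((p1, w1, inv p2), (w3, inv q4, q3, (p3, inv w4, inv q2), (p4, inv q1, w2))).
rewrite [RHS](reindex f) /=; last first.
  exists f'.
    by case=> [[[? ?] ?] [[[[? ?] ?] [[? ?] ?]] [[? ?] ?]]] _; rewrite /= !invK.
  by case=> [[[[? ?] ?] ?] [[[[? ?] ?] ?] [[[? ?] ?] ?]]] _; rewrite /= !invK.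
apply: eq_bigr => -[[[s1 s2] s3] [[[[u1 u2] u3] [[g1 g2] g3]] [[h1 h2] h3]]] _ /=.
have -> : F (inv u2) (inv g2) (inv h2) = F g2 u2 h2 by rewrite swapE flipE swapE.
have -> : F (inv h2) s2 (inv g3) = F s2 g3 h2 by rewrite flipE swapE.
rewrite swapE !flipE (F_rot u3).
by congr (nat_of_bool _)%:R; do 8 case: (F _ _ _).
Qed.

End Octahedra.

Section FacePopularity.
Variables (R : realFieldType) (A : finType).
Local Notation T := (A * bool)%type.
Variable F : T -> T -> T -> bool.
Hypothesis Fdet3 : forall a u h h', F a u h -> F a u h' -> h = h'.
Local Notation N := (#|{: T}|%:R : R).

(** An annulus around a triangle that ends in a face is an octahedron through it. This makes the
    count of octahedra the base case of [universal_kernels]. *)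
Lemma popularity_face_kernel s1 s2 s3 :
  popularity F (face_kernel R F) [:: Some s1; Some s2; Some s3] =
  N ^- 3 * octa R (@linv A) F s1 s2 s3.
Proof.
rewrite /popularity /=; congr (_ * _); rewrite /octa.
pose G (u1 u2 u3 g1 g2 g3 h1 h2 h3 : T) :=
  (octa_at (@linv A) F s1 s2 s3 (u1, u2, u3, (g1, g2, g3), (h1, h2, h3)))%:R : R.
transitivity (\sum_u1 \sum_u2 \sum_u3 \sum_g1 \sum_g2 \sum_g3
   \sum_h1 \sum_h2 \sum_h3 G u1 u2 u3 g1 g2 g3 h1 h2 h3); last first.
  rewrite (sum_triple (fun u => \sum_g1 \sum_g2 \sum_g3 \sum_h1 \sum_h2 \sum_h3
    G u.1.1 u.1.2 u.2 g1 g2 g3 h1 h2 h3)).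
  under eq_bigr => u _ do rewrite (sum_triple (fun g => \sum_h1 \sum_h2 \sum_h3
    G u.1.1 u.1.2 u.2 g.1.1 g.1.2 g.2 h1 h2 h3)).
  under eq_bigr => u _ do under eq_bigr => g _ do rewrite (sum_triple (fun h =>
    G u.1.1 u.1.2 u.2 g.1.1 g.1.2 g.2 h.1.1 h.1.2 h.2)).
  rewrite !pair_bigA; apply: eq_bigr => -[[[[? ?] ?] [[? ?] ?]] [[? ?] ?]] //.
apply: eq_bigr => u1 _; apply: eq_bigr => u2 _; apply: eq_bigr => u3 _.
rewrite mulr_suml; apply: eq_bigr => g1 _.
rewrite paths_cons mulr_suml; apply: eq_bigr => g2 _.
rewrite paths_cons mulr_sumr mulr_suml; apply: eq_bigr => g3 _.
rewrite paths1 !(stepE R Fdet3) -mulrA mulr_suml; apply: eq_bigr => h1 _.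
rewrite -[X in _ * X]mulrA mulr_suml mulr_sumr; apply: eq_bigr => h2 _.
rewrite mulr_suml !mulr_sumr; apply: eq_bigr => h3 _.
by rewrite /G /= !natrA !mulrA.
Qed.

End FacePopularity.

(** * Choice of exponents and faces all of whose letters are good *)

Section Spread.
Variables (R : realFieldType) (A : finType).
Local Notation T := (A * bool)%type.
Local Notation inv := (@linv A).
Variable F : T -> T -> T -> bool.
Hypothesis F_swap : forall g u h, F g u h -> F h (inv u) g.
Hypothesis F_flip : forall g u h, F g u h -> F (inv g) h u.
Hypothesis Fdet1 : forall a a' u h, F a u h -> F a' u h -> a = a'.
Hypothesis Fdet2 : forall a u u' h, F a u h -> F a u' h -> u = u'.
Hypothesis Fdet3 : forall a u h h', F a u h -> F a u h' -> h = h'.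
Local Notation N := (#|{: T}|%:R : R).
Hypothesis N_gt0 : 0 < N.
Let invK : involutive inv := @linvK A.

Lemma F_rot u1 u2 u3 : F u1 u2 (inv u3) = F u2 u3 (inv u1).
Proof.
suff rot a b c : F a b (inv c) -> F b c (inv a).
  by apply/idP/idP => [|/rot/rot]; first exact: rot.
by move=> /F_flip/F_swap; rewrite invK.
Qed.

Variables (dl : R) (S g Tm : nat).
Local Notation L := (7 * S).+1.
Hypothesis dl_gt0 : 0 < dl.
Hypothesis dl_le : dl <= 16^-1.
Hypothesis S_dl : (2 * (S.+1 * (L + 4) ^ 3))%:R * dl <= 1.
Hypothesis S_gt0 : (0 < S)%N.
Hypothesis stars : forall t d, (1 < d < L + 4)%N -> (g < t <= Tm)%N ->
  sums d (fun V => cones R F V * (cones R F V < dl ^+ t * N)%R%:R) <=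
  dl ^+ (t - g.+1) * N ^+ d.

Lemma dlX_gt0 k : 0 < dl ^+ k. Proof. by rewrite exprn_gt0. Qed.

Lemma dlX_le j k : (j <= k)%N -> dl ^+ k <= dl ^+ j.
Proof. by apply: ler_wiXn2l; have := dl_gt0; have := dl_le; lra. Qed.

Section Level.
Variable y : nat.
Hypothesis y_le : (8 * y + 23 + 2 * g <= Tm)%N.

(* The exponents are the least ones that keep the exceptional sets below
   [dl ^+ (2 * y + 3)] in [fold_total] and below [dl ^+ y] in [merge_total]. *)
Definition fold_gam : R :=
  dl ^+ (4 * y + 11 + g) * dl ^+ (8 * y + 23 + 2 * g) * dl ^+ (2 * y + 4) / 4.
Definition merge_gam : R := dl ^+ y.+1 * fold_gam / 2.

Local Notation K := (dumbbell R inv F).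

Lemma fold_total_level m : (m < L)%N ->
  \sum_s \sum_a \sum_b sums m.+2 (fun V =>
    paths R F a (zipper inv s m) V b * (detour F K a b V < fold_gam)%R%:R) <=
  dl ^+ (2 * y + 3) * N ^+ (m + 4).
Proof.
move=> mL; have d0 := dl_gt0; have dl1 := dl_le.
have s1 : (1 < m.+3 < L + 4)%N by lia.
have s2 : (1 < 6 < L + 4)%N by lia.
have t1 : (g < 4 * y + 11 + g <= Tm)%N by lia.
have t2 : (g < 8 * y + 23 + 2 * g <= Tm)%N by lia.
apply: le_trans (fold_total invK F_swap F_flip Fdet1 Fdet2 Fdet3 N_gt0
  (dlX_gt0 _) (dlX_gt0 _) (dlX_gt0 _) (stars s1 t1) (stars s2 t2)) _.
apply: ler_wpM2r; first by rewrite exprn_ge0 // ltW.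
have -> : (4 * y + 11 + g - g.+1 = 2 * (2 * y + 3) + 4)%N by lia.
have -> : (8 * y + 23 + 2 * g - g.+1 = (4 * y + 11 + g) + (2 * (2 * y + 3) + 5))%N by lia.
have -> : (2 * y + 4 = (2 * y + 3).+1)%N by lia.
move: (4 * y + 11 + g)%N (2 * y + 3)%N => i j.
have -> : dl ^+ (2 * j + 4) = dl ^+ j * dl ^+ j * dl ^+ 4 by rewrite -!exprD; congr (_ ^+ _); lia.
have -> : dl ^+ (i + (2 * j + 5)) = dl ^+ i * dl ^+ j * dl ^+ j * dl ^+ 5.
  by rewrite -!exprD; congr (_ ^+ _); lia.
rewrite exprSr; have := dlX_gt0 i; have := dlX_gt0 j.
move: (dl ^+ i) (dl ^+ j) => x z z0 x0.
have -> : z * dl + 2 / (z * dl) * (z * z * dl ^+ 4 + 2 / x * (x * z * z * dl ^+ 5)) =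
    z * (dl + 2 * dl ^+ 3 + 4 * dl ^+ 4).
  by field; rewrite !gt_eqF.
rewrite ger_pMr //; nra.
Qed.

Lemma merge_total_level :
  \sum_s \sum_a \sum_b \sum_a' \sum_b' \sum_u \sum_u'
    (step F a (Some s) u b)%:R * (step F a' (Some (inv s)) u' b')%:R *
    (detour2 inv F K a b a' b' u u' < merge_gam)%R%:R <= dl ^+ y * N ^+ 5.
Proof.
have d0 := dl_gt0; have dl1 := dl_le; have L3 : (3 < L)%N by lia.
have g0 : 0 <= fold_gam by rewrite divr_ge0 ?ler0n // !mulr_ge0 // ltW // dlX_gt0.
apply: le_trans (merge_total invK F_swap F_flip Fdet2 Fdet3 N_gt0
  (dlX_gt0 _) g0 (fold_total_level L3)) _.
apply: ler_wpM2r; first by rewrite exprn_ge0 // ltW.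
have -> : dl ^+ (2 * y + 3) = dl ^+ y * dl ^+ y * dl ^+ 3 by rewrite -!exprD; congr (_ ^+ _); lia.
rewrite exprSr; have := dlX_gt0 y; move: (dl ^+ y) => z z0.
have -> : z * dl + 2 / (z * dl) * (z * z * dl ^+ 3) = z * (dl + 2 * dl ^+ 2).
  by field; rewrite !gt_eqF.
rewrite ger_pMr //; nra.
Qed.

Lemma fold_gam_ge0 : 0 <= fold_gam.
Proof. by rewrite divr_ge0 ?ler0n // !mulr_ge0 // ltW // dlX_gt0. Qed.

Lemma merge_gam_le : merge_gam <= fold_gam.
Proof.
have y1 : dl ^+ y.+1 <= 1 by apply: (@dlX_le 0).
have := fold_gam_ge0; rewrite /merge_gam; move: (dl ^+ y.+1) y1 fold_gam => x x1 f f0.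
nra.
Qed.

Lemma merge_gam_ge : dl ^+ (15 * y + 40 + 3 * g) <= merge_gam.
Proof.
have d0 := dl_gt0; have dl1 := dl_le.
have -> : merge_gam = 8^-1 * dl ^+ (15 * y + 39 + 3 * g).
  have -> : (15 * y + 39 + 3 * g =
    y.+1 + ((4 * y + 11 + g) + (8 * y + 23 + 2 * g) + (2 * y + 4)))%N by lia.
  by rewrite 3![in RHS]exprD /merge_gam /fold_gam; field.
have -> : (15 * y + 40 + 3 * g = (15 * y + 39 + 3 * g).+1)%N by lia.
by rewrite exprS ler_pM2r ?dlX_gt0 //; lra.
Qed.

End Level.

Lemma markov (f : T -> R) c B : 0 < c -> (forall x, 0 <= f x) ->
  \sum_x f x <= B * c -> \sum_x (~~ (f x <= c))%:R <= B.
Proof.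
move=> c0 f0 le; rewrite -(ler_pM2r c0); apply: le_trans le.
rewrite mulr_suml; apply: ler_sum => x _; rewrite -ltNge.
by case: ltP => [/ltW|_]; rewrite ?mul1r ?mul0r.
Qed.

(* Octahedra have density [dl ^+ height], and discs built in [s] steps have
   popularity [dl ^+ expo s]. *)
Definition height := (25 * g + 19)%N.
Definition expo s := (height.+2 * 64 ^ s.-1)%N.
Definition level s := (2 * expo s + height + 4)%N.
Hypothesis level_le : forall s, (s < S)%N -> (8 * level s + 23 + 2 * g <= Tm)%N.
(** This is [dl] times the square of the popularity [dl ^+ expo s], hence a small fraction of the
    product of popularities available in a merge. *)
Definition loss s := dl ^+ (2 * expo s).+1.
Definition gain s := merge_gam (level s).

Local Notation K := (dumbbell R inv F).

Definition good_at s (i : option 'I_L) x :=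
  if i is Some m then fold_good inv F K (loss s) (gain s) m x
  else merge_good inv F K (loss s) (gain s) x.

Definition good_letter x := [forall s : 'I_S, forall i, good_at s i x].

Lemma few_bad_at s i : (s < S)%N ->
  \sum_x (~~ good_at s i x)%:R <= dl ^+ height.+3 * N.
Proof.
move=> sS; have yl := level_le sS; have d0 := dl_gt0.
have loss0 : 0 < loss s by apply: dlX_gt0.
have n0 := N_gt0.
(* [level] is chosen for this identity: Markov's inequality divides by [loss s], and of the
   remaining [dl ^+ height.+3] one factor [dl] pays for the sum over all [s] and [i]. *)
have e : dl ^+ level s = dl ^+ height.+3 * loss s.
  by rewrite /loss -exprD; congr (_ ^+ _); rewrite /level; lia.
case: i => [m|].
  apply: markov; first by rewrite mulr_gt0 // exprn_gt0.
    move=> x; apply: sumr_ge0 => a _; apply: sumr_ge0 => b _; apply: sums_ge0 => V _.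
    by rewrite mulr_ge0 ?paths_ge0 ?ler0n.
  apply: le_trans (_ : dl ^+ (2 * level s + 3) * N ^+ (m + 4) <= _).
    apply: le_trans (fold_total_level yl (ltn_ord m)).
    apply: ler_sum => x _; apply: ler_sum => a _; apply: ler_sum => b _.
    apply: le_sums => V _; apply: ler_wpM2l; first exact: paths_ge0.
    rewrite ler_nat; case: (ltP _ (gain s)) => // lt.
    by rewrite (lt_le_trans lt) // merge_gam_le.
  apply: le_trans (_ : dl ^+ level s * N ^+ (m + 4) <= _).
    by apply: ler_wpM2r; [rewrite exprn_ge0 // ltW | apply: dlX_le; lia].
  rewrite e !addnS addn0 !exprS.
  by rewrite le_eqVlt; apply/orP; left; apply/eqP; move: N (N ^+ m) => x z; ring.
apply: markov; first by rewrite mulr_gt0 // exprn_gt0.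
  move=> x; do 6 (apply: sumr_ge0 => ? _); by rewrite !mulr_ge0 ?ler0n.
apply: le_trans (merge_total_level yl) _; rewrite e.
by rewrite le_eqVlt; apply/orP; left; apply/eqP; move: N => x; ring.
Qed.

Lemma natr_neg_forall (I : finType) (P : pred I) :
  (~~ [forall i, P i])%:R <= \sum_i (~~ P i)%:R :> R.
Proof.
case: (boolP [forall i, P i]) => [_|/forallPn[i ni]].
  by apply: sumr_ge0 => i _; rewrite ler0n.
by rewrite (bigD1 i) //= ni lerDl sumr_ge0 // => j _; rewrite ler0n.
Qed.

Lemma few_bad_letters : \sum_x (~~ good_letter x)%:R <= dl ^+ height.+2 / 2 * N.
Proof.
apply: le_trans (_ : \sum_x \sum_(s < S) \sum_i (~~ good_at s i x)%:R <= _).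
  apply: ler_sum => x _; apply: le_trans (natr_neg_forall _) _.
  by apply: ler_sum => s _; apply: natr_neg_forall.
rewrite exchange_big; apply: le_trans (_ : \sum_(s < S) \sum_(i : option 'I_L)
    dl ^+ height.+3 * N <= _).
  apply: ler_sum => s _; rewrite exchange_big; apply: ler_sum => i _.
  exact: few_bad_at (ltn_ord s).
have -> : \sum_(s < S) \sum_(i : option 'I_L) dl ^+ height.+3 * N =
    (S * L.+1)%:R * dl * (dl ^+ height.+2 * N).
  rewrite !sumr_const card_option !card_ord -mulrnA (mulnC _ S).
  rewrite -[LHS]mulr_natl [dl ^+ height.+3]exprS -!mulrA; congr (_ * _).
have le : (S * L.+1)%:R * dl <= 2^-1.
  suff : (2 * (S * L.+1))%:R * dl <= 1 by rewrite natrM; lra.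
  apply: le_trans S_dl; apply: ler_wpM2r; first exact: ltW.
  by rewrite ler_nat; nia.
have p0 : 0 <= dl ^+ height.+2 * N by rewrite mulr_ge0 // ltW // dlX_gt0.
by apply: le_trans (ler_wpM2r p0 le) _; rewrite mulrCA mulrA.
Qed.

Local Notation O := (octa R inv F).

Lemma octa_le s1 s2 s3 : O s1 s2 s3 <= N ^+ 3.
Proof.
have := sum_popularity_letter Fdet1 Fdet2 Fdet3 N_gt0 [::] [:: Some s2; Some s3]
  (kernel_face R Fdet1 Fdet2 Fdet3).
move=> le1; rewrite -[X in _ <= X]mulr1 -ler_pdivrMl ?exprn_gt0 //.
rewrite -popularity_face_kernel //; apply: le_trans le1.
rewrite (bigD1 s1) //= lerDl sumr_ge0 // => y _.
rewrite popularity_face_kernel // mulr_ge0 ?octa_ge0 // invr_ge0 exprn_ge0 // ltW.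
Qed.

Local Notation weight s1 s2 s3 := ((F s1 s2 (inv s3))%:R * O s1 s2 s3).

Lemma sum_face_letter (B : pred T) c : \sum_x (B x)%:R <= c ->
  \sum_s1 \sum_s2 \sum_s3 (B s1)%:R * weight s1 s2 s3 <= c * N ^+ 4.
Proof.
move=> Bc; have n0 := N_gt0.
apply: le_trans (_ : (\sum_x (B x)%:R) * N ^+ 4 <= _).
  rewrite mulr_suml; apply: ler_sum => s1 _.
  apply: le_trans (_ : (B s1)%:R * N ^+ 3 * \sum_s2 \sum_s3 (F s1 s2 (inv s3))%:R <= _).
    rewrite mulr_sumr; apply: ler_sum => s2 _; rewrite mulr_sumr; apply: ler_sum => s3 _.
    rewrite -mulrA; apply: ler_wpM2l; first by rewrite ler0n.
    by rewrite mulrC; apply: ler_wpM2r (octa_le _ _ _); rewrite ler0n.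
  rewrite [in X in _ <= X]exprSr mulrA; apply: ler_wpM2l.
    by rewrite mulr_ge0 ?ler0n // exprn_ge0 // ltW.
  have -> : N = \sum_(s2 : T) 1 by rewrite sumr_const.
  apply: ler_sum => s2 _.
  rewrite (sum_inv invK (fun x => (F s1 s2 x)%:R)).
  by apply: sum_uniq_le1 => s3 s3'; apply: Fdet3.
by apply: ler_wpM2r Bc; rewrite exprn_ge0 // ltW.
Qed.

Lemma weight_rot s1 s2 s3 : weight s2 s3 s1 = weight s1 s2 s3.
Proof. by rewrite -F_rot (octa_rot R F_rot). Qed.

Lemma sum_rot (G : T -> T -> T -> R) :
  \sum_s1 \sum_s2 \sum_s3 G s2 s3 s1 = \sum_s1 \sum_s2 \sum_s3 G s1 s2 s3.
Proof.
by rewrite exchange_big; apply: eq_bigr => s2 _; rewrite exchange_big.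
Qed.

(** Both signs are required so that nice faces are closed under inversion. *)
Definition two_good x := good_letter x && good_letter (inv x).

Lemma few_bad_two : \sum_x (~~ two_good x)%:R <= dl ^+ height.+2 * N.
Proof.
have -> : dl ^+ height.+2 * N = dl ^+ height.+2 / 2 * N + dl ^+ height.+2 / 2 * N.
  by move: N => x; field.
apply: le_trans (lerD few_bad_letters few_bad_letters).
rewrite -[X in _ <= _ + X](sum_inv invK) -big_split; apply: ler_sum => x _ /=.
by rewrite -natrD ler_nat negb_and; do 2 case: (good_letter _).
Qed.

Definition nice_face s1 s2 s3 :=
  [&& F s1 s2 (inv s3), dl ^+ height.+2 * N ^+ 3 <= O s1 s2 s3,
      two_good s1, two_good s2 & two_good s3].

Lemma nice_rot s1 s2 s3 : nice_face s1 s2 s3 -> nice_face s2 s3 s1.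
Proof.
case/and5P=> f o g1 g2 g3; rewrite /nice_face -F_rot f (octa_rot R F_rot) o.
by rewrite g1 g2 g3.
Qed.

Lemma nice_inv s1 s2 s3 : nice_face s1 s2 s3 -> nice_face (inv s3) (inv s2) (inv s1).
Proof.
case/and5P=> f o g1 g2 g3.
have two_inv x : two_good (inv x) = two_good x by rewrite /two_good invK andbC.
rewrite /nice_face (octa_inv R invK F_swap F_flip F_rot) o !two_inv g1 g2 g3 invK.
by rewrite F_swap.
Qed.

(** A face is not nice because it lies in few octahedra or because one of its three letters is bad.
    Each of the four cases loses at most [c * N ^ 5] octahedra, where [c] is [dl ^+ 2] times their
    density, and a nice face accounts for at most [N ^ 3]. *)
Lemma sum_nice_face :
  dl ^+ height * N ^+ 5 <= \sum_s1 \sum_s2 \sum_s3 weight s1 s2 s3 ->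
  dl ^+ height.+1 * N ^+ 2 <= \sum_s1 \sum_s2 \sum_s3 (nice_face s1 s2 s3)%:R.
Proof.
move=> many; have n0 := N_gt0; have d0 := dl_gt0; have dl1 := dl_le.
set c := dl ^+ height.+2; have c0 : 0 < c by apply: dlX_gt0.
pose B x := ~~ two_good x.
have le : \sum_s1 \sum_s2 \sum_s3 weight s1 s2 s3 <=
    \sum_s1 \sum_s2 \sum_s3 (N ^+ 3 * (nice_face s1 s2 s3)%:R +
     (c * N ^+ 3 * (F s1 s2 (inv s3))%:R +
     ((B s1)%:R * weight s1 s2 s3 + ((B s2)%:R * weight s2 s3 s1 +
      (B s3)%:R * weight s3 s1 s2)))).
  apply: ler_sum => s1 _; apply: ler_sum => s2 _; apply: ler_sum => s3 _.
  rewrite (weight_rot s2 s3 s1) (weight_rot s1 s2 s3) /nice_face -/c.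
  have o0 := octa_ge0 R inv F s1 s2 s3; have oN := octa_le s1 s2 s3.
  case: (F s1 s2 (inv s3)); last by rewrite !mul0r !mulr0 !addr0.
  rewrite !mul1r mulr1 /=.
  have cN : 0 <= c * N ^+ 3 by rewrite mulr_ge0 ?exprn_ge0 // ltW.
  rewrite /B; move: (two_good s1) (two_good s2) (two_good s3) => g1 g2 g3.
  move: (N ^+ 3) (c * N ^+ 3) (O s1 s2 s3) o0 oN cN => z y x x0 xz y0.
  case: (leP y x) => yx; case: g1; case: g2; case: g3; rewrite /= ?mulr0 ?mulr1 ?mul0r ?mul1r; lra.
have bB : \sum_x (B x)%:R <= c * N by exact: few_bad_two.
have b1 := sum_face_letter bB.
have FN : \sum_s1 \sum_s2 \sum_s3 (F s1 s2 (inv s3))%:R <= N ^+ 2.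
  rewrite expr2; have -> : N * N = \sum_(x : T) \sum_(y : T) 1.
    by rewrite !sumr_const mulr_natl.
  apply: ler_sum => s1 _; apply: ler_sum => s2 _.
  rewrite (sum_inv invK (fun x => (F s1 s2 x)%:R)).
  by apply: sum_uniq_le1 => s3 s3'; apply: Fdet3.
have sum3D (G H : T -> T -> T -> R) : \sum_x \sum_y \sum_z (G x y z + H x y z) =
    \sum_x \sum_y \sum_z G x y z + \sum_x \sum_y \sum_z H x y z.
  rewrite -big_split; apply: eq_bigr => x _; rewrite -big_split; apply: eq_bigr => y _.
  by rewrite -big_split.
have sum3Z a (G : T -> T -> T -> R) :
    \sum_x \sum_y \sum_z a * G x y z = a * \sum_x \sum_y \sum_z G x y z.
  rewrite mulr_sumr; apply: eq_bigr => x _; rewrite mulr_sumr; apply: eq_bigr => y _.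
  by rewrite mulr_sumr.
rewrite !sum3D !sum3Z in le.
have cF : c * N ^+ 3 * \sum_s1 \sum_s2 \sum_s3 (F s1 s2 (inv s3))%:R <= c * N ^+ 5.
  rewrite (exprD N 3 2) mulrA; apply: ler_wpM2l FN.
  by rewrite mulr_ge0 ?exprn_ge0 // ltW.
have e5 : c * N * N ^+ 4 = c * N ^+ 5 by rewrite (exprS N 4) mulrA.
rewrite {}e5 in b1.
have b2 : \sum_x \sum_y \sum_z (B y)%:R * weight y z x <= c * N ^+ 5.
  apply: le_trans b1; rewrite le_eqVlt; apply/orP; left; apply/eqP.
  exact: (sum_rot (fun x y z => (B x)%:R * weight x y z)).
have b3 : \sum_x \sum_y \sum_z (B z)%:R * weight z x y <= c * N ^+ 5.
  apply: le_trans b2; rewrite le_eqVlt; apply/orP; left; apply/eqP.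
  exact: (sum_rot (fun x y z => (B y)%:R * weight y z x)).
have n3 : 0 < N ^+ 3 by rewrite exprn_gt0.
rewrite -(ler_pM2l n3); have := le_trans many le; move: cF b1 b2 b3.
set X := N ^+ 3 * \sum_s1 \sum_s2 \sum_s3 (nice_face s1 s2 s3)%:R.
move=> cF b1 b2 b3 le2; apply: le_trans (_ : dl ^+ height * N ^+ 5 - 4 * (c * N ^+ 5) <= _).
  have -> : N ^+ 3 * (dl ^+ height.+1 * N ^+ 2) = dl ^+ height * dl * N ^+ 5.
    by rewrite (exprSr dl height); move: N (dl ^+ height) => x z; ring.
  have -> : c = dl ^+ height * dl ^+ 2 by rewrite /c -addn2 exprD.
  have h0 : 0 < dl ^+ height * N ^+ 5 by rewrite mulr_gt0 ?exprn_gt0.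
  move: (dl ^+ height) (N ^+ 5) h0 => x z h0.
  have -> : x * dl * z = x * z * dl by ring.
  have -> : x * dl ^+ 2 * z = x * z * dl ^+ 2 by ring.
  have le1 : 0 <= 1 - 4 * dl ^+ 2 - dl by nra.
  rewrite -subr_ge0; have -> : x * z - 4 * (x * z * dl ^+ 2) - x * z * dl =
    x * z * (1 - 4 * dl ^+ 2 - dl) by ring.
  by rewrite mulr_ge0 // ltW.
move: le2 cF b1 b2 b3; move: X => X; lra.
Qed.

Hypothesis Tm_ge : (13 * g + 10 <= Tm)%N.

(** Octahedra are pairs of cones over one four-cycle. Dense faces give many cones, few of them over
    unpopular four-cycles, and each of the others pairs with every cone over its cycle. *)
Lemma many_nice_faces :
  dl ^+ (3 * g + 2) * N ^+ 2 <= \sum_x \sum_u \sum_h (F x u h)%:R ->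
  dl ^+ height.+1 * N ^+ 2 <= \sum_s1 \sum_s2 \sum_s3 (nice_face s1 s2 s3)%:R.
Proof.
move=> many; have n0 := N_gt0; have d0 := dl_gt0; have dl1 := dl_le.
apply: sum_nice_face; rewrite (sum_octa R invK F_swap F_flip F_rot).
have cones4 := sums_cones4_ge invK F_swap N_gt0 (ltW (dlX_gt0 _)) many.
have t4 : (g < 13 * g + 10 <= Tm)%N by lia.
have d4 : (1 < 4 < L + 4)%N by lia.
have few := stars d4 t4.
(* There are at least [dl ^+ (12 * g + 8) * N ^+ 4] cones. At this threshold the unpopular ones have
   density at most [dl ^+ (12 * g + 9)], and the exponents [13 * g + 10] and [12 * g + 9] add up to
   [height]. *)
pose th := dl ^+ (13 * g + 10) * N.
have th0 : 0 < th by rewrite mulr_gt0 ?dlX_gt0.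
apply: le_trans (_ : th * (sums 4 (cones R F) - sums 4 (fun V =>
    cones R F V * (cones R F V < th)%R%:R)) <= _).
  apply: le_trans (_ : th * (dl ^+ (12 * g + 9) * N ^+ 4) <= _).
    rewrite le_eqVlt; apply/orP; left; apply/eqP.
    have -> : height = (13 * g + 10 + (12 * g + 9))%N by rewrite /height; lia.
    by rewrite exprD /th; move: N (dl ^+ _) (dl ^+ _) => x z w; ring.
  rewrite ler_pM2l // lerBrDr; apply: le_trans cones4; apply: le_trans (lerD (lexx _) few) _.
  have -> : (13 * g + 10 - g.+1 = 12 * g + 8 + 1)%N by lia.
  have -> : (12 * g + 9 = 12 * g + 8 + 1)%N by lia.
  rewrite -exprM (_ : (3 * g + 2) * 4 = 12 * g + 8)%N; last by lia.
  rewrite exprD expr1 -mulrDl; apply: ler_wpM2r; first by rewrite exprn_ge0 // ltW.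
  have := dlX_gt0 (12 * g + 8); move: (dl ^+ _) => z z0; nra.
rewrite mulrBr -!sumsZ lerBlDr -sumsD; apply: le_sums => V _.
have := cones_ge0 R F V; move: (cones R F V) => x x0.
by rewrite expr2; case: ltP => xth; rewrite ?mulr1 ?mulr0 ?addr0; nra.
Qed.

Lemma nice_face_degree x (Q : pred T) :
  (forall y, Q y -> exists s j, (s <= S)%N /\
     disc (fun a b c => nice_face a b c) s j [:: x; inv y]) ->
  #|Q|%:R * dl ^+ expo S <= (S.+1 * L ^ 3)%:R.
Proof.
move=> Qd; have n0 := N_gt0; have d0 := dl_gt0; have dl1 := dl_le.
have expo_le s t : (s <= t)%N -> (expo s <= expo t)%N.
  by move=> st; rewrite leq_mul2l leq_exp2l //; apply/orP; right; lia.
apply: (@disc_degree R A F Fdet1 Fdet2 Fdet3 N_gt0 K (dumbbell_ge0 R inv F)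
  (dumbbell_unitl inv Fdet1 Fdet2 Fdet3 N_gt0) (dumbbell_unitr inv Fdet1 Fdet2 Fdet3 N_gt0)
  (fun a b c => nice_face a b c) S (fun s => dl ^+ expo s) loss gain _ _ _ _ _ _ _ x Q Qd).
- exact: F_rot.
- move=> a b c /and5P[_ o _ _ _]; rewrite popularity_face_kernel // /expo expn0 muln1.
  by rewrite mulrC ler_pdivlMr ?exprn_gt0.
- move=> a b c /and5P[_ _ ga gb gc] x' xin s sS.
  have /andP[/forallP/(_ (Ordinal sS))/forallP gx _] : two_good x'.
    by move: xin; rewrite !inE => /or3P[] /eqP->.
  split=> [m mL|]; last exact: (gx None).
  exact: (gx (Some (Ordinal mL))).
- by move=> s; rewrite ltW ?dlX_gt0 //= -(expr0 dl) dlX_le.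
- by move=> s t st; apply: dlX_le; apply: expo_le.
- move=> s; rewrite /gain /merge_gam.
  by rewrite divr_ge0 ?ler0n // mulr_ge0 ?fold_gam_ge0 // ltW // dlX_gt0.
move=> s sS; have sS1 : (s < S)%N by lia.
(* One factor [dl] absorbs the number of possible last steps, by [S_dl]. *)
apply: le_trans (_ : dl ^+ (expo s.+1).-1 <= _).
  have e0 : (0 < expo s.+1)%N by rewrite muln_gt0 expn_gt0.
  rewrite -{1}(prednK e0) exprS mulrA; apply: ler_piMl; first by rewrite ltW // dlX_gt0.
  apply: le_trans S_dl; apply: ler_wpM2r; first exact: ltW.
  rewrite ler_nat !card_prod card_sum !card_prod !card_ord.
  have : (L ^ 3 <= (L + 4) ^ 3)%N by rewrite leq_exp2r // leq_addr.
  rewrite !expnS !expn0 !muln1; move: L (L + 4)%N => l l4; nia.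
apply: le_trans (_ : dl ^+ (15 * level s + 40 + 3 * g) * dl ^+ (2 * expo s).+1 <= _).
  rewrite -exprD dlX_le //.
  have -> : expo s.+1 = (64 * expo s)%N.
    by rewrite /expo /=; case: s sS {sS1} => // s _; rewrite /= expnS; lia.
  have : (height.+2 <= expo s)%N by rewrite leq_pmulr // expn_gt0.
  by rewrite /level /height; lia.
apply: ler_pM; [exact: ltW (dlX_gt0 _)|exact: ltW (dlX_gt0 _)|exact: merge_gam_ge (level_le sS1)|].
rewrite /loss exprS mulnC exprM; have := dlX_gt0 (expo s); move: (dl ^+ _) => z z0.
nra.
Qed.

End Spread.

Section DenseFaces.
Variables (R : realFieldType) (A : finType).
Local Notation T := (A * bool)%type.
Local Notation inv := (@linv A).
Variable F : T -> T -> T -> bool.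
Variables (cl : T -> 'I_3) (sg : T -> bool).
Hypothesis F_swap : forall g u h, F g u h -> F h (inv u) g.
Hypothesis F_flip : forall g u h, F g u h -> F (inv g) h u.
Hypothesis Fdet1 : forall a a' u h, F a u h -> F a' u h -> a = a'.
Hypothesis Fdet2 : forall a u u' h, F a u h -> F a u' h -> u = u'.
Hypothesis Fdet3 : forall a u h h', F a u h -> F a u h' -> h = h'.
Hypothesis F_sg : forall g u h, F g u h -> sg g != sg h.
Hypothesis F_cl : forall g u h, F g u h -> cl g = cl h.
Hypothesis F_corners : forall g u h, F g u h ->
  [/\ cl g != cl (inv g), cl g != cl (inv h) & cl (inv g) != cl (inv h)].
Local Notation N := (#|{: T}|%:R : R).
Hypothesis N_gt0 : 0 < N.
Let invK : involutive inv := @linvK A.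

Variables (dl : R) (S : nat).
Local Notation L := (7 * S).+1.
Hypothesis dl_gt0 : 0 < dl.
Hypothesis dl_le : dl <= 16^-1.
Hypothesis S_dl : (2 * (S.+1 * (L + 4) ^ 3))%:R * dl <= 1.
Hypothesis S_gt0 : (0 < S)%N.

(* With [g] random shifts per corner and popularity threshold [dl ^+ g], the
   unpopular stars have density about [dl ^+ (g ^ 2)]; this beats the losses, which
   are of order [g * 64 ^ S] in the exponent. *)
Definition branching := (16 * 64 ^ S)%N.
Local Notation g := branching.

(** The faces surviving the shifts satisfy the hypotheses of the preceding section. The exponents of
    density and degree are at most [27 * g * 64 ^ S.-1], while [g = 1024 * 64 ^ S.-1], so
    [dl ^+ (g ^ 2)] serves for both. *)
Lemma dense_faces :
  dl * N ^+ 2 <= \sum_x \sum_u \sum_h [&& F x u h,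
    dl * N ^+ 3 <= \sum_t (movable F t x h)%:R,
    dl * N ^+ 3 <= \sum_t (movable F t (inv x) u)%:R &
    dl * N ^+ 3 <= \sum_t (movable F t (inv h) (inv u))%:R]%R%:R ->
  exists P : T -> T -> T -> bool, [/\ forall a b c, P a b c -> F a b (inv c),
    forall a b c, P a b c -> P b c a,
    forall a b c, P a b c -> P (inv c) (inv b) (inv a),
    dl ^+ (g ^ 2)%N * N ^+ 2 <= \sum_a \sum_b \sum_c (P a b c)%:R &
    forall x (Q : pred T), (forall y, Q y -> exists s j, (s <= S)%N /\
        disc (fun a b c => P a b c) s j [:: x; inv y]) ->
      #|Q|%:R * dl ^+ (g ^ 2)%N <= (S.+1 * L ^ 3)%:R].
Proof.
move=> many; have D0 : (0 < L + 4)%N by lia.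
have dX k : 0 < dl ^+ k by rewrite exprn_gt0.
have dXl j k : (j <= k)%N -> dl ^+ k <= dl ^+ j.
  by apply: ler_wiXn2l; [exact: ltW | have := dl_le; lra].
have [tau [dense few]] := exists_subface Fdet1 Fdet2 Fdet3 F_sg F_cl F_corners g
  N_gt0 dl_gt0 dl_gt0 (dX g) D0 many.
pose F' := subface inv F cl tau.
have F'F a b c : F' a b c -> F a b c by exact: subface_F.
have sw := @subface_swap _ _ _ _ invK F_swap F_cl _ tau.
have fl := @subface_flip _ _ _ _ invK F_swap F_flip F_cl _ tau.
have d1 a a' u h : F' a u h -> F' a' u h -> a = a' by move=> /F'F + /F'F; apply: Fdet1.
have d2 a u u' h : F' a u h -> F' a u' h -> u = u' by move=> /F'F + /F'F; apply: Fdet2.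
have d3 a u h h' : F' a u h -> F' a u h' -> h = h' by move=> /F'F + /F'F; apply: Fdet3.
have [z [z0 zS gz]] : exists z, [/\ (0 < z)%N, (64 ^ S.-1 = z)%N & g = (1024 * z)%N].
  exists (64 ^ S.-1)%N; split; rewrite ?expn_gt0 //.
  by rewrite /branching -(prednK S_gt0) expnS /=; lia.
(* For [t <= Tm], the surviving unpopular stars and the term [dl ^+ t / dl ^+ g] of [star_bound]
   both have density at most [dl ^+ (t - g)]; their sum is below [dl ^+ (t - g.+1)]. *)
pose Tm := (g ^ 2 - 2 * g - 2)%N.
have stars t d : (1 < d < L + 4)%N -> (g < t <= Tm)%N ->
    sums d (fun V => cones R F' V * (cones R F' V < dl ^+ t * N)%R%:R) <=
    dl ^+ (t - g.+1) * N ^+ d.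
  move=> d4 /andP[gt tT]; have /andP[/ltnW dpos _] := d4.
  under eq_sums => V sV do rewrite /cones sV.
  apply: le_trans (star_bound Fdet2 Fdet3 dpos (ltW (dX t)) (dX g) (few d d4)) _.
  apply: ler_wpM2r; first by rewrite exprn_ge0 // ltW.
  have [t' et] : exists t', t = (g + t').+1 by exists (t - g.+1)%N; lia.
  have -> : (t - g.+1 = t')%N by lia.
  have t'2 : (t' + (3 * g + 3) <= g * g)%N by move: tT; rewrite /Tm et expnS expn1; lia.
  have -> : dl ^+ t / dl ^+ g = dl * dl ^+ t'.
    by rewrite et -addnS exprD mulrC mulKf ?gt_eqF // exprS.
  have -> : dl ^+ g ^+ g = dl * (dl * dl ^+ (3 * g)) * dl ^+ (g * g - (3 * g + 2)).
    by rewrite -exprM -!exprS -exprD; congr (_ ^+ _); lia.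
  have le1 : dl ^+ (g * g - (3 * g + 2)) <= dl * dl ^+ t' by rewrite -exprS dXl //; lia.
  have le2 : 2 * (L + 4)%:R * dl <= 1.
    apply: le_trans S_dl; apply: ler_wpM2r; first exact: ltW.
    rewrite -natrM ler_nat; have : (L + 4 <= (L + 4) ^ 3)%N
      by rewrite expnS leq_pmulr ?expn_gt0 ?addnS.
    by move: (L + 4)%N ((L + 4) ^ 3)%N => x y; nia.
  have := dX t'; have := dX (3 * g)%N; move: (dl ^+ (3 * g)) le1 le2 => w.
  move: (dl ^+ (g * g - _)) (dl ^+ t') => x y le1; have := dl_le; have := dl_gt0.
  have : 0 <= (L + 4)%:R :> R by rewrite ler0n.
  move: ((L + 4)%:R : R) => l l0 dl0 dl1 le2 w0 y0.
  have -> : 2 * l * (dl * (dl * w) * x) / (dl * w) = 2 * l * dl * x.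
    by field; rewrite !gt_eqF.
  have dy0 : 0 < dl * y by rewrite mulr_gt0.
  have : 2 * l * dl * x <= dl * y.
    have l1 : 0 <= 2 * l * dl by rewrite !mulr_ge0 // ltW.
    apply: le_trans (ler_wpM2l l1 le1) _; rewrite ler_piMl // ltW //.
  by nra.
have many' : dl ^+ (3 * g + 2) * N ^+ 2 <= \sum_x \sum_u \sum_h (F' x u h)%:R.
  apply: le_trans dense; apply: ler_wpM2r; first by rewrite exprn_ge0 // ltW.
  have -> : dl * dl ^+ (3 * g) / 2 = dl ^+ (3 * g).+1 / 2 by rewrite exprS.
  have := dX (3 * g).+1; rewrite addn2 [dl ^+ (3 * g).+2]exprS.
  move: (dl ^+ (3 * g).+1) => w w0; have := dl_le; have := dl_gt0; nra.
have g2 : (g ^ 2 = 1024 * z * g)%N by rewrite expnS expn1 -gz.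
have le_g2 j : (26 * g * z + j <= g ^ 2)%N -> dl ^+ (g ^ 2) <= dl ^+ j.
  by move=> jg; apply: dXl; apply: leq_trans jg; apply: leq_addl.
have expoS : (expo g S <= 27 * g * z)%N.
  rewrite /expo zS leq_mul2r; apply/orP; right; rewrite /height; lia.
have height_le : (height g <= 26 * g)%N by rewrite /height; lia.
have lev s : (s < S)%N -> (8 * level g s + 23 + 2 * g <= Tm)%N.
  move=> sS; have : (expo g s <= 27 * g * z)%N.
    apply: leq_trans expoS; rewrite leq_mul2l leq_exp2l //; apply/orP; right; lia.
  by rewrite /level /Tm; nia.
have tm : (13 * g + 10 <= Tm)%N by rewrite /Tm; nia.
exists (nice_face F' dl S g); split.
- by move=> a b c /and5P[/F'F].
- exact: (nice_rot sw fl).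
- exact: (nice_inv sw fl).
- apply: le_trans (_ : dl ^+ (height g).+1 * N ^+ 2 <= _).
    apply: ler_wpM2r; first by rewrite exprn_ge0 // ltW.
    by apply: dXl; nia.
  exact: (many_nice_faces sw fl d1 d2 d3 N_gt0 dl_gt0 dl_le S_dl S_gt0 stars lev tm many').
move=> x Q Qd; apply: le_trans (_ : #|Q|%:R * dl ^+ expo g S <= _).
  by apply: ler_wpM2l; [rewrite ler0n | apply: dXl; nia].
exact: (nice_face_degree sw fl d1 d2 d3 N_gt0 dl_gt0 dl_le S_dl S_gt0 lev tm Qd).
Qed.

End DenseFaces.

(** * Partial Latin squares far from groups *)

Lemma sum_natr_card (R : pzSemiRingType) (I : finType) (P : pred I) :
  \sum_i (P i)%:R = #|P|%:R :> R.
Proof.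
rewrite -sum1_card natr_sum [RHS]big_mkcond; apply: eq_bigr => i _.
by rewrite -[i \in P]/(P i); case: (P i).
Qed.

Section Latin.
Variables (X Y Z : finType) (E : {set X * Y}) (lam : X * Y -> Z).
Hypothesis latin : partial_latin_square E lam.
Local Notation A := (X + Y + Z)%type.
Local Notation T := (A * bool)%type.
Local Notation inv := (@linv A).

Definition row_letter (x : X) : T := (inl (inl x), true).
Definition col_letter (y : Y) : T := (inl (inr y), true).
(** The positive letter stands for [z^-1], so a face is a product of three positive letters and its
    inverse a product of three negative ones. Accordingly [latin_metric] represents [z] by the
    negative letter. *)
Definition sym_letter (z : Z) : T := (inr z, true).

Definition cell x y z := ((x, y) \in E) && (lam (x, y) == z).

Definition latin_face (a b c : T) : bool :=
  match a, b, c with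
  | (inl (inl x), true), (inl (inr y), true), (inr z, true)
  | (inl (inr y), true), (inr z, true), (inl (inl x), true)
  | (inr z, true), (inl (inl x), true), (inl (inr y), true)
  | (inr z, false), (inl (inr y), false), (inl (inl x), false)
  | (inl (inr y), false), (inl (inl x), false), (inr z, false)
  | (inl (inl x), false), (inr z, false), (inl (inr y), false) => cell x y z
  | _, _, _ => false
  end.

Lemma cell_sym x y z z' : cell x y z -> cell x y z' -> z = z'.
Proof. by move=> /andP[_ /eqP<-] /andP[_ /eqP]. Qed.

Lemma cell_col x y y' z : cell x y z -> cell x y' z -> y = y'.
Proof.
move=> /andP[E1 /eqP l1] /andP[E2 /eqP l2].
by apply: (latin.1 _ _ _ E1 E2); rewrite l1 l2.
Qed.

Lemma cell_row x x' y z : cell x y z -> cell x' y z -> x = x'.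
Proof.
move=> /andP[E1 /eqP l1] /andP[E2 /eqP l2].
by apply: (latin.2 _ _ _ E1 E2); rewrite l1 l2.
Qed.

Lemma latin_face_rot a b c : latin_face a b c -> latin_face b c a.
Proof. by case: a => [[[x|y]|z] []]; case: b => [[[?|?]|?] []] //; case: c => [[[?|?]|?] []]. Qed.

Lemma latin_face_inv a b c :
  latin_face a b c -> latin_face (inv c) (inv b) (inv a).
Proof. by case: a => [[[x|y]|z] []]; case: b => [[[?|?]|?] []] //; case: c => [[[?|?]|?] []]. Qed.

Lemma latin_face_det a b c c' : latin_face a b c -> latin_face a b c' -> c = c'.
Proof.
case: a => [[[x|y]|z] []]; case: b => [[[?|?]|?] []] //; case: c => [[[?|?]|?] []] //;
  case: c' => [[[?|?]|?] []] //= c1 c2; congr (_, _); congr (inr _) || congr (inl (_ _));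
  (exact: cell_sym c1 c2) || (exact: cell_col c1 c2) || (exact: cell_row c1 c2).
Qed.

Definition latin_step g u h := latin_face g u (inv h).

Lemma latin_swap g u h : latin_step g u h -> latin_step h (inv u) g.
Proof.
by move=> /latin_face_inv/latin_face_rot/latin_face_rot/latin_face_rot; rewrite linvK.
Qed.

Lemma latin_flip g u h : latin_step g u h -> latin_step (inv g) h u.
Proof. by move=> /latin_face_inv/latin_face_rot/latin_face_rot; rewrite linvK. Qed.

Lemma latin_det3 a u h h' : latin_step a u h -> latin_step a u h' -> h = h'.
Proof. by move=> s1 s2; rewrite -(linvK h) (latin_face_det s1 s2) linvK. Qed.

Lemma latin_det2 a u u' h : latin_step a u h -> latin_step a u' h -> u = u'.
Proof. by move=> /latin_flip s1 /latin_flip; apply: latin_det3 s1. Qed.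

Lemma latin_det1 a a' u h : latin_step a u h -> latin_step a' u h -> a = a'.
Proof. by move=> /latin_swap s1 /latin_swap; apply: latin_det3 s1. Qed.

(** Triangles have vertices 0, 1, 2: a row leads from 0 to 1, a column from 1 to 2, a symbol letter
    from 2 to 0. *)
Definition source (a : T) : 'I_3 :=
  match a with
  | (inl (inl _), true) | (inr _, false) => @Ordinal 3 0 isT
  | (inl (inr _), true) | (inl (inl _), false) => @Ordinal 3 1 isT
  | _ => @Ordinal 3 2 isT
  end.

Lemma latin_step_sg g u h : latin_step g u h -> g.2 != h.2.
Proof. by case: g => [[[x|y]|z] []]; case: u => [[[?|?]|?] []] //; case: h => [[[?|?]|?] []]. Qed.

Lemma latin_step_source g u h : latin_step g u h -> source g = source h.
Proof. by case: g => [[[x|y]|z] []]; case: u => [[[?|?]|?] []] //; case: h => [[[?|?]|?] []]. Qed.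

Lemma latin_step_corners g u h : latin_step g u h ->
  [/\ source g != source (inv g), source g != source (inv h)
    & source (inv g) != source (inv h)].
Proof. by case: g => [[[x|y]|z] []]; case: u => [[[?|?]|?] []] //; case: h => [[[?|?]|?] []]. Qed.

Lemma latin_face_sign a b c : latin_face a b c -> a.2 = b.2 /\ b.2 = c.2.
Proof. by case: a => [[[x|y]|z] []]; case: b => [[[?|?]|?] []] //; case: c => [[[?|?]|?] []]. Qed.

Ltac merge_cells := repeat match goal with
  | c : is_true (cell ?x ?y ?z), d : is_true (cell ?x ?y ?z') |- _ =>
      tryif constr_eq z z' then fail else have ? := cell_sym c d; subst
  | c : is_true (cell ?x ?y ?z), d : is_true (cell ?x ?y' ?z) |- _ =>
      tryif constr_eq y y' then fail else have ? := cell_col c d; subst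
  | c : is_true (cell ?x ?y ?z), d : is_true (cell ?x' ?y ?z) |- _ =>
      tryif constr_eq x x' then fail else have ? := cell_row c d; subst
  end.

Local Notation rl := row_letter.
Local Notation cr := col_letter.
Local Notation sl := sym_letter.

Definition octahedra_at x1 y1 := [set o in octahedra E lam |
  let: (x, _, y, _, _, _, _, _) := o in (x == x1) && (y == y1)].

Local Notation movable := (movable latin_step).

Lemma cellE x y : (x, y) \in E -> cell x y (lam (x, y)).
Proof. by move=> xE; rewrite /cell xE eqxx. Qed.

Variant octahedron_spec x1 y1 : X * X * Y * Y * X * X * Y * Y -> Prop :=
  OctahedronSpec x2 y2 x3 x4 y3 y4 z12 z21 z22 of z12 = lam (x1, y2)
    & z21 = lam (x2, y1) & z22 = lam (x2, y2)
    & cell x1 y1 (lam (x1, y1)) & cell x2 y1 z21 & cell x1 y2 z12 & cell x2 y2 z22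
    & cell x3 y3 (lam (x1, y1)) & cell x4 y3 z21 & cell x3 y4 z12 & cell x4 y4 z22 :
  octahedron_spec x1 y1 (x1, x2, y1, y2, x3, x4, y3, y4).

Lemma octahedra_atP x1 y1 p : p \in octahedra_at x1 y1 -> octahedron_spec x1 y1 p.
Proof.
case: p => [[[[[[[a1 x2] b1] y2] x3] x4] y3] y4]; rewrite [_ \in _]finset.in_set.
move=> /andP[+ /andP[/eqP ea /eqP eb]]; subst a1 b1; rewrite inE /octahedron.
move=> /and5P[e1 e2 e3 e4 /and5P[e5 e6 e7 e8 /and4P[/eqP l1 /eqP l2 /eqP l3 /eqP l4]]].
by constructor 1 with (lam (x1, y2)) (lam (x2, y1)) (lam (x2, y2)); rewrite // /cell
  ?(e1, e2, e3, e4, e5, e6, e7, e8) ?(l1, l2, l3, l4) eqxx.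
Qed.

Lemma card_movable_ge (I : finType) (B : {set I}) (f : I -> T * T * T) g h :
  {in B &, injective f} -> (forall o, o \in B -> movable (f o) g h) ->
  forall R : realFieldType, #|B|%:R <= \sum_t (movable t g h)%:R :> R.
Proof.
move=> inj mov R; rewrite -(card_in_imset inj).
have -> : \sum_t (movable t g h)%:R = #|[set t | movable t g h]|%:R :> R.
  by rewrite sum_natr_card; congr (_%:R); apply: eq_card => t; rewrite inE.
rewrite ler_nat subset_leq_card //; apply/fintype.subsetP => t /imsetP[q qB ->].
by rewrite inE mov.
Qed.

Lemma movable_witness t g h u u0 l0 v w g' h' :
  latin_step g u h -> latin_step g' u h' ->
  latin_step t.1.1 u0 t.1.2 -> latin_step t.2 u0 l0 ->
  (latin_step t.1.2 v g /\ latin_step l0 v g') \/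
    (latin_step t.1.1 v g /\ latin_step t.2 v g') ->
  (latin_step t.1.2 w h /\ latin_step l0 w h') \/
    (latin_step t.1.1 w h /\ latin_step t.2 w h') ->
  movable t g h.
Proof.
move=> f1 f2 f3 f4 m1 m2; apply/existsP; exists u; apply/existsP; exists g'.
apply/existsP; exists h'; rewrite f1 f2 /=; apply/andP; split.
  apply/existsP; exists u0; apply/existsP; exists l0; rewrite f3 f4 /=.
  case: m1 => -[a b]; apply/orP; [left | right]; apply/existsP; exists v; exact/andP.
apply/existsP; exists u0; apply/existsP; exists l0; rewrite f3 f4 /=.
case: m2 => -[a b]; apply/orP; [left | right]; apply/existsP; exists w; exact/andP.
Qed.

(** At each corner of the triangle, an octahedron contains this corner and its antipode as two hubs
    over one four-cycle. The shift is read off the side of the cycle opposite to the triangle, and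
    its three letters determine the octahedron. *)
Lemma octahedra_movable (R : realFieldType) x1 y1 :
  let z := lam (x1, y1) in let c : R := #|octahedra_at x1 y1|%:R in
  [/\ c <= \sum_t (movable t (rl x1) (inv (sl z)))%:R,
      c <= \sum_t (movable t (inv (rl x1)) (cr y1))%:R &
      c <= \sum_t (movable t (sl z) (inv (cr y1)))%:R].
Proof.
split.
- pose f (o : X * X * Y * Y * X * X * Y * Y) :=
    let: (_, _, _, y2, x3, x4, _, _) := o in
    (rl x3, inv (sl (lam (x1, y2))), rl x4).
  apply: (@card_movable_ge _ _ f).
    move=> _ _ /octahedra_atP[x2 y2 x3 x4 y3 y4 z12 z21 z22 e12 e21 e22 ? ? ? ? ? ? ? ?]
    /octahedra_atP[x2' y2' x3' x4' y3' y4' z12' z21' z22' e12' e21' e22' ? ? ? ? ? ? ? ?].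
    rewrite /f /= -e12 -e12' => -[ex ez ex'].
    clear e12 e12' e21 e21' e22 e22'; subst z12' x3' x4'.
    by merge_cells.
  move=> _ /octahedra_atP[x2 y2 x3 x4 y3 y4 z12 z21 z22 e12 e21 e22 c1 c2 c3 c4 c5 c6 c7 c8].
  rewrite /f -e12.
  by apply: (@movable_witness _ _ _ (cr y1) (cr y4) (inv (sl z22)) (inv (cr y2)) (cr y3)
    (rl x2) (inv (sl z21))) => //; [left | right].
- pose f (o : X * X * Y * Y * X * X * Y * Y) :=
    let: (_, x2, _, y2, _, x4, _, _) := o in (inv (rl x2), cr y2, inv (rl x4)).
  apply: (@card_movable_ge _ _ f).
    move=> _ _ /octahedra_atP[x2 y2 x3 x4 y3 y4 z12 z21 z22 e12 e21 e22 ? ? ? ? ? ? ? ?]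
    /octahedra_atP[x2' y2' x3' x4' y3' y4' z12' z21' z22' e12' e21' e22' ? ? ? ? ? ? ? ?].
    rewrite /f /= => -[ex ey ex'].
    clear e12 e12' e21 e21' e22 e22'; subst x2' y2' x4'.
    by merge_cells.
  move=> _ /octahedra_atP[x2 y2 x3 x4 y3 y4 z12 z21 z22 e12 e21 e22 c1 c2 c3 c4 c5 c6 c7 c8].
  rewrite /f.
  by apply: (@movable_witness _ _ _ (inv (sl (lam (x1, y1)))) (inv (sl z22)) (cr y4)
    (sl z12) (inv (sl z21)) (inv (rl x3)) (cr y3)) => //; [left | right].
pose f (o : X * X * Y * Y * X * X * Y * Y) :=
  let: (_, x2, _, _, _, _, y3, y4) := o in
  (inv (cr y3), sl (lam (x2, y1)), inv (cr y4)).
apply: (@card_movable_ge _ _ f).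
  move=> _ _ /octahedra_atP[x2 y2 x3 x4 y3 y4 z12 z21 z22 e12 e21 e22 ? ? ? ? ? ? ? ?]
    /octahedra_atP[x2' y2' x3' x4' y3' y4' z12' z21' z22' e12' e21' e22' ? ? ? ? ? ? ? ?].
  rewrite /f /= -e21 -e21' => -[ey ez ey'].
  clear e12 e12' e21 e21' e22 e22'; subst z21' y3' y4'.
  by merge_cells.
move=> _ /octahedra_atP[x2 y2 x3 x4 y3 y4 z12 z21 z22 e12 e21 e22 c1 c2 c3 c4 c5 c6 c7 c8].
rewrite /f -e21.
by apply: (@movable_witness _ _ _ (rl x1) (inv (rl x4)) (sl z22) (inv (rl x3)) (rl x2)
  (sl z12) (inv (cr y2))) => //; [right | left].
Qed.

Lemma card_octahedra_at x1 y1 : (#|octahedra_at x1 y1| <= #|X| * #|Y| * #|X|)%N.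
Proof.
pose f (o : X * X * Y * Y * X * X * Y * Y) :=
  let: (_, x2, _, y2, _, x4, _, _) := o in (x2, y2, x4).
suff inj : {in octahedra_at x1 y1 &, injective f}.
  by rewrite -(card_in_imset inj) -!card_prod max_card.
move=> _ _ /octahedra_atP[x2 y2 x3 x4 y3 y4 z12 z21 z22 e12 e21 e22 ? ? ? ? ? ? ? ?]
    /octahedra_atP[x2' y2' x3' x4' y3' y4' z12' z21' z22' e12' e21' e22' ? ? ? ? ? ? ? ?].
rewrite /f /= => -[ex ey ex'].
clear e12 e12' e21 e21' e22 e22'; subst x2' y2' x4'.
by merge_cells.
Qed.

(** A cell meeting the base triangle in a vertex only, together with the symbol of [(x2, y2)]. They
    determine the octahedron and form the triples counted by [completes]. *)
Definition opposite_cell (p : X * X * Y * Y * X * X * Y * Y) :=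
  let: (_, x2, _, y2, _, x4, y3, _) := p in (x4, y3, lam (x2, y2)).

Lemma opposite_cell_inj x1 y1 : {in octahedra_at x1 y1 &, injective opposite_cell}.
Proof.
move=> _ _ /octahedra_atP[x2 y2 x3 x4 y3 y4 z12 z21 z22 e12 e21 e22 ? ? ? ? ? ? ? ?]
  /octahedra_atP[x2' y2' x3' x4' y3' y4' z12' z21' z22' e12' e21' e22' ? ? ? ? ? ? ? ?].
rewrite /= -e22 -e22' => -[ex ey ez].
clear e12 e12' e21 e21' e22 e22'; subst z22' x4' y3'.
by merge_cells.
Qed.

Lemma octahedra_at_E x1 y1 : (x1, y1) \notin E -> octahedra_at x1 y1 = finset.set0.
Proof.
move=> nE; apply/finset.setP => p; rewrite [RHS]inE; apply/negP.
by move=> /octahedra_atP[? ? ? ? ? ? ? ? ? _ _ _ /andP[xyE _]]; rewrite xyE in nE.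
Qed.

Lemma sum_octahedra_at :
  #|octahedra E lam| = \sum_x \sum_y #|octahedra_at x y|.
Proof.
rewrite pair_bigA /= -sum1_card.
rewrite (partition_big (fun o : X * X * Y * Y * X * X * Y * Y =>
  let: (x, _, y, _, _, _, _, _) := o in (x, y)) xpredT) //=.
apply: eq_bigr => -[x1 y1] _; rewrite -sum1_card; apply: eq_bigl => o.
rewrite [in RHS]inE; congr (_ && _).
by case: o => [[[[[[[a1 a2] b1] b2] a3] a4] b3] b4].
Qed.

End Latin.

Lemma card_letters (X Y Z : finType) n : #|X| = n -> #|Y| = n -> #|Z| = n ->
  #|{: (X + Y + Z) * bool}| = (6 * n)%N.
Proof. by rewrite card_prod !card_sum card_bool => -> -> ->; lia. Qed.

Section LatinDense.
Variables (R : realFieldType) (X Y Z : finType) (E : {set X * Y}) (lam : X * Y -> Z).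
Hypothesis latin : partial_latin_square E lam.
Variables (n : nat) (eps dl : R).
Hypotheses (cardX : #|X| = n) (cardY : #|Y| = n) (cardZ : #|Z| = n).
Hypothesis n_gt0 : (0 < n)%N.
Hypothesis many_octahedra : eps * n%:R ^+ 5 <= #|octahedra E lam|%:R.
Local Notation A := (X + Y + Z)%type.
Local Notation T := (A * bool)%type.
Local Notation inv := (@linv A).
Local Notation F := (latin_step E lam).
Local Notation N := (#|{: T}|%:R : R).

Lemma sum_natr_card3 (I : finType) (P : I -> I -> I -> bool) :
  \sum_a \sum_b \sum_c (P a b c)%:R =
  #|[set t : I * I * I | P t.1.1 t.1.2 t.2]|%:R :> R.
Proof.
rewrite (sum_triple (fun t => (P t.1.1 t.1.2 t.2)%:R)) sum_natr_card.
by congr (_%:R); apply: eq_card => t; rewrite inE.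
Qed.

Definition rich := [set p : X * Y | (p \in E) &&
  (eps / 2 * n%:R ^+ 3 <= #|octahedra_at E lam p.1 p.2|%:R)].

Lemma card_rich : 0 <= eps -> eps / 2 * n%:R ^+ 2 <= #|rich|%:R.
Proof.
move=> eps0; have n0 : 0 < n%:R :> R by rewrite ltr0n.
have n3 : 0 < n%:R ^+ 3 :> R by rewrite exprn_gt0.
have le : eps * n%:R ^+ 5 <= n%:R ^+ 3 * #|rich|%:R + eps / 2 * n%:R ^+ 5.
  have p3 : 0 <= eps / 2 * n%:R ^+ 3 by rewrite mulr_ge0 ?divr_ge0 ?exprn_ge0 ?ler0n.
  apply: le_trans many_octahedra _; rewrite (sum_octahedra_at E lam) natr_sum.
  under eq_bigr => x _ do rewrite natr_sum.
  rewrite pair_bigA /=; apply: le_trans (_ : \sum_(p : X * Y)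
    (n%:R ^+ 3 * (p \in rich)%:R + eps / 2 * n%:R ^+ 3) <= _).
    apply: ler_sum => p _; rewrite inE; case: (boolP (p \in E)) => [pE|npE]; last first.
      rewrite octahedra_at_E ?cards0; last by case: p npE.
      by rewrite mulr0 add0r.
    case: (leP (eps / 2 * _) #|octahedra_at E lam p.1 p.2|%:R) => [_|/ltW le];
      rewrite /= ?mulr0 ?add0r // mulr1.
    rewrite -[X in X <= _]addr0; apply: lerD => //.
    rewrite -natrX ler_nat; apply: leq_trans (card_octahedra_at latin _ _) _.
    by rewrite cardX cardY !expnS expn0 muln1 mulnA.
  rewrite big_split /= -mulr_sumr (sum_natr_card R (mem rich)) sumr_const card_prod.
  rewrite cardX cardY lerD2l -[X in X <= _]mulr_natl natrM le_eqVlt; apply/orP; left; apply/eqP.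
  by move: (n%:R : R) => x; field.
rewrite -(ler_pM2l n3); move: le; rewrite -(lerBlDr).
by move: (#|_|%:R) (n%:R : R) => x y; congr (_ <= _); field.
Qed.

Hypothesis dl_gt0 : 0 < dl.
Hypothesis dl_eps : 432 * dl <= eps.

Lemma many_movable :
  dl * N ^+ 2 <= \sum_x \sum_u \sum_h [&& F x u h,
    dl * N ^+ 3 <= \sum_t (movable F t x h)%:R,
    dl * N ^+ 3 <= \sum_t (movable F t (inv x) u)%:R &
    dl * N ^+ 3 <= \sum_t (movable F t (inv h) (inv u))%:R]%R%:R.
Proof.
have n0 : 0 < n%:R :> R by rewrite ltr0n.
have eps0 : 0 <= eps by have := dl_gt0; move: dl_eps; lra.
(* Here [N = 6 * n], so [216 * dl <= eps / 2] is needed; this is the origin of 432. *)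
have le3 : dl * N ^+ 3 <= eps / 2 * n%:R ^+ 3.
  rewrite (card_letters cardX cardY cardZ) natrM exprMn mulrA; apply: ler_wpM2r;
    first by rewrite exprn_ge0 // ltW.
  by move: dl_eps; lra.
apply: le_trans (_ : eps / 2 * n%:R ^+ 2 <= _).
  rewrite (card_letters cardX cardY cardZ) natrM exprMn mulrA; apply: ler_wpM2r;
    first by rewrite exprn_ge0 // ltW.
  by move: dl_eps dl_gt0; lra.
apply: le_trans (card_rich eps0) _.
rewrite (sum_natr_card3 (fun x u h => [&& F x u h, _ <= _, _ <= _ & _ <= _])) ler_nat.
pose f (p : X * Y) : T * T * T :=
  (row_letter Y Z p.1, col_letter X Z p.2, inv (sym_letter X Y (lam p))).
have inj : {in rich &, injective f}.
  by move=> [x y] [x' y'] _ _ [-> ->].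
rewrite -(card_in_imset inj) subset_leq_card //; apply/fintype.subsetP => _ /imsetP[[x y] + ->].
rewrite !inE /= => /andP[xyE rich_xy].
have [m1 m2 m3] := octahedra_movable latin R x y.
have le_rich := le_trans le3 rich_xy; apply/and4P; split.
- by rewrite /latin_step /= cellE.
- exact: le_trans m1.
- exact: le_trans m2.
- exact: le_trans m3.
Qed.

End LatinDense.

(** * The area metric on a free group *)

Section AreaMetric.
Variables (R : realType) (A : choiceType) (b : nat).
Variable face : A * bool -> A * bool -> A * bool -> Prop.
Hypothesis b_gt0 : (0 < b)%N.
Hypothesis face_inv : forall a b c,
  face a b c -> face (linv c) (linv b) (linv a).
Local Notation G := (free_group A).
Implicit Types g h k : G.

Definition area_norm g : \bar R :=
  if pselect (exists n, `[< area face n g >]) is left ex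
  then ((ex_minn ex)%:R / b%:R)%:E else +oo%E.

Lemma area_norm_le n g : area face n g -> (area_norm g <= (n%:R / b%:R)%:E)%E.
Proof.
move=> ag; rewrite /area_norm; case: pselect => [ex|[]]; last by exists n; apply/asboolP.
case: ex_minnP => m _ min; rewrite lee_fin ler_pM2r ?invr_gt0 ?ltr0n // ler_nat.
by apply: min; apply/asboolP.
Qed.

Lemma area_normP g : area_norm g = +oo%E \/
  exists2 n, area face n g & area_norm g = (n%:R / b%:R)%:E.
Proof.
rewrite /area_norm; case: pselect => [ex|_]; [right | by left].
by case: ex_minnP => m /asboolP am _; exists m.
Qed.

Lemma area_norm_ge0 g : (0 <= area_norm g)%E.
Proof.
by case: (area_normP g) => [->|[n _ ->]] //; rewrite lee_fin divr_ge0 ?ler0n.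
Qed.

Lemma area_norm_mono g h : (forall n, area face n g -> area face n h) ->
  (area_norm h <= area_norm g)%E.
Proof.
move=> gh; case: (area_normP g) => [->|[n an ->]]; first exact: leey.
exact: area_norm_le (gh _ an).
Qed.

Definition area_dist g h := area_norm (g * h^-1)%g.

Lemma area_dist_metric : biinvariant_metric area_dist.
Proof.
split=> [g h|g h|g h|g h k|k g h|k g h]; rewrite /area_dist.
- exact: area_norm_ge0.
- split=> [|->]; last first.
    rewrite mulgV; apply/eqP; rewrite eq_le area_norm_ge0 andbT.
    by have := area_norm_le (area0 face); rewrite mul0r.
  case: (area_normP (g * h^-1)%g) => [->//|[n an ->]] [/eqP].
  rewrite mulf_eq0 invr_eq0 !pnatr_eq0 [b == 0%N]eqn0Ngt b_gt0 orbF.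
  move=> /eqP n0; rewrite {}n0 in an.
  by rewrite -[g]mulg1 -(mulVg h) mulgA (area0_eq1 an) mul1g.
- have e x y : (area_norm (x * y^-1)%g <= area_norm (y * x^-1)%g)%E.
    apply: area_norm_mono => n /(areaV face_inv).
    by rewrite invgM invgK.
  by apply/eqP; rewrite eq_le !e.
- have -> : (g * k^-1 = (g * h^-1) * (h * k^-1))%g by rewrite mulgA mulgVK.
  case: (area_normP (g * h^-1)%g) => [->|[n an ->]].
    by rewrite addye ?leey // gt_eqF // (lt_le_trans _ (area_norm_ge0 _)).
  case: (area_normP (h * k^-1)%g) => [->|[m am ->]]; first by rewrite leey.
  by rewrite -EFinD -mulrDl -natrD; apply: area_norm_le; apply: areaM.
- have e x y : (k * x * (k * y)^-1 = k * (x * y^-1) * k^-1)%g.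
    by rewrite invgM !mulgA.
  apply/eqP; rewrite eq_le e; apply/andP; split; apply: area_norm_mono => n.
    exact: areaJ.
  by move/(@areaJ _ _ _ _ k^-1%g); rewrite invgK -!mulgA mulVg mulg1 mulKg.
by rewrite invgM mulgA mulgK.
Qed.

Lemma area_separated (I : Type) (f : I -> G) :
  (forall x y n, x <> y -> area face n (f x * (f y)^-1)%g -> (b <= n)%N) ->
  one_separated_image area_dist f.
Proof.
move=> sep; split=> [x y exy|_ _ [x _ <-] [y _ <-] nxy].
  apply: contrapT => nxy; have := sep x y 0%N nxy; rewrite exy mulgV.
  by move=> /(_ (area0 face)); rewrite leqNgt b_gt0.
have nxy' : x <> y by move=> e; apply: nxy; rewrite e.
rewrite /area_dist; case: (area_normP (f x * (f y)^-1)%g) => [->|[n an ->]].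
  exact: leey.
by rewrite lee_fin ler_pdivlMr ?ltr0n // mul1r ler_nat; apply: sep nxy' an.
Qed.

End AreaMetric.

Section LatinMetric.
Variables (R : realType) (X Y Z : finType) (E : {set X * Y}) (lam : X * Y -> Z).
Variable b : nat.
Hypothesis b_gt0 : (0 < b)%N.
Local Notation L := (X + Y + Z)%type.
Local Notation T := (L * bool)%type.
Local Notation face := (fun a b c : T => latin_face E lam a b c).
Local Notation rl := (row_letter Y Z).
Local Notation cr := (col_letter X Z).
Local Notation sl := (sym_letter X Y).

Lemma latin_metric :
  (forall x x' n, x <> x' -> area face n (fg_of [:: rl x; linv (rl x')]) -> (b <= n)%N) ->
  (forall y y' n, y <> y' -> area face n (fg_of [:: cr y; linv (cr y')]) -> (b <= n)%N) ->
  (forall z z' n, z <> z' -> area face n (fg_of [:: linv (sl z); sl z']) -> (b <= n)%N) ->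
  exists (G : groupType) (d : G -> G -> \bar R)
         (phi : X -> G) (psi : Y -> G) (omega : Z -> G),
    [/\ biinvariant_metric d,
        [/\ one_separated_image d phi, one_separated_image d psi
          & one_separated_image d omega]
      & forall x y z, (x, y) \in E -> lam (x, y) = z ->
          (d (phi x * psi y)%g (omega z) <= (b%:R^-1)%:E)%E].
Proof.
move=> sepX sepY sepZ; have fi := @latin_face_inv _ _ _ E lam.
have inv1 s : (fg_of [:: s] : free_group L)^-1%g = fg_of [:: linv s].
  by rewrite -fgV.
exists (free_group L), (@area_dist R _ b face), (fun x => fg_of [:: rl x]),
  (fun y => fg_of [:: cr y]), (fun z => fg_of [:: linv (sl z)]).
split.
- exact: area_dist_metric.
- by split; apply: area_separated.
move=> x y z xyE xyz; rewrite /area_dist inv1 linvK -!fgM /=.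
have c : latin_face E lam (rl x) (cr y) (sl z) by rewrite /= /cell xyE xyz /=.
have := area_norm_le R b_gt0 (area1 (face := face) c).
by rewrite mul1r.
Qed.

End LatinMetric.

Lemma area_mono (A : choiceType) (face face' : A * bool -> A * bool -> A * bool -> Prop) n g :
  (forall a b c, face a b c -> face' a b c) -> area face n g -> area face' n g.
Proof.
move=> ff; elim=> {n g} [|n g h a b c _ IH /ff f]; [exact: area0 | exact: areaS].
Qed.

(** * Colouring the letters and numerical bounds *)

Lemma greedy_colouring (T : finType) (e : rel T) (D : nat) : symmetric e ->
  (forall x, (#|[pred y | e x y]| <= D)%N) ->
  exists col : T -> 'I_D.+1, forall x y, x <> y -> e x y -> col x <> col y.
Proof.
move=> sym deg.
suff [col colP] : exists col : T -> 'I_D.+1, {in enum T &, forall x y,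
    x <> y -> e x y -> col x <> col y}.
  by exists col => x y; apply: colP; rewrite mem_enum.
elim: (enum T) => [|a s [col colP]]; first by exists (fun=> ord0).
pose used := col @: [set y | e a y].
have [c cP] : exists c, c \notin used.
  apply/existsP; rewrite -negb_forall; apply/negP => /forallP all.
  have : (#|'I_D.+1| <= #|used|)%N.
    by apply: subset_leq_card; apply/fintype.subsetP => x _; apply: all.
  rewrite card_ord leqNgt ltnS; move/negP; apply; apply: leq_trans (deg a).
  by apply: leq_trans (leq_imset_card _ _) _; rewrite cardsE.
have new y : e a y -> c <> col y.
  by move=> ay ec; move: cP; rewrite ec imset_f // inE.
exists (fun x => if x == a then c else col x) => x y; rewrite !inE.
case: eqP => [->|_] /=; case: eqP => [->|_] //= xs ys nxy exy.
- exact: new.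
- by move=> ec; apply: (new x); rewrite // sym.
- exact: colP.
Qed.

Lemma popular_class (I C : finType) (B : {set I}) (f : I -> C) (c0 : C) :
  exists c, (#|B| <= #|C| * #|[set i in B | f i == c]|)%N.
Proof.
pose F c := #|[set i in B | f i == c]|.
case: (@arg_maxnP _ c0 xpredT F isT) => c _ max; exists c.
rewrite -sum_nat_const -sum1_card (partition_big f xpredT) //=.
apply: leq_sum => c' _; apply: leq_trans (max c' isT).
by rewrite sum1dep_card /F; apply: subset_leq_card; apply/fintype.subsetP => i; rewrite !inE.
Qed.

(** The equation forces [j] to be even and positive, hence [j >= 2]. *)
Lemma steps_ge s j m b : (b <= 2)%N -> (2 * s + 2 = 5 * j)%N -> (j <= m)%N -> (b <= m)%N.
Proof. lia. Qed.

Lemma steps_le s j k b S : (2 * s + 2 = 5 * j)%N -> (j <= k)%N -> (k < b)%N ->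
  (5 * b <= 2 * S + 8)%N -> (s <= S)%N.
Proof. lia. Qed.

Lemma cube_le S : ((S.+1 * (7 * S).+1 ^ 3).+1 <= 2 * (S.+1 * ((7 * S).+1 + 4) ^ 3))%N.
Proof.
have le : ((7 * S).+1 ^ 3 <= ((7 * S).+1 + 4) ^ 3)%N by rewrite leq_exp2r // leq_addr.
have : (0 < (7 * S).+1 ^ 3)%N by rewrite expn_gt0.
by move: le; move: (_ ^ 3)%N (_ ^ 3)%N => u v; nia.
Qed.

(** The main factor is [64 ^ (2 * S)] with [2 * S <= 5 * b - 7] and [64 <= 3 ^ 4 <= b ^ 4]. This
    leaves an exponent below [20 * b], and [25 * b] has room for the rest. *)
Lemma exponent_le b S : (3 <= b)%N -> (2 * S + 7 <= 5 * b)%N ->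
  ((2 * b + 4) * (40 * b) * (4 * branching S ^ 2 + 3) <= b ^ (25 * b))%N.
Proof.
move=> b3 Sb; set X := (64 ^ (2 * S))%N; have X0 : (0 < X)%N by rewrite expn_gt0.
have g2 : (4 * branching S ^ 2 + 3 <= 20 * (64 * X))%N.
  by rewrite /branching expnMn -expnM mulnC [(S * 2)%N]mulnC -/X; lia.
have bb : ((2 * b + 4) * (40 * b) <= 160 * (b * b))%N by nia.
apply: leq_trans (leq_mul bb g2) _.
apply: (@leq_trans (b ^ 2 * 64 ^ (2 * S + 3))%N).
  by rewrite expnD -/X !expnS !expn0 !muln1; nia.
apply: (@leq_trans (b ^ 2 * b ^ (4 * (5 * b - 4)))%N).
  rewrite leq_mul2l; apply/orP; right; rewrite expnM.
  apply: (@leq_trans (64 ^ (5 * b - 4))%N); first by rewrite leq_exp2l //; lia.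
  rewrite leq_exp2r; last by lia.
  by apply: (@leq_trans (3 ^ 4)%N); rewrite // leq_exp2r.
by rewrite -expnD leq_exp2l; lia.
Qed.

Lemma cube_exp_le b S : (3 <= b)%N -> (2 * S + 7 <= 5 * b)%N ->
  (2 * (S.+1 * ((7 * S).+1 + 4) ^ 3) <= 2 ^ (40 * b))%N.
Proof.
move=> b3 Sb; have b2 : (b < 2 ^ b)%N by rewrite ltn_expl.
apply: (@leq_trans (2 ^ 1 * (2 ^ (b + 2) * (2 ^ (b + 5)) ^ 3))%N).
  apply: leq_mul => //; apply: leq_mul; first by rewrite expnD; lia.
  by rewrite leq_exp2r // expnD; lia.
by rewrite -expnM -!expnD leq_exp2l //; lia.
Qed.

Section Dense.
Variables (R : realType) (X Y Z : finType) (E : {set X * Y}) (lam : X * Y -> Z).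
Hypothesis latin : partial_latin_square E lam.
Variables (n : nat) (eps : R).
Hypotheses (cardX : #|X| = n) (cardY : #|Y| = n) (cardZ : #|Z| = n).
Hypothesis n_gt0 : (0 < n)%N.
Hypothesis eps_gt0 : 0 < eps.
Hypothesis many_octahedra : eps * n%:R ^+ 5 <= #|octahedra E lam|%:R.
Variable b : nat.
Hypothesis b_gt0 : (0 < b)%N.

Lemma card_cells : eps * n%:R ^+ 2 <= #|E|%:R.
Proof.
have n3 : 0 < n%:R ^+ 3 :> R by rewrite exprn_gt0 // ltr0n.
rewrite -(ler_pM2l n3) mulrCA -exprD; apply: le_trans many_octahedra _.
rewrite -natrX -natrM ler_nat (sum_octahedra_at E lam) pair_bigA /= mulnC -sum_nat_const.
rewrite [leqRHS]big_mkcond; apply: leq_sum => -[x y] _; case: ifP => [_|/negbT /=].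
  apply: leq_trans (card_octahedra_at latin x y) _.
  by rewrite cardX cardY !expnS expn0 muln1 mulnA.
by move=> nE; rewrite octahedra_at_E ?cards0.
Qed.

Lemma eps_le1 : eps <= 1.
Proof.
have n2 : 0 < n%:R ^+ 2 :> R by rewrite exprn_gt0 // ltr0n.
rewrite -(ler_pM2r n2) mul1r; apply: le_trans card_cells _.
by rewrite -natrX ler_nat (leq_trans (max_card _)) // card_prod cardX cardY.
Qed.

Definition embeds (A : {set X * Y}) :=
  exists (G : groupType) (d : G -> G -> \bar R)
         (phi : X -> G) (psi : Y -> G) (omega : Z -> G),
    [/\ biinvariant_metric d,
        [/\ one_separated_image d phi, one_separated_image d psi
          & one_separated_image d omega]
      & forall x y z, (x, y) \in A -> lam (x, y) = z ->
          (d (phi x * psi y)%g (omega z) <= (b%:R^-1)%:E)%E].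

Lemma embeds_small : (b <= 2)%N -> embeds E.
Proof.
move=> b2; have fs := @latin_face_sign _ _ _ E lam; have fi := @latin_face_inv _ _ _ E lam.
have small x y m : x <> y -> area (fun a b c => latin_face E lam a b c) m
    (fg_of [:: x; linv y]) -> (b <= m)%N.
  move=> nxy /(area_disc fs nxy)[s [j [jm /disc_steps d]]].
  exact: steps_ge b2 d jm.
apply: latin_metric => // x x' m nx; [| |rewrite -{1}(linvK (sym_letter X Y x'))];
  by apply: small => -[e]; apply: nx.
Qed.

Local Notation L := (X + Y + Z)%type.
Local Notation T := (L * bool)%type.
Local Notation rl := (row_letter Y Z).
Local Notation cr := (col_letter X Z).
Local Notation sl := (sym_letter X Y).

Section Colouring.
Variable P : T -> T -> T -> bool.
Hypothesis P_face : forall a u c, P a u c -> latin_face E lam a u c.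
Hypothesis P_rot : forall a u c, P a u c -> P u c a.
Hypothesis P_inv : forall a u c, P a u c -> P (linv c) (linv u) (linv a).
Local Notation faceP := (fun a u c : T => P a u c).

Definition cells := [set p in E | P (rl p.1) (cr p.2) (sl (lam p))].

Lemma P_cells a u c : P a u c -> exists p s, p \in cells /\
  let w : T * T * T := if s then (rl p.1, cr p.2, sl (lam p))
    else (linv (sl (lam p)), linv (cr p.2), linv (rl p.1)) in
  [\/ (a, u, c) = w, (u, c, a) = w | (c, a, u) = w].
Proof.
move=> Pauc; have f := P_face Pauc; have P2 := P_rot Pauc; have P3 := P_rot P2.
have I1 := P_inv Pauc; have I2 := P_inv P2; have I3 := P_inv P3.
move: f Pauc P2 P3 I1 I2 I3; case: a => [[[x|y]|z] []]; case: u => [[[x'|y']|z'] []] //;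
  case: c => [[[x''|y'']|z''] []] //= /andP[xyE /eqP <-] P1 P2 P3 I1 I2 I3.
- by exists (x, y'), true; split; [rewrite inE xyE | constructor 1].
- by exists (x, y''), false; split; [rewrite inE xyE | constructor 2].
- by exists (x'', y), true; split; [rewrite inE xyE | constructor 3].
- by exists (x', y), false; split; [rewrite inE xyE | constructor 3].
- by exists (x', y''), true; split; [rewrite inE xyE | constructor 2].
- by exists (x'', y'), false; split; [rewrite inE xyE | constructor 1].
Qed.

Lemma card_P : (#|[set t : T * T * T | P t.1.1 t.1.2 t.2]| <= 6 * #|cells|)%N.
Proof.
pose f (q : 'I_3 * bool * (X * Y)) : T * T * T :=
  let: (k, s, p) := q in
  let: (a, u, c) := if s then (rl p.1, cr p.2, sl (lam p))
    else (linv (sl (lam p)), linv (cr p.2), linv (rl p.1)) in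
  if k == 0 :> nat then (a, u, c) else if k == 1%N :> nat then (c, a, u) else (u, c, a).
pose D := finset.setX [set: 'I_3 * bool]%SET cells.
have -> : (6 * #|cells| = #|D|)%N by rewrite cardsX cardsT card_prod card_ord card_bool.
apply: leq_trans (leq_imset_card f _); apply: subset_leq_card.
apply/fintype.subsetP => -[[a u] c]; rewrite inE /= => /P_cells[p [s [pc e]]].
apply/imsetP; case: e => e.
- exists (@Ordinal 3 0 isT, s, p); first by rewrite inE /= inE pc.
  by rewrite /f; case: s e => /= -[-> -> ->].
- exists (@Ordinal 3 1 isT, s, p); first by rewrite inE /= inE pc.
  by rewrite /f; case: s e => /= -[-> -> ->].
exists (@Ordinal 3 2 isT, s, p); first by rewrite inE /= inE pc.
by rewrite /f; case: s e => /= -[-> -> ->].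
Qed.

Definition near x y := `[< x <> y /\ exists2 k, (k < b)%N &
  area faceP k (fg_of [:: x; linv y]) >].

Lemma near_sym : symmetric near.
Proof.
suff imp x y : near x y -> near y x by move=> x y; apply/idP/idP; apply: imp.
move=> /asboolP[nxy [k kb ar]]; apply/asboolP; split; first by move=> e; apply: nxy.
exists k => //; have := areaV P_inv ar; rewrite -fgV.
by rewrite /word_inv /= /rev /= linvK.
Qed.

(** All letters of a disc occur in its faces. Two rows at distance below 1 in the metric of [A]
    therefore both occur in cells of [A] and share a colour, although they are near and coloured
    differently; the same holds for columns and symbols. *)
Lemma embeds_coloured D : (forall x, (#|[pred y | near x y]| <= D)%N) ->
  exists A : {set X * Y}, [/\ A \subset E, embeds A & (#|cells| <= D.+1 ^ 3 * #|A|)%N].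
Proof.
move=> deg; have [col colP] := greedy_colouring near_sym deg.
pose f (p : X * Y) := (col (rl p.1), col (cr p.2), col (linv (sl (lam p)))).
have [c leA] := popular_class cells f (ord0, ord0, ord0).
set A := [set i in cells | f i == c] in leA.
have AE : A \subset E by apply/fintype.subsetP => p; rewrite !inE -andbA => /and3P[].
exists A; split=> //; last by rewrite !card_prod !card_ord in leA; rewrite !expnS expn0 muln1 mulnA.
have AP a u e : latin_face A lam a u e -> P a u e.
  case: a => [[[x|y]|z] []]; case: u => [[[?|?]|?] []] //; case: e => [[[?|?]|?] []] //=;
    rewrite /cell !inE /= => /andP[/andP[/andP[_ p] _] /eqP <-];
    by [|apply: (P_rot p)|apply: P_rot (P_rot p)|apply: (P_inv p)
       |apply: P_rot (P_inv p)|apply: P_rot (P_rot (P_inv p))].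
have AP' a u e : latin_face A lam a u e -> faceP a u e by exact: AP.
(* The sign is ignored, since a disc contains [linv a'] rather than [a']. Symbols are coloured
   through [linv (sl z)], the letter that represents them in the group. *)
pose Q (s : T) := match s.1 with
  | inl (inl x) => col (rl x) = c.1.1
  | inl (inr y) => col (cr y) = c.1.2
  | inr z => col (linv (sl z)) = c.2
  end.
have AQ a u e : latin_face A lam a u e -> [/\ Q a, Q u & Q e].
  case: a => [[[x|y]|z] []]; case: u => [[[?|?]|?] []] //; case: e => [[[?|?]|?] []] //=;
    by rewrite /cell !inE /Q /= => /andP[/andP[_ /eqP <-] /eqP <-].
have sep a a' m : a <> a' -> (Q a -> Q (linv a') -> col a = col a') ->
    area (fun a u e => latin_face A lam a u e) m (fg_of [:: a; linv a']) -> (b <= m)%N.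
  move=> naa' qcol ar; rewrite leqNgt; apply/negP => mb.
  have [s [j [_ d]]] := area_disc (@latin_face_sign _ _ _ A lam) naa' ar.
  have mem := disc_letters AQ d.
  apply: (colP a a' naa'); last by apply: qcol; apply: mem; rewrite !inE eqxx ?orbT.
  apply/asboolP; split=> //; exists m => //.
  exact: (area_mono AP' ar).
apply: latin_metric => // x x' m nx ar.
- apply: (sep (rl x) (rl x')) => //; first by case=> e; apply: nx.
  by rewrite /Q /= => -> ->.
- apply: (sep (cr x) (cr x')) => //; first by case=> e; apply: nx.
  by rewrite /Q /= => -> ->.
apply: (sep (linv (sl x)) (linv (sl x'))) => //; first by case=> e; apply: nx.
by rewrite /Q /= => -> ->.
Qed.

End Colouring.

(** Cells have density [dl ^+ g2], and three letters with at most [dl ^- g2.+1] colours each give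
    the exponent [3 * (g2 + 1) + g2 = 4 * g2 + 3]. *)
Lemma embeds_dense (dl : R) (S : nat) : 0 < dl -> dl <= 16^-1 ->
  (2 * (S.+1 * ((7 * S).+1 + 4) ^ 3))%:R * dl <= 1 -> (0 < S)%N ->
  432 * dl <= eps -> (5 * b <= 2 * S + 8)%N ->
  exists A : {set X * Y}, [/\ A \subset E, embeds A &
    dl ^+ (4 * branching S ^ 2 + 3)%N * n%:R ^+ 2 <= #|A|%:R].
Proof.
move=> dl0 dl16 Sdl S0 dle bS.
have cl := card_letters cardX cardY cardZ.
have N0 : 0 < #|{: T}|%:R :> R by rewrite cl ltr0n muln_gt0.
have [P [PF Prot Pinv many deg]] := dense_faces (@latin_swap _ _ _ E lam)
  (@latin_flip _ _ _ E lam) (latin_det1 latin) (latin_det2 latin) (latin_det3 latin)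
  (@latin_step_sg _ _ _ E lam) (@latin_step_source _ _ _ E lam)
  (@latin_step_corners _ _ _ E lam) N0 dl0 dl16 Sdl S0
  (many_movable latin cardX cardY cardZ n_gt0 many_octahedra dl0 dle).
have Pf a u c : P a u c -> latin_face E lam a u c.
  by move/PF; rewrite /latin_step linvK.
pose D := \max_x #|[pred y | near P x y]|.
have degD x : (#|[pred y | near P x y]| <= D)%N by apply: leq_bigmax.
have [A [AE emb le]] := embeds_coloured Prot Pinv degD.
exists A; split=> //.
set g2 := (branching S ^ 2)%N in many deg *.
have w0 : 0 < dl ^+ g2 by rewrite exprn_gt0.
have D1 : D.+1%:R * dl ^+ g2.+1 <= 1.
  have [x Dx] : {x | D = #|[pred y | near P x y]|}.
    have c0 : (0 < #|{: T}|)%N by rewrite cl muln_gt0.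
    exact: (bigop.eq_bigmax (fun x => #|[pred y | near P x y]|) c0).
  have le1 : D%:R * dl ^+ g2 <= (S.+1 * (7 * S).+1 ^ 3)%:R.
    rewrite Dx; apply: (deg x) => y /asboolP[nxy [k kb ar]].
    have fs a u c : P a u c -> a.2 = u.2 /\ u.2 = c.2 by move/Pf/latin_face_sign.
    have [s [j [jk d]]] := area_disc fs nxy ar.
    exists s, j; split=> //; exact: steps_le (disc_steps d) jk kb bS.
  have le2 : dl ^+ g2 <= 1 by apply: exprn_ile1; [exact: ltW | lra].
  have le3 : D.+1%:R * dl ^+ g2 <= (2 * (S.+1 * ((7 * S).+1 + 4) ^ 3))%:R.
    apply: le_trans (_ : (S.+1 * (7 * S).+1 ^ 3)%:R + 1 <= _).
      by rewrite -natr1 mulrDl mul1r; apply: lerD.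
    by rewrite natr1 ler_nat cube_le.
  rewrite exprSr mulrA; apply: le_trans Sdl; apply: ler_wpM2r le3; exact: ltW.
have cells_ge : dl ^+ g2 * n%:R ^+ 2 <= #|cells P|%:R.
  rewrite -(ler_pM2l (_ : 0 < 6 :> R)) //.
  apply: le_trans (_ : dl ^+ g2 * #|{: T}|%:R ^+ 2 <= _).
    rewrite mulrCA; apply: ler_wpM2l; first exact: ltW.
    rewrite cl natrM exprMn; apply: ler_wpM2r; first by rewrite exprn_ge0 // ler0n.
    by lra.
  apply: le_trans many _; rewrite sum_natr_card3 -natrM ler_nat; exact: card_P.
have le' : #|cells P|%:R <= D.+1%:R ^+ 3 * #|A|%:R :> R by rewrite -natrX -natrM ler_nat.
have -> : (4 * g2 + 3 = g2.+1 * 3 + g2)%N by rewrite mulnC mulSn (mulnC g2); ring.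
rewrite exprD exprM -mulrA.
apply: le_trans (_ : dl ^+ g2.+1 ^+ 3 * (D.+1%:R ^+ 3 * #|A|%:R) <= _).
  apply: ler_wpM2l; first by rewrite !exprn_ge0 // ltW.
  exact: le_trans cells_ge le'.
rewrite mulrA -exprMn; apply: ler_piMl; first by rewrite ler0n.
by apply: exprn_ile1; [rewrite mulr_ge0 ?ler0n ?exprn_ge0 // ltW | rewrite mulrC].
Qed.

(** The first two terms of the binomial expansion of [((m - 1) + 1) ^ m] give
    [2 * (m - 1) ^ m <= m ^ m]. *)
Lemma exp_half (m : nat) : (1 < m)%N -> eps <= 1 - m%:R^-1 -> eps ^+ m <= 2^-1.
Proof.
move=> m1 le; have m0 : 0 < m%:R :> R by rewrite ltr0n; lia.
have bern (k x : nat) : (x ^ k + k * x ^ k.-1 <= x.+1 ^ k)%N.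
  elim: k => [|k IH]; first by rewrite !expn0.
  rewrite !expnS /=; case: k IH => [|k] /= IH; first by rewrite !expn0; lia.
  rewrite expnS in IH *; nia.
have : eps ^+ m <= (1 - m%:R^-1) ^+ m.
  by rewrite lerXn2r // nnegrE ?(le_trans _ le) // ltW.
move=> /le_trans; apply.
have -> : 1 - m%:R^-1 = m.-1%:R / m%:R :> R.
  by rewrite -[in RHS]subn1 natrB; [field; rewrite gt_eqF | lia].
rewrite expr_div_n ler_pdivrMr ?exprn_gt0 // -!natrX.
rewrite -(ler_pM2l (_ : 0 < 2 :> R)) // mulrA divff ?mul1r // -natrM ler_nat.
have := bern m m.-1; rewrite prednK; last by lia.
have -> : (m * m.-1 ^ m.-1 = m.-1 ^ m + m.-1 ^ m.-1)%N.
  by rewrite -{1}(prednK (ltnW m1)) mulSn addnC -expnS prednK // ltnW.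
lia.
Qed.

Lemma embeds_sparse : (3 <= b)%N -> eps <= 1 - (2 * b + 4)%:R^-1 ->
  exists A : {set X * Y}, [/\ A \subset E, embeds A &
    eps ^+ (b ^ (25 * b))%N * n%:R ^+ 2 <= #|A|%:R].
Proof.
move=> b3 eps_le; have m1 : (1 < 2 * b + 4)%N by rewrite addnC.
have half := exp_half m1 eps_le; have eps1 := eps_le1.
have eps0 : 0 <= eps by exact: ltW.
(* [S] is the number of steps of the largest disc with fewer than [b] faces and two boundary
   letters, rounded down. As [eps ^+ (2 * b + 4) <= 1/2], this [dl] is at most [2 ^- (40 * b)],
   enough for every constant lost on the way. *)
pose S := (5 * b - 7)./2; pose dl := eps ^+ ((2 * b + 4) * (40 * b)).
have S7 : (7 <= 5 * b)%N by apply: (@leq_trans (5 * 3)%N); rewrite ?leq_mul2l.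
have [Sb [S0 bS]] : (2 * S + 7 <= 5 * b)%N /\ (0 < S)%N /\ (5 * b <= 2 * S + 8)%N.
  by clear half; rewrite /S; lia.
have dl_half : dl <= 2^-1 ^+ (40 * b).
  by rewrite /dl exprM lerXn2r // nnegrE ?exprn_ge0 // invr_ge0.
have h0 : 0 <= 2^-1 :> R by rewrite invr_ge0.
have h1 : 2^-1 <= 1 :> R by lra.
have dl0 : 0 < dl by rewrite exprn_gt0.
have dl16 : dl <= 16^-1.
  apply: le_trans dl_half _; apply: le_trans (ler_wiXn2l h0 h1 (_ : (4 <= 40 * b)%N)) _.
    by apply: (@leq_trans (40 * 1)%N); rewrite // leq_mul2l.
  by rewrite !exprS expr0; lra.
have Sdl : (2 * (S.+1 * ((7 * S).+1 + 4) ^ 3))%:R * dl <= 1.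
  apply: le_trans (_ : (2 ^ (40 * b))%:R * 2^-1 ^+ (40 * b) <= _).
    by apply: ler_pM; rewrite ?ler0n ?ler_nat ?cube_exp_le // ltW.
  by rewrite natrX -exprMn divff // expr1n.
have dl_eps : 432 * dl <= eps.
  have -> : dl = eps * eps ^+ ((2 * b + 4) * (40 * b)).-1.
    rewrite -exprS prednK // muln_gt0 muln_gt0 /= (leq_trans _ b3) // andbT.
    exact: ltnW.
  rewrite mulrCA; apply: (ler_piMr eps0).
  apply: le_trans (_ : 432 * 2^-1 ^+ 9 <= _); last by rewrite !exprS expr0; lra.
  apply: ler_wpM2l; first by lra.
  apply: le_trans (_ : eps ^+ ((2 * b + 4) * 9) <= _).
    by apply: ler_wiXn2l => //; clear half dl_half dl16 Sdl; nia.
  by rewrite exprM lerXn2r // nnegrE exprn_ge0.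
have [A [AE emb le]] := embeds_dense dl0 dl16 Sdl S0 dl_eps bS.
exists A; split=> //; apply: le_trans le; apply: ler_wpM2r.
  by rewrite exprn_ge0 // ler0n.
by rewrite /dl -exprM; apply: ler_wiXn2l => //; apply: exponent_le.
Qed.

End Dense.

(** * Partial Latin squares close to groups *)

(** The complements of the domain and of the image of a partial injection have equal size and are
    matched in the order of their enumerations. *)
Lemma perm_of_rel (U : finType) (r : rel U) :
  (forall v w w', r v w -> r v w' -> w = w') ->
  (forall v v' w, r v w -> r v' w -> v = v') ->
  exists s : {perm U}, forall v w, r v w -> s v = w.
Proof.
move=> rf ri; pose f v := odflt v [pick w | r v w].
pose D := [set v | [exists w, r v w]]; pose B := f @: D.
have fP v : v \in D -> r v (f v).
  rewrite inE => /existsP[w rvw]; rewrite /f; case: pickP => [//|/(_ w)].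
  by rewrite rvw.
have injf : {in D &, injective f}.
  by move=> v v' /fP rv /fP rv' e; apply: (ri _ _ (f v)); rewrite // e.
have cB : #|~: B| = #|~: D| 
  by apply/eqP; rewrite -(eqn_add2l #|B|) cardsC {1}/B card_in_imset // cardsC.
pose g v := if v \in D then f v else nth v (enum (~: B)) (index v (enum (~: D))).
have idx v : v \notin D -> (index v (enum (~: D)) < size (enum (~: B)))%N.
  by move=> vD; rewrite -cardE cB cardE index_mem mem_enum inE.
have gB v : v \notin D -> g v \notin B.
  move=> vD; rewrite /g (negPf vD).
  by have := mem_nth v (idx v vD); rewrite mem_enum inE.
have gD v : v \in D -> g v = f v by rewrite /g => ->.
have injg : injective g.
  move=> v v'; case: (boolP (v \in D)) => vD; case: (boolP (v' \in D)) => vD' e.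
  - by apply: injf => //; rewrite -!gD.
  - by case/negP: (gB _ vD'); rewrite -e gD // imset_f.
  - by case/negP: (gB _ vD); rewrite e gD // imset_f.
  move: e; rewrite /g (negPf vD) (negPf vD') (@set_nth_default _ _ v' v) ?idx //.
  move=> /eqP; rewrite nth_uniq ?idx ?enum_uniq // => /eqP e.
  have mem x : x \notin D -> x \in enum (~: D) by rewrite mem_enum finset.in_setC.
  by rewrite -[LHS](nth_index v (mem _ vD)) -[RHS](nth_index v (mem _ vD')) e.
exists (perm injg) => v w rvw; have vD : v \in D by rewrite inE; apply/existsP; exists w.
by rewrite permE gD //; apply: rf (fP _ vD) rvw.
Qed.

(** * The scaled Hamming metric with an infinite second factor *)

Section Hamming.
Variables (R : realType) (U : finType) (H : finGroupType) (kap : R).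
Hypothesis kap_gt0 : 0 < kap.
Local Notation G := ({perm U} * H)%type.
Implicit Types (s t : {perm U}) (g h k : G).

Definition hamming s t := #|[set v | s v != t v]|.

Lemma hamming_sym s t : hamming s t = hamming t s.
Proof. by apply: eq_card => v; rewrite !inE eq_sym. Qed.

Lemma hammingxx s : hamming s s = 0%N.
Proof. by apply: eq_card0 => v; rewrite !inE eqxx. Qed.

Lemma hamming_eq0 s t : hamming s t = 0%N -> s = t.
Proof.
move=> /card0_eq e; apply/permP => v.
by have := e v; rewrite !inE => /negbFE/eqP.
Qed.

Lemma hamming_triangle s t u : (hamming s u <= hamming s t + hamming t u)%N.
Proof.
apply: leq_trans (leq_card_setU _ _); apply: subset_leq_card; apply/fintype.subsetP => v.
by rewrite !inE -negb_and; apply: contra => /andP[/eqP-> /eqP->].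
Qed.

Lemma hammingMl u s t : hamming (u * s)%g (u * t)%g = hamming s t.
Proof.
rewrite /hamming -(card_imset _ (@perm_inj _ u)); apply: eq_card => v.
apply/imsetP/idP => [[w]|]; rewrite !inE.
  by rewrite !permM => ne ->.
by move=> ne; exists (u^-1%g v); rewrite ?inE ?permM permKV.
Qed.

Lemma hammingMr u s t : hamming (s * u)%g (t * u)%g = hamming s t.
Proof. by apply: eq_card => v; rewrite !inE !permM (inj_eq perm_inj). Qed.

Definition hamming_dist g h : \bar R :=
  if g.2 == h.2 then (kap * (hamming g.1 h.1)%:R)%:E else +oo%E.

Lemma hamming_metric : biinvariant_metric hamming_dist.
Proof.
have pos s t : 0 <= kap * (hamming s t)%:R by rewrite mulr_ge0 ?ler0n // ltW.
split=> [g h|g h|g h|g h k|k g h|k g h]; rewrite /hamming_dist.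
- by case: eqP => _; rewrite ?lee_fin.
- case: eqP => [e|ne]; last by split=> // e; case: ne; rewrite e.
  split=> [[/eqP]|->]; last by rewrite hammingxx mulr0.
  rewrite mulf_eq0 gt_eqF //= pnatr_eq0 => /eqP/hamming_eq0 e1.
  by case: g h e e1 => [? ?] [? ?] /= -> ->.
- by rewrite eq_sym hamming_sym.
- case: (eqVneq g.2 h.2) => [e1|_]; case: (eqVneq h.2 k.2) => [e2|ne2].
  + by rewrite e1 e2 eqxx -EFinD lee_fin -mulrDr ler_pM2l // -natrD ler_nat hamming_triangle.
  + by rewrite addey ?leey.
  + by rewrite addye ?leey.
  + by rewrite addye ?leey.
- by rewrite /= hammingMl (inj_eq (mulgI _)).
by rewrite /= hammingMr (inj_eq (mulIg _)).
Qed.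

(** By injectivity in the index, two of the partial injections disagree wherever both are defined,
    which is on at least [2 * m - #|U| >= c] points. Indices that are not good go to distinct
    nontrivial elements of [H], at infinite distance from all others. *)
Lemma hamming_separated (I : Type) (r : I -> rel U) (s : I -> {perm U})
    (good : I -> bool) (tau : I -> H) (m c : nat) :
  injective tau -> (forall i, tau i != 1%g) ->
  (forall i v w, r i v w -> s i v = w) ->
  (forall i j v w, r i v w -> r j v w -> i = j) ->
  (forall i, good i -> (m <= #|[set v | [exists w, r i v w]]|)%N) ->
  (#|U| + c <= 2 * m)%N -> 1 <= kap * c%:R ->
  one_separated_image hamming_dist
    (fun i => if good i then (s i, 1%g) else (1%g, tau i)).
Proof.
move=> tau_inj tau1 rs rr dom Um kc; set f := fun i => _.
suff sep i j : i <> j -> (1 <= hamming_dist (f i) (f j))%E.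
  split=> [i j e|_ _ [i _ <-] [j _ <-] nfij].
    apply: contrapT => /sep; rewrite e /hamming_dist eqxx hammingxx mulr0.
    by rewrite lee_fin ler10.
  by apply: sep => e; apply: nfij; rewrite e.
move=> nij; rewrite /f /hamming_dist.
case: (boolP (good i)) => gi; case: (boolP (good j)) => gj /=.
- rewrite eqxx lee_fin; apply: le_trans kc _; rewrite ler_pM2l // ler_nat.
  set Di := [set v | [exists w, r i v w]]; set Dj := [set v | [exists w, r j v w]].
  have sub : (#|Di :&: Dj| <= hamming (s i) (s j))%N.
    apply: subset_leq_card; apply/fintype.subsetP => v.
    rewrite !inE => /andP[/existsP[w riw] /existsP[w' rjw']].
    rewrite (rs _ _ _ riw) (rs _ _ _ rjw'); apply/negP => /eqP e.
    by apply: nij; apply: rr riw _; rewrite e.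
  have := cardsUI Di Dj; have := max_card (Di :|: Dj).
  have := dom i gi; have := dom j gj; rewrite -/Di -/Dj.
  by move: sub Um; clear; lia.
- by rewrite eq_sym (negPf (tau1 j)) leey.
- by rewrite (negPf (tau1 i)) leey.
by case: eqP => [/tau_inj//|_]; rewrite leey.
Qed.

End Hamming.

(** * Permutations defined by a base cell *)

Section BaseFace.
Variables (R : realType) (X Y Z : finType) (E : {set X * Y}) (lam : X * Y -> Z).
Hypothesis latin : partial_latin_square E lam.
Variables (n b : nat).
Hypotheses (cardX : #|X| = n) (cardY : #|Y| = n) (cardZ : #|Z| = n).
Hypothesis n_gt0 : (0 < n)%N.
Hypothesis b_gt0 : (0 < b)%N.
Variables (x0 : X) (y0 : Y).
Local Notation z0 := (lam (x0, y0)).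
Local Notation cell := (cell E lam).
Variable h : Y -> Z.
Hypothesis h_inj : injective h.

(** The seven cells besides [(x0, y0)] of an octahedron at this base cell, with [x] and [y] in the
    roles of [x4] and [y3] and with [u] the symbol of [(c, y2)]. *)
Definition completes x y u := [exists c, exists y2, exists a, exists y4, exists w,
  [&& cell c y0 (lam (x, y)), cell x0 y2 w, cell c y2 u & cell a y z0] &&
  [&& cell x y (lam (x, y)), cell a y4 w & cell x y4 u]].

Lemma completesP x y u : reflect (exists c y2 a y4 w,
  [/\ cell c y0 (lam (x, y)), cell x0 y2 w, cell c y2 u & cell a y z0] /\
  [/\ cell x y (lam (x, y)), cell a y4 w & cell x y4 u]) (completes x y u).
Proof.
apply: (iffP existsP) => [[c /existsP[y2 /existsP[a /existsP[y4 /existsP[w]]]]]|].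
  by move=> /andP[/and4P[? ? ? ?] /and3P[? ? ?]]; exists c, y2, a, y4, w.
move=> [c [y2 [a [y4 [w [[c1 c2 c3 c4] [c5 c6 c7]]]]]]]; exists c.
apply/existsP; exists y2; apply/existsP; exists a; apply/existsP; exists y4.
by apply/existsP; exists w; rewrite c1 c2 c3 c4 c5 c6 c7.
Qed.

(** If the square were a group with [x0 y0 = z0], rows, columns and symbols would act by
    [u -> x^-1 u], [v -> z0 y^-1 v] and [u -> z0 z^-1 u]. For [z = x y] the first two compose to the
    third. The injection [h] lets all of them act on symbols. *)
Definition row_rel x : rel Z := fun u v => [exists y, (v == h y) && cell x y u].
Definition col_rel y : rel Z := fun v w =>
  [exists y', exists a, [&& v == h y', cell a y z0 & cell a y' w]].
Definition sym_rel z : rel Z := fun u w =>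
  [exists c, exists y2, [&& cell c y0 z, cell x0 y2 w & cell c y2 u]].

Lemma row_relP x u v : reflect (exists2 y, v = h y & cell x y u) (row_rel x u v).
Proof.
apply: (iffP existsP) => [[y /andP[/eqP-> ?]]|[y -> ?]]; exists y => //.
exact/andP.
Qed.

Lemma col_relP y v w : reflect
  (exists y' a, [/\ v = h y', cell a y z0 & cell a y' w]) (col_rel y v w).
Proof.
apply: (iffP existsP) => [[y' /existsP[a /and3P[/eqP-> ? ?]]]|[y' [a [-> ? ?]]]].
  by exists y', a.
by exists y'; apply/existsP; exists a; apply/and3P.
Qed.

Lemma sym_relP z u w : reflect
  (exists c y2, [/\ cell c y0 z, cell x0 y2 w & cell c y2 u]) (sym_rel z u w).
Proof.
apply: (iffP existsP) => [[c /existsP[y2 /and3P[? ? ?]]]|[c [y2 [? ? ?]]]].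
  by exists c, y2.
by exists c; apply/existsP; exists y2; apply/and3P.
Qed.

Lemma row_perm x : exists s : {perm Z}, forall u v, row_rel x u v -> s u = v.
Proof.
apply: perm_of_rel => [u v v'|u u' v] /row_relP[y ev c] /row_relP[y' ev' c'].
  by rewrite ev ev' (cell_col latin c c').
by subst v; move: c'; rewrite -(h_inj ev') => c'; apply: cell_sym c c'.
Qed.

Lemma col_perm y : exists s : {perm Z}, forall v w, col_rel y v w -> s v = w.
Proof.
apply: perm_of_rel => [u v v'|u u' v] /col_relP[y1 [a1 [e1 c1 d1]]]
  /col_relP[y2 [a2 [e2 c2 d2]]]; have ea := cell_row latin c1 c2; subst a2.
  by subst u; move: d2; rewrite -(h_inj e2) => d2; apply: cell_sym d1 d2.
by rewrite e1 e2 (cell_col latin d1 d2).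
Qed.

Lemma sym_perm z : exists s : {perm Z}, forall u w, sym_rel z u w -> s u = w.
Proof.
apply: perm_of_rel => [u v v'|u u' v] /sym_relP[a1 [y1 [c1 d1 f1]]]
  /sym_relP[a2 [y2 [c2 d2 f2]]]; have ea := cell_row latin c1 c2; subst a2.
  by have ey := cell_col latin f1 f2; subst y2; apply: cell_sym d1 d2.
by have ey := cell_col latin d1 d2; subst y2; apply: cell_sym f1 f2.
Qed.

Lemma row_rel_inj x x' u v : row_rel x u v -> row_rel x' u v -> x = x'.
Proof.
move=> /row_relP[y -> c] /row_relP[y' /h_inj e c']; subst y'.
exact: cell_row latin _ _ _ _ c c'.
Qed.

Lemma col_rel_inj y y' v w : col_rel y v w -> col_rel y' v w -> y = y'.
Proof.
move=> /col_relP[y1 [a1 [-> c1 d1]]] /col_relP[y2 [a2 [/h_inj e c2 d2]]]; subst y2.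
have ea := cell_row latin d1 d2; subst a2; exact: cell_col latin _ _ _ _ c1 c2.
Qed.

Lemma sym_rel_inj z z' u w : sym_rel z u w -> sym_rel z' u w -> z = z'.
Proof.
move=> /sym_relP[a1 [y1 [c1 d1 f1]]] /sym_relP[a2 [y2 [c2 d2 f2]]].
have ey := cell_col latin d1 d2; subst y2.
have ea := cell_row latin f1 f2; subst a2; exact: cell_sym c1 c2.
Qed.

Definition completions x y := [set u | completes x y u].
Definition fine_cells := [set p in E | (n - n %/ b.+2 <= #|completions p.1 p.2|)%N].

Lemma fine_embeds : embeds R lam b fine_cells.
Proof.
have [s sP] := boolp.choice row_perm; have [t tP] := boolp.choice col_perm.
have [w wP] := boolp.choice sym_perm.
(* At most [q] incompatible symbols are allowed. The inequality [(b + 2) * q <= n] gives both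
   [kap * q <= 1 / b], for closeness, and [kap * (n - 2 * q) >= 1], for separation. *)
pose q := (n %/ b.+2)%N; have qn : (b.+2 * q <= n)%N by rewrite mulnC leq_divM.
pose kap : R := b.+2%:R / (b%:R * n%:R).
have b0 : 0 < b%:R :> R by rewrite ltr0n.
have n0 : 0 < n%:R :> R by rewrite ltr0n.
have kap0 : 0 < kap by rewrite divr_gt0 ?mulr_gt0 ?ltr0n.
have Um : (#|Z| + (n - 2 * q) <= 2 * (n - q))%N by rewrite cardZ; nia.
have kc : 1 <= kap * (n - 2 * q)%:R.
  rewrite /kap mulrAC ler_pdivlMr ?mulr_gt0 // mul1r -!natrM ler_nat.
  by rewrite mulnBr; nia.
(* The transpositions with [None] are distinct and nontrivial, one for each letter. They are used
   only for letters in no fine cell, to which the approximation does not apply. *)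
pose H := {perm option (X + Y + Z)}.
have tau_inj : injective (fun i : X + Y + Z => tperm None (Some i) : H).
  by move=> i j e; have := tpermL None (Some i); rewrite e tpermL => -[].
have tau1 (i : X + Y + Z) : (tperm None (Some i) : H) != 1%g.
  by apply/eqP => e; have := tpermL None (Some i); rewrite e perm1.
pose gX x := [exists y, (x, y) \in fine_cells].
pose gY y := [exists x, (x, y) \in fine_cells].
pose gZ z := [exists p in fine_cells, lam p == z].
exists ({perm Z} * H)%type, (hamming_dist kap),
  (fun x => if gX x then (s x, 1%g) else (1%g, tperm None (Some (inl (inl x))))),
  (fun y => if gY y then (t y, 1%g) else (1%g, tperm None (Some (inl (inr y))))),
  (fun z => if gZ z then (w z, 1%g) else (1%g, tperm None (Some (inr z)))).
split; first exact: hamming_metric.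
- split.
  + apply: (hamming_separated kap0 _ _ sP row_rel_inj _ Um kc) => //.
      by move=> x x' /tau_inj[].
    move=> x /existsP[y]; rewrite inE => /andP[_ /leq_trans]; apply.
    apply: subset_leq_card; apply/fintype.subsetP => u; rewrite !inE.
    move=> /completesP[c [y2 [a [y4 [v [_ [_ _ c1]]]]]]].
    by apply/existsP; exists (h y4); apply/row_relP; exists y4.
  + apply: (hamming_separated kap0 _ _ tP col_rel_inj _ Um kc) => //.
      by move=> y y' /tau_inj[].
    move=> y /existsP[x]; rewrite inE => /andP[_ /leq_trans]; apply.
    rewrite -(card_imset _ (@perm_inj _ (s x))).
    apply: subset_leq_card; apply/fintype.subsetP => _ /imsetP[u + ->]; rewrite !inE.
    move=> /completesP[c [y2 [a [y4 [v [[_ _ _ c1] [_ c2 c3]]]]]]].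
    have -> : s x u = h y4 by apply: sP; apply/row_relP; exists y4.
    by apply/existsP; exists v; apply/col_relP; exists y4, a.
  apply: (hamming_separated kap0 _ _ wP sym_rel_inj _ Um kc) => //.
    by move=> z z' /tau_inj[].
  move=> z /existsP[[x y] /andP[+ /eqP<-]]; rewrite inE => /andP[_ /leq_trans]; apply.
  apply: subset_leq_card; apply/fintype.subsetP => u; rewrite !inE.
  move=> /completesP[c [y2 [a [y4 [v [[c1 c2 c3 _] _]]]]]].
  by apply/existsP; exists v; apply/sym_relP; exists c, y2.
move=> x y z xyA xyz.
have -> : gX x by apply/existsP; exists y.
have -> : gY y by apply/existsP; exists x.
have -> : gZ z by apply/existsP; exists (x, y); rewrite xyA xyz eqxx.
rewrite /hamming_dist /= mulg1 eqxx lee_fin.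
have hq : (hamming (s x * t y)%g (w z) <= q)%N.
  have : (n - q <= #|completions x y|)%N by move: xyA; rewrite inE => /andP[].
  have sub : (hamming (s x * t y)%g (w z) <= #|~: completions x y|)%N.
    apply: subset_leq_card; apply/fintype.subsetP => u; rewrite !inE.
    apply: contra => /completesP[c [y2 [a [y4 [v]]]]] [[c1 c2 c3 c4] [c5 c6 c7]].
    rewrite permM (_ : s x u = h y4); last by apply: sP; apply/row_relP; exists y4.
    rewrite (_ : t y (h y4) = v); last by apply: tP; apply/col_relP; exists y4, a.
    apply/eqP/esym; apply: wP; apply/sym_relP; exists c, y2; split=> //.
    by rewrite -xyz.
  have := cardsC (completions x y); rewrite cardZ; move: sub; lia.
apply: le_trans (_ : kap * q%:R <= _); first by rewrite ler_pM2l // ler_nat.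
rewrite /kap mulrAC ler_pdivrMr ?mulr_gt0 // mulrA mulVf ?gt_eqF // mul1r.
by rewrite -natrM ler_nat.
Qed.

(** Octahedra at the base cell inject into the completed triples. A pair outside [fine_cells] has at
    most [b.+1 / b.+2 * n] completions and any pair at most [n], so fine cells must supply the
    excess. *)
Lemma card_fine_cells (eps : R) : eps * n%:R ^+ 3 <= #|octahedra_at E lam x0 y0|%:R ->
  (eps * b.+2%:R - b.+1%:R) * n%:R ^+ 2 <= #|fine_cells|%:R.
Proof.
move=> many; have n0 : 0 < n%:R :> R by rewrite ltr0n.
pose D := [set q : X * Y * Z | completes q.1.1 q.1.2 q.2].
have OD : (#|octahedra_at E lam x0 y0| <= #|D|)%N.
  rewrite -(card_in_imset (opposite_cell_inj latin (x1 := x0) (y1 := y0))).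
  apply: subset_leq_card; apply/fintype.subsetP => q /imsetP[v vD ->]; move: vD.
  move=> /octahedra_atP[x2 y2 x3 x4 y3 y4 z12 z21 z22 e12 e21 e22 c1 c2 c3 c4 c5 c6 c7 c8].
  rewrite inE /= -e22; apply/completesP; exists x2, y2, x3, y4, z12.
  by have /andP[_ /eqP->] := c6; split.
have DE : #|D|%:R = \sum_(p : X * Y) #|completions p.1 p.2|%:R :> R.
  rewrite -natr_sum; congr (_%:R).
  rewrite -sum1_card (partition_big (fun q : X * Y * Z => q.1) xpredT) //=.
  apply: eq_bigr => -[x y] _; rewrite -sum1_card.
  rewrite (reindex_onto (fun u => (x, y, u)) snd) /=; last first.
    by move=> [[x' y'] u] /= /andP[_ /eqP[-> ->]].
  by apply: eq_bigl => u; rewrite !inE /= !eqxx !andbT.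
have b2 : 0 < b.+2%:R :> R by rewrite ltr0n.
have le : b.+2%:R * #|D|%:R <= \sum_(p : X * Y)
    (n%:R * (p \in fine_cells)%:R + b.+1%:R * n%:R) :> R.
  rewrite DE mulr_sumr; apply: ler_sum => -[x y] _ /=; rewrite -!natrM -natrD ler_nat.
  have Cn : (#|completions x y| <= n)%N by rewrite -cardZ max_card.
  rewrite inE /=; case: (boolP ((x, y) \in E)) => [xyE|nE] /=.
    have up := ltn_ceil n (isT : (0 < b.+2)%N).
    case: (leqP (n - n %/ b.+2) #|completions x y|) => [_|lt].
      by rewrite muln1 -mulSn leq_mul2l Cn orbT.
    rewrite muln0 add0n; move: up lt; move: #|_| (n %/ b.+2)%N => u v; nia.
  suff -> : #|completions x y| = 0%N by rewrite muln0.
  apply: eq_card0 => u; rewrite !inE; apply/negbTE/negP => /completesP[c [y2 [a [y4 [v [_ c1]]]]]].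
  by case: c1 => /andP[xyE _]; rewrite xyE in nE.
have {le}le : b.+2%:R * (eps * n%:R ^+ 3) <= n%:R * #|fine_cells|%:R + b.+1%:R * n%:R ^+ 3.
  apply: le_trans (ler_wpM2l (ltW b2) many) _.
  apply: le_trans (_ : b.+2%:R * #|D|%:R <= _).
    by rewrite ler_pM2l // ler_nat.
  apply: le_trans le _; rewrite big_split /= -mulr_sumr (sum_natr_card R (mem fine_cells)).
  rewrite lerD2l sumr_const card_prod cardX cardY -[X in X <= _]mulr_natl natrM.
  by rewrite le_eqVlt; apply/orP; left; apply/eqP; move: (n%:R : R) => x; ring.
rewrite -(ler_pM2l n0); move: le; rewrite -lerBlDr.
by move: (#|_|%:R) (n%:R : R) => x y; congr (_ <= _); ring.
Qed.

End BaseFace.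

Section NearOne.
Variables (R : realType) (X Y Z : finType) (E : {set X * Y}) (lam : X * Y -> Z).
Hypothesis latin : partial_latin_square E lam.
Variables (n b : nat) (eps : R).
Hypotheses (cardX : #|X| = n) (cardY : #|Y| = n) (cardZ : #|Z| = n).
Hypothesis n_gt0 : (0 < n)%N.
Hypothesis eps_gt0 : 0 < eps.
Hypothesis many_octahedra : eps * n%:R ^+ 5 <= #|octahedra E lam|%:R.

Lemma rich_base_face : exists x0 y0,
  eps * n%:R ^+ 3 <= #|octahedra_at E lam x0 y0|%:R.
Proof.
have [/existsP[[x y] le]|/existsPn no] :=
  boolP [exists p : X * Y, eps * n%:R ^+ 3 <= #|octahedra_at E lam p.1 p.2|%:R].
  by exists x, y.
have [x0 _] : exists x : X, true.
  by move: n_gt0; rewrite -cardX => /card_gt0P[x _]; exists x.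
have [y0 _] : exists y : Y, true.
  by move: n_gt0; rewrite -cardY => /card_gt0P[y _]; exists y.
have : #|octahedra E lam|%:R < eps * n%:R ^+ 5 :> R.
  rewrite (sum_octahedra_at E lam) pair_bigA /= natr_sum.
  have -> : eps * n%:R ^+ 5 = \sum_(p : X * Y) eps * n%:R ^+ 3.
    rewrite sumr_const card_prod cardX cardY -[RHS]mulr_natl natrM.
    by move: (n%:R : R) => x; ring.
  apply: ltr_sum => [|p _]; last by rewrite ltNge no.
  by apply/hasP; exists (x0, y0); rewrite ?mem_index_enum.
by rewrite ltNge many_octahedra.
Qed.

(** With [d = m * (1 - t)], the Bernoulli-type bound gives [t ^+ (2 * m) <= 1 / (1 + 2 * d)], and
    this is at most [1 - d] as long as [2 * d <= 1]. For [m = b + 2] that condition is the threshold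
    on [eps]. *)
Lemma exp_le_linear (t : R) (m : nat) : 0 <= t -> t <= 1 ->
  1 - (2 * m)%:R^-1 <= t -> (0 < m)%N -> t ^+ (2 * m) <= 1 - m%:R * (1 - t).
Proof.
move=> t0 t1 tm m0.
have bern k : t ^+ k * (1 + k%:R * (1 - t)) <= 1.
  elim: k => [|k IH]; first by rewrite expr0 mul0r addr0 mul1r.
  apply: le_trans IH; rewrite exprSr -mulrA; apply: ler_wpM2l; first exact: exprn_ge0.
  rewrite -natr1; have : 0 <= k%:R :> R by rewrite ler0n.
  move: (k%:R : R) => u u0; rewrite -subr_ge0.
  have -> : 1 + u * (1 - t) - t * (1 + (u + 1) * (1 - t)) = (u + 1) * (1 - t) ^+ 2.
    by ring.
  by rewrite mulr_ge0 ?sqr_ge0 // addr_ge0.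
have dl : (2 * m)%:R * (1 - t) <= 1.
  have m2 : 0 < (2 * m)%:R :> R by rewrite ltr0n muln_gt0.
  by rewrite -ler_pdivlMl // mulr1; move: tm; lra.
have := bern (2 * m)%N; have := exprn_ge0 (2 * m) t0; move: dl; rewrite natrM.
have : 0 <= m%:R * (1 - t) by rewrite mulr_ge0 ?ler0n // subr_ge0.
rewrite -!mulrA; move: (m%:R * (1 - t)) (t ^+ _) => d w d0 d1 w0 wd.
have : 0 <= d * (1 - 2 * d) by rewrite mulr_ge0 // subr_ge0.
nra.
Qed.

Lemma embeds_near_one : (3 <= b)%N -> eps <= 1 -> 1 - (2 * b + 4)%:R^-1 <= eps ->
  exists A : {set X * Y}, [/\ A \subset E, embeds R lam b A &
    eps ^+ (b ^ (25 * b))%N * n%:R ^+ 2 <= #|A|%:R].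
Proof.
move=> b3 eps1 eps_ge; have b0 : (0 < b)%N by exact: ltnW (ltnW b3).
have [x0 [y0 rich]] := rich_base_face.
have eYZ : #|Y| = #|Z| by rewrite cardY cardZ.
pose h y : Z := enum_val (cast_ord eYZ (enum_rank y)).
have h_inj : injective h.
  by move=> y y' /enum_val_inj/cast_ord_inj/enum_rank_inj.
exists (fine_cells E lam n b x0 y0); split.
- by apply/fintype.subsetP => p; rewrite inE => /andP[].
- exact: (fine_embeds R latin cardX cardY cardZ n_gt0 b0 x0 y0 h_inj).
have := card_fine_cells latin cardX cardY cardZ n_gt0 b0 rich; apply: le_trans.
apply: ler_wpM2r; first by rewrite exprn_ge0 // ler0n.
apply: le_trans (_ : eps ^+ (2 * b.+2) <= _).
  apply: ler_wiXn2l => //; first exact: ltW.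
  apply: (@leq_trans (b ^ 3)%N); first by rewrite !expnS expn0 muln1; nia.
  by rewrite leq_exp2l ?(ltnW b3) //; lia.
have tm : 1 - (2 * b.+2)%:R^-1 <= eps.
  by rewrite (_ : 2 * b.+2 = 2 * b + 4)%N //; lia.
apply: le_trans (exp_le_linear (ltW eps_gt0) eps1 tm isT) _.
by rewrite -[b.+2%:R]natr1 le_eqVlt; apply/orP; left; apply/eqP; ring.
Qed.

End NearOne.

Theorem theorem1p9 (R : realType) (n : nat) (eps : R) (X Y Z : finType)
    (E : {set X * Y}) (lam : X * Y -> Z)
    (eps_gt0 : 0 < eps)
    (cardX : #|X| = n) (cardY : #|Y| = n) (cardZ : #|Z| = n)
    (latin : partial_latin_square E lam)
    (many_octahedra : eps * n%:R ^+ 5 <= #|octahedra E lam|%:R)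
    (b : nat) (b_gt0 : (0 < b)%N) :
  exists (A : {set X * Y}) (G : groupType) (d : G -> G -> \bar R)
         (phi : X -> G) (psi : Y -> G) (omega : Z -> G),
    [/\ A \subset E,
        eps ^+ (b ^ (25 * b))%N * n%:R ^+ 2 <= #|A|%:R,
        biinvariant_metric d,
        [/\ one_separated_image d phi, one_separated_image d psi
          & one_separated_image d omega]
      & forall x y z, (x, y) \in A -> lam (x, y) = z ->
          (d (phi x * psi y)%g (omega z) <= (b%:R^-1)%:E)%E].
Proof.
suff [A [AE [G [d [phi [psi [omega [dm sep app]]]]]] le]] :
    exists A : {set X * Y}, [/\ A \subset E, embeds R lam b A &
      eps ^+ (b ^ (25 * b))%N * n%:R ^+ 2 <= #|A|%:R].
  by exists A, G, d, phi, psi, omega.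
have [n0|n_gt0] := posnP n.
  (* With [n = 0] there are no letters, so separation in the area metric is vacuous. *)
  exists finset.set0; split; first exact: finset.sub0set.
  - have no (T : finType) (x : T) : #|T| <> 0%N
      by apply/eqP; rewrite -lt0n; apply/card_gt0P; exists x.
    by apply: latin_metric => // x; case: (no _ x); rewrite (cardX, cardY, cardZ).
  by rewrite n0 expr0n mulr0 ler0n.
have eps1 := eps_le1 latin cardX cardY n_gt0 many_octahedra.
case: (leqP b 2) => [b2|b3].
  exists E; split=> //; first exact: embeds_small b2.
  apply: le_trans (card_cells latin cardX cardY n_gt0 many_octahedra).
  apply: ler_wpM2r; first by rewrite exprn_ge0 // ler0n.
  rewrite -[leRHS]expr1; apply: ler_wiXn2l => //; first exact: ltW.
  by rewrite expn_gt0 b_gt0.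
case: (leP eps (1 - (2 * b + 4)%:R^-1)) => [le|/ltW ge].
  exact: (embeds_sparse latin cardX cardY cardZ n_gt0 eps_gt0 many_octahedra b_gt0 b3 le).
exact: (embeds_near_one latin cardX cardY cardZ n_gt0 eps_gt0 many_octahedra b3 eps1 ge).
Qed.
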